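(* Let $(\Omega,d,\mu)$ be a locally compact, non-complete metric measure space, with $\mu$ a doubling measure. Suppose also that $\partial\Omega:=\overline\Omega\setminus\Omega$ is equipped with a Borel measure $\nu$ which is codimension $\theta$ Ahlfors regular with respect to $\mu$ for some $\theta>0$. Let $0<\alpha<1$, $1\le p<\infty$, and $1\le q\le\infty$ be such that $\alpha<1-\theta/p$. Then there exists a bounded linear extension operator $$\widetilde E:HB^\alpha_{p,q}(\partial\Omega,\nu)\to HB^{\alpha+\theta/p}_{p,q}(\Omega,\mu).$$ In particular, there exists $C\ge 1$, depending only on $\alpha$, $p$, $q$, $\theta$, and the doubling and codimensional Ahlfors regularity constants, such that $$\|\widetilde Ef\|_{HB^{\alpha+\theta/p}_{p,q}(\Omega,\mu)}\le C\|f\|_{HB^\alpha_{p,q}(\partial\Omega,\nu)}$$ for all $f\in HB^\alpha_{p,q}(\partial\Omega,\nu)$.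
   Context: Doubling: a Borel measure $\mu$ on a metric space is doubling if there is $C_\mu\ge 1$ (the doubling constant) with $0<\mu(B(x,2r))\le C_\mu\,\mu(B(x,r))<\infty$ for all points $x$ and all $r>0$. Boundary: $\overline\Omega$ is the metric completion of $\Omega$; since $\Omega$ is locally compact it is open in $\overline\Omega$. The measure $\mu$ is extended to $\overline\Omega$ by zero (i.e. $\mu(\partial\Omega)=0$). Balls $B(z,r)$ centered at $z\in\partial\Omega$ are balls of $\overline\Omega$. Codimension $\theta$ Ahlfors regularity: $\nu$ is codimension $\theta$ Ahlfors regular with respect to $\mu$ if there is $C_\theta\ge 1$ such that for all $z\in\partial\Omega$ and $0<r\le 2\operatorname{diam}(\partial\Omega)$, $$\frac{1}{C_\theta}\frac{\mu(B(z,r)\cap\Omega)}{r^\theta}\le\nu(B(z,r)\cap\partial\Omega)\le C_\theta\frac{\mu(B(z,r)\cap\Omega)}{r^\theta}.$$ Besov spaces: for a metric measure space $(X,d,\mu)$, $0<\alpha<1$, $1\le p<\infty$ and $f\in L^1_{\mathrm{loc}}(X,\mu)$, set $$\|f\|_{HB^\alpha_{p,q}(X,\mu)}:=\left(\int_0^\infty\left(\int_X\frac{1}{\mu(B(x,t))}\int_{B(x,t)}|f(y)-f(x)|^p\,d\mu(y)\,d\mu(x)\right)^{q/p}\frac{dt}{t^{\alpha q+1}}\right)^{1/q}$$ for $1\le q<\infty$, and $$\|f\|_{HB^\alpha_{p,\infty}(X,\mu)}:=\sup_{t>0}\frac{1}{t^{\alpha}}\left(\int_X\frac{1}{\mu(B(x,t))}\int_{B(x,t)}|f(y)-f(x)|^p\,d\mu(y)\,d\mu(x)\right)^{1/p}.$$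 The homogeneous Besov space $HB^\alpha_{p,q}(X,\mu)$ is the class of $f\in L^1_{\mathrm{loc}}(X,\mu)$ for which this seminorm is finite. Extension operator: a linear operator $E$ from functions on $\partial\Omega$ to functions on $\Omega$ is an extension operator if for each $f$ in its domain, $\lim_{r\to0^+}\frac{1}{\mu(B(z,r))}\int_{B(z,r)}|Ef-f(z)|\,d\mu=0$ for $\nu$-a.e. $z\in\partial\Omega$. *)

(* Defs.v *)
From HB Require Import structures.
From mathcomp Require Import all_boot all_order all_algebra.
From mathcomp Require Import all_classical all_reals all_analysis.

Set Implicit Arguments.
Unset Strict Implicit.
Unset Printing Implicit Defensive.

Import Order.TTheory GRing.Theory Num.Theory.
Import numFieldNormedType.Exports.

Local Open Scope classical_set_scope.
Local Open Scope ring_scope.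

#[short(type="completeMetricType")]
HB.structure Definition CompleteMetric (R : numDomainType) :=
  {T of CompletePseudoMetric R T & Metric R T}.

(* The same notion as the library's [completeType], as a predicate: it has to be
   negated for the subspace Omega. *)
Definition complete_space (T : uniformType) : Prop :=
  forall F : set_system T, ProperFilter F -> cauchy F -> exists x : T, F --> x.

Definition borel {R : realType} (X : completeMetricType R) :=
  g_sigma_algebraType (@open X).

(* Throughout, X is a complete metric space, and a metric measure space (A, d, m)
   is encoded by a subset A of X, with the restricted distance, and a Borel
   measure m on X, of which only the values on subsets of A are used.  Balls of
   the space A are the sets [ball x r `&` A].  A function on A is encoded by a
   function on X, of which only the values on A are used. *)
Section metric_measure_spaces.
Context {R : realType} {X : completeMetricType R}.
Local Open Scope ereal_scope.

Implicit Types (A Omega : set X) (m mu nu : {measure set (borel X) -> \bar R}).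
Implicit Types (f g : X -> R).

(* When Omega is a dense subset of X, the complete space X is the metric
   completion of Omega, so that this is the boundary of Omega. *)
Definition boundary Omega : set X := ~` Omega.

Definition diam A : \bar R := ereal_sup [set (mdist x y)%:E | x in A & y in A].

Definition doubling m A (C : R) : Prop :=
  forall (x : X) (r : R), A x -> (0 < r)%R ->
  [/\ 0 < m (ball x (2 * r)%R `&` A),
      m (ball x (2 * r)%R `&` A) <= C%:E * m (ball x r `&` A) &
      m (ball x r `&` A) < +oo].

Definition codim_Ahlfors_regular mu nu Omega (theta C : R) : Prop :=
  forall (z : X) (r : R),
  boundary Omega z -> (0 < r)%R -> r%:E <= 2%:E * diam (boundary Omega) ->
  C^-1%:E * (mu (ball z r `&` Omega) * (r `^ (- theta))%:E)
    <= nu (ball z r `&` boundary Omega)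
    <= C%:E * (mu (ball z r `&` Omega) * (r `^ (- theta))%:E).

Definition L1loc m A f : Prop :=
  measurable_fun (A : set (borel X)) (f : borel X -> R) /\
  forall x, A x -> exists2 r : R, (0 < r)%R &
    m.-integrable (ball x r `&` A) (EFin \o f).

Definition besov_energy m A (p : R) f (t : R) : \bar R :=
  \int[m]_(x in A) ((m (ball x t `&` A))^-1 *
    \int[m]_(y in ball x t `&` A) (`|f y - f x| `^ p)%:E).

(* The value at q = -oo is irrelevant: q is always at least 1. *)
Definition besov_seminorm m A (alpha p : R) (q : \bar R) f : \bar R :=
  match q with
  | q'%:E => (\int[@lebesgue_measure R]_(t in `]0%R, +oo[)
               (besov_energy m A p f t `^ (q' / p) *
                (t `^ (- (alpha * q' + 1)))%:E)) `^ q'^-1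
  | +oo => ereal_sup [set (t `^ (- alpha))%:E * besov_energy m A p f t `^ p^-1
                     | t in `]0%R, +oo[]
  | -oo => 0
  end.

Definition besov m A (alpha p : R) (q : \bar R) : set (X -> R) :=
  [set f | L1loc m A f /\ besov_seminorm m A alpha p q f < +oo].

(* Elements of D are functions on the boundary, and E maps them to functions on
   Omega; the first condition says that E is well defined on classes of almost
   everywhere equal functions. *)
Definition extension_operator mu nu Omega (D : set (X -> R))
    (E : (X -> R) -> (X -> R)) : Prop :=
  [/\ forall f g, D f -> D g -> f = g %[ae nu in boundary Omega] ->
        E f = E g %[ae mu in Omega],
      forall (a : R) f g, D f -> D g ->
        forall x, Omega x -> E (a \*o f \+ g)%R x = (a * E f x + E g x)%R &
      forall f, D f -> \forall z \ae nu, boundary Omega z ->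
        (mu (ball z r `&` Omega))^-1 *
          \int[mu]_(x in ball z r `&` Omega) `|E f x - f z|%:E
        @[r --> (0:R)^'+] --> (0 : \bar R)].

End metric_measure_spaces.

(* Main.v *)
Require Import Defs.
From HB Require Import structures.
From mathcomp Require Import finmap all_boot all_order all_algebra.
From mathcomp Require Import all_classical all_reals all_analysis.
From mathcomp Require Import measurable_realfun.
From mathcomp Require Import ring lra zify.

Set Implicit Arguments.
Unset Strict Implicit.
Unset Printing Implicit Defensive.

Import Order.TTheory GRing.Theory Num.Theory.
Import numFieldNormedType.Exports.

Local Open Scope classical_set_scope.
Local Open Scope ring_scope.

(** Let [Z] be the boundary and [delta x] the distance of [x] to [Z]. The
    extension of [f] at a point [x] of Omega is a mean of [f] over the points of
    [Z] whose distance to [x] is comparable to [delta x]: it is the integral of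
    [f] against the probability density [extension_kernel Z nu x], a cutoff
    function which varies with [x] in a Lipschitz way at the scale [delta x],
    divided by its mass.

    Let [mdist x y < t] and let [delta y] be about [t * 2 ^+ k]. If [k] is
    small, the two values of the extension are means of [f] at the scale [t];
    otherwise they are means at the scale [t * 2 ^+ k] for densities whose
    relative difference is at most about [2 ^- k]. In both cases Jensen's
    inequality bounds the [p]-th power of their difference by the mean, for the
    kernel at [x] or [y], of the [p]-oscillation of [f] on balls of radius about
    [t * 2 ^+ k], times [2 ^- (k * p)]. This is [extend_diff_le], where
    [osc_series] gathers all the possible values of [k].

    The energy at the scale [t] is the integral of these differences over the
    pairs of points at distance less than [t]. Averaging over balls of radius
    [t] is bounded on L^1 by doubling ([integral_average_le]). The operator that
    sends a function on [Z] to its means for the kernels is bounded from L^1 of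
    [Z] to L^1 of the points with [delta y < T], with norm at most a multiple of
    [T `^ theta] ([integral_average_kernel]): by Tonelli this amounts to the integral of the
    kernel in its first variable, which is where the codimension enters
    ([collar_mass]). Hence, up to constants, the energy of the extension at the
    scale [t] is at most the sum over [k] of
    [2 ^- (k * p) * (t * 2 ^+ k) `^ theta] times the energy of [f] at the scale
    [t * 2 ^+ (k + 6)] ([besov_energy_extend_le]).

    With the weights of the two seminorms, this sum over [k] is a convolution
    over the dyadic scales with the geometric weights
    [2 `^ (- (k * p * (1 - s)))], where [s = alpha + theta / p] is less than 1;
    convolution with summable weights is bounded on the sequence spaces to which
    the Besov seminorms are equivalent ([energy_seminorm_le]).

    For the traces, a finite seminorm makes the energies at the scales [2 ^- k]
    summable, so that the oscillation of [f] at [nu]-almost every boundary point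
    tends to 0 with the radius ([ae_osc_small]); the L^1 bound above, applied to
    the function [`|f v - f z|] near [z], bounds the mean of
    [`|extend f x - f z|] over a ball of centre [z] by this oscillation
    ([extend_trace_mean]).

    When the boundary is a single point [z], the codimension condition says
    nothing, and the extension by the constant [f z], or by 0 if [z] has measure
    0, has all the properties. *)

(** * Nonnegative integrals and Tonelli *)

Section nonneg_integral.
Local Open Scope ereal_scope.
Context d (T : measurableType d) (R : realType) (m : {measure set T -> \bar R}).
Implicit Types (A B : set T) (f g : T -> \bar R).

(** The integral of a nonnegative function is the supremum of the integrals of
    the simple functions below it, hence it is monotone on all functions; this
    is used for the energies as functions of the scale. *)
Lemma le_integral_ge0 A f g :
  (forall x, A x -> 0 <= f x) -> (forall x, A x -> f x <= g x) ->
  \int[m]_(x in A) f x <= \int[m]_(x in A) g x.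
Proof.
move=> f0 fg; rewrite !(integral_mkcond A).
have f0' x : 0 <= (f \_ A) x by apply: erestrict_ge0.
have g0' x : 0 <= (g \_ A) x.
  by apply: erestrict_ge0 => y Ay; apply: le_trans (fg _ Ay); apply: f0.
have fg' x : (f \_ A) x <= (g \_ A) x.
  by rewrite !patchE; case: ifPn => //; rewrite inE; apply: fg.
rewrite !ge0_integralTE//; apply: ereal_sup_le => _ /= [h hf <-].
by exists h => // x; apply: le_trans (fg' x).
Qed.

Lemma subset_integral_ge0 A B f : (forall x, B x -> 0 <= f x) -> A `<=` B ->
  \int[m]_(x in A) f x <= \int[m]_(x in B) f x.
Proof.
move=> f0 AB; rewrite !(integral_mkcond A) (integral_mkcond B).
apply: le_integral_ge0 => x _.
  by apply: erestrict_ge0 => y Ay; exact/f0/AB.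
rewrite !patchE; case: ifPn => [|_]; last first.
  by case: ifPn => //; rewrite inE; exact: f0.
by rewrite inE => /AB/mem_set ->.
Qed.

End nonneg_integral.

(** This packs a measure into the structure which Tonelli's theorem takes. *)
Lemma sigma_finite_measureP d (T : measurableType d) (R : realType)
    (m : {measure set T -> \bar R}) :
  sigma_finite setT m ->
  exists m' : {sigma_finite_measure set T -> \bar R}, m = m'.
Proof.
move=> sm.
pose H1 := isSFinite.Build _ _ _ _ (sfinite_measure_sigma_finite sm).
pose H2 := isSigmaFinite.Build _ _ _ _ sm.
pose m' := HB.pack_for (SigmaFiniteMeasure.type T R) (Measure.sort m) H1 H2.
by exists m'; exact: eq_measure.
Qed.

Section tonelli.
Local Open Scope ereal_scope.
Context d (T : measurableType d) d' (T' : measurableType d') (R : realType).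

Context (mu : {measure set T -> \bar R}) (nu : {measure set T' -> \bar R}).
Hypotheses (smu : sigma_finite setT mu) (snu : sigma_finite setT nu).
Context (k : T -> T' -> \bar R).
Hypothesis k0 : forall x y, 0 <= k x y.
Hypothesis mk : measurable_fun setT (fun z : T * T' => k z.1 z.2).

Lemma measurable_integralr (B : set T') : measurable B ->
  measurable_fun setT (fun x => \int[nu]_(y in B) k x y).
Proof.
move=> mB; have [nu' ->] := sigma_finite_measureP snu.
pose k' (z : T * T') := k z.1 z.2 * (\1_B z.2)%:E.
rewrite (_ : (fun _ => _) = fubini_F nu' k').
  apply: measurable_fun_fubini_tonelli_F => [|z]; last by rewrite mule_ge0.
  apply: emeasurable_funM => //; apply/measurable_EFinP.
  have mI : measurable_fun setT (\1_B : T' -> R) by exact: measurable_indic.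
  exact: (measurableT_comp mI measurable_snd).
apply/funext => x; rewrite /fubini_F (integral_mkcond B).
apply: eq_integral => y _ /=.
by rewrite /k' patchE indicE /=; case: ifPn; rewrite ?mule1 ?mule0.
Qed.

Lemma tonelli (A : set T) (B : set T') : measurable A -> measurable B ->
  \int[mu]_(x in A) \int[nu]_(y in B) k x y =
  \int[nu]_(y in B) \int[mu]_(x in A) k x y.
Proof.
move=> mA mB; have [nu' ->] := sigma_finite_measureP snu.
have [mu' ->] := sigma_finite_measureP smu.
pose k' (z : T * T') := k z.1 z.2 * (\1_(A `*` B) z)%:E.
have mk' : measurable_fun setT k'.
  apply: emeasurable_funM => //; apply/measurable_EFinP.
  by apply: measurable_indic; exact: measurableX.
have k'0 z : 0 <= k' z by rewrite mule_ge0.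
have := @fubini_tonelli _ _ _ _ _ mu' nu' _ mk' k'0; rewrite /fubini_F/fubini_G => kE.
transitivity (\int[mu']_x \int[nu']_y k' (x, y)).
  rewrite (integral_mkcond A).
  apply: eq_integral => x _; rewrite patchE; case: ifPn => xA; last first.
    rewrite integral0_eq// => y _; rewrite /k' indicE /= in_setX/=.
    by rewrite (negbTE xA) mule0.
  rewrite (integral_mkcond B).
  apply: eq_integral => y _; rewrite patchE /k' indicE in_setX/= xA/=.
  by case: ifPn; rewrite ?mule1 ?mule0.
rewrite kE; apply: esym.
rewrite (integral_mkcond B).
apply: eq_integral => y _; rewrite patchE; case: ifPn => yB; last first.
  rewrite integral0_eq// => x _; rewrite /k' indicE /= in_setX/=.
  by rewrite (negbTE yB) andbF mule0.
rewrite (integral_mkcond A).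
apply: eq_integral => x _; rewrite patchE /k' indicE in_setX/= yB andbT.
by case: ifPn; rewrite ?mule1 ?mule0.
Qed.

End tonelli.

(** * Powers, geometric series and dyadic decompositions *)

Section power_inequalities.
Context {R : realType}.
Implicit Types (a b c p r t x y : R).

(** The convex function [y `^ p] is above its tangent at [c], by Young's
    inequality. *)
Lemma powR_tangent c y p : 0 <= c -> 0 <= y -> 1 <= p ->
  p * c `^ (p - 1) * y <= (p - 1) * c `^ p + y `^ p.
Proof.
move=> c0 y0; rewrite le_eqVlt => /predU1P[<-|p1].
  by rewrite subrr powRr0 !mul1r mul0r add0r powRr1.
have p0 : 0 < p by lra.
have q0 : 0 < p / (p - 1) by rewrite divr_gt0// subr_gt0.
have := @conjugate_powR _ y (c `^ (p - 1)) p (p / (p - 1)) y0 (powR_ge0 _ _) p0 q0.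
rewrite -powRrM (_ : (p - 1) * (p / (p - 1)) = p); last by field; lra.
move=> /(_ _)/wrap[]; first by field; lra.
rewrite -(ler_pM2l p0).
rewrite [leLHS](_ : _ = p * c `^ (p - 1) * y); last by ring.
rewrite [leRHS](_ : _ = (p - 1) * c `^ p + y `^ p)//; field; lra.
Qed.

Lemma powRD_le a b p : 0 <= a -> 0 <= b -> 0 <= p ->
  (a + b) `^ p <= 2 `^ p * (a `^ p + b `^ p).
Proof.
move=> a0 b0 p0.
have h x y : 0 <= y -> y <= x -> (x + y) `^ p <= 2 `^ p * (x `^ p + y `^ p).
  move=> y0 yx; apply: (@le_trans _ _ ((2 * x) `^ p)).
    by apply: ge0_ler_powR; rewrite ?nnegrE; lra.
  by rewrite powRM ?ler_wpM2l ?powR_ge0 ?lerDl ?powR_ge0//; lra.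
have [ab|/ltW ba] := leP a b; last exact: h.
by rewrite addrC [X in _ <= _ * X]addrC; exact: h.
Qed.

End power_inequalities.

Section jensen.
Local Open Scope ereal_scope.
Context d (T : measurableType d) (R : realType) (m : {measure set T -> \bar R}).

(** Jensen's inequality for the probability density [k] is the integral of the
    tangent inequality at the mean of [h]. *)
Lemma jensen_powR (A : set T) (k h : T -> R) (p : R) :
  measurable A -> (1 <= p)%R ->
  measurable_fun A k -> measurable_fun A h ->
  (forall x, A x -> (0 <= k x)%R) -> (forall x, A x -> (0 <= h x)%R) ->
  \int[m]_(x in A) (k x)%:E = 1 ->
  (\int[m]_(x in A) (k x * h x)%:E) `^ p <=
  \int[m]_(x in A) (k x * h x `^ p)%:E.
Proof.
move=> mA p1 mk mh k0 h0 k1.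
have p0 : (0 < p)%R by lra.
have mkE : measurable_fun A (EFin \o k) by exact/measurable_EFinP.
have mkh : measurable_fun A (fun x => (k x * h x)%:E).
  by apply/measurable_EFinP/measurable_funM.
have mhp : measurable_fun A (fun x => h x `^ p)%R.
  exact: (measurableT_comp (measurable_powR p) mh).
have mkhp : measurable_fun A (fun x => (k x * h x `^ p)%:E).
  by apply/measurable_EFinP/measurable_funM.
have kh0 x : A x -> 0 <= (k x * h x)%:E by move=> Ax; rewrite lee_fin mulr_ge0 ?k0 ?h0.
have khp0 x : A x -> 0 <= (k x * h x `^ p)%:E.
  by move=> Ax; rewrite lee_fin mulr_ge0 ?k0 ?powR_ge0.
have I0 : 0 <= \int[m]_(x in A) (k x * h x)%:E by exact: integral_ge0.
have tangent (c : R) : (0 <= c)%R ->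
  (p * c `^ (p - 1))%:E * \int[m]_(x in A) (k x * h x)%:E <=
  ((p - 1) * c `^ p)%:E + \int[m]_(x in A) (k x * h x `^ p)%:E.
  move=> c0.
  have e0 : (0 <= (p - 1) * c `^ p)%R by rewrite mulr_ge0 ?powR_ge0//; lra.
  have e1 : (0 <= p * c `^ (p - 1))%R by rewrite mulr_ge0 ?powR_ge0//; lra.
  rewrite -(ge0_integralZl_EFin _ mA kh0 mkh e1).
  rewrite -[X in _ <= X + _]mule1 -k1 -(ge0_integralZl_EFin _ mA _ mkE e0); last first.
    by move=> x Ax; rewrite lee_fin k0.
  rewrite -ge0_integralD//.
  - apply: ge0_le_integral => //.
    + by move=> x Ax; rewrite mule_ge0 ?kh0 ?lee_fin.
    + exact: measurable_funeM.
    + by apply: emeasurable_funD => //; exact: measurable_funeM.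
    + move=> x Ax; rewrite -!EFinM -EFinD lee_fin.
      have := powR_tangent c0 (h0 _ Ax) p1 => /(ler_wpM2l (k0 _ Ax)).
      by congr (_ <= _)%R; ring.
  - by move=> x Ax; rewrite mule_ge0 ?lee_fin ?k0.
  - exact: measurable_funeM.
have [Ioo|Ioo] := eqVneq (\int[m]_(x in A) (k x * h x)%:E) +oo.
  have := tangent 1%R ler01; rewrite Ioo poweRyr ?gt_eqF// !powR1 !mulr1.
  rewrite mulry gtr0_sg// mul1e.
  by case: (\int[m]_(x in A) (k x * h x `^ p)%:E).
have Ifin : \int[m]_(x in A) (k x * h x)%:E \is a fin_num.
  by rewrite ge0_fin_numE// lt_neqAle Ioo leey.
have := tangent _ (fine_ge0 I0).
rewrite -(fineK Ifin); move: (fine _) (fine_ge0 I0) => c c0.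
rewrite poweR_EFin -EFinM -mulrA [(_ `^ (p - 1) * _)%R]mulrC mulr_powRB1//.
case: (\int[m]_(x in A) (k x * h x `^ p)%:E) => [I| |//].
  by rewrite -EFinD !lee_fin/=; lra.
by move=> _; rewrite leey.
Qed.

End jensen.

Section dyadic.
Context {R : realType}.
Implicit Types (t : R) (n : int).

Lemma exprz2_powR n : (2 : R) ^ n = 2 `^ n%:~R.
Proof. by rewrite powR_intmul. Qed.

Lemma exprz2_gt0 n : 0 < (2 : R) ^ n.
Proof. exact: exprz_gt0. Qed.

Lemma exprz2S n : (2 : R) ^ (n + 1) = 2 * 2 ^ n.
Proof. by rewrite expfzDr// mulrC. Qed.

Lemma dyadic_floor t : 0 < t -> exists n, 2 ^ n <= t < (2 : R) ^ (n + 1).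
Proof.
move=> t0; have l2 : 0 < ln (2 : R) by rewrite ln_gt0// ltr1n.
exists (Num.floor (ln t / ln 2)).
have /andP[h1 h2] := floor_itv (ln t / ln (2 : R)).
rewrite !exprz2_powR /powR gt_eqF//.
rewrite -{2 3}(lnK t0) ler_expR ltr_expR.
by rewrite -ler_pdivlMr// -ltr_pdivrMr// h1 h2.
Qed.

Lemma dyadic_uniq t n k : 2 ^ n <= t < (2 : R) ^ (n + 1) ->
  2 ^ k <= t < (2 : R) ^ (k + 1) -> n = k.
Proof.
have two : 1 < (2 : R) by rewrite ltr1n.
move=> /andP[a b] /andP[c e].
have := le_lt_trans a e; have := le_lt_trans c b.
by rewrite !ltr_eXz2l//; lia.
Qed.

End dyadic.

Section series.
Local Open Scope ereal_scope.
Context {R : realType}.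

Lemma nneseries_geometric (a x : R) : (0 <= x)%R -> (x < 1)%R ->
  \sum_(k <oo) (a * x ^+ k)%:E = (a / (1 - x))%:E.
Proof.
move=> x0 x1; apply/cvg_lim => //.
rewrite [X in X @ \oo --> _](_ : _ = EFin \o series (geometric a x)).
  apply: cvg_EFin; first by near=> n.
  by apply: cvg_geometric_series; rewrite ger0_norm.
by apply/funext => n; rewrite /= /series/= sumEFin.
Unshelve. all: by end_near. Qed.

Lemma poweR_le (r : R) (a b : \bar R) : (0 <= r)%R -> 0 <= a -> a <= b ->
  a `^ r <= b `^ r.
Proof.
move=> r0 a0 ab; apply: gt0_ler_poweR => //; rewrite in_itv/= leey ?a0//=.
by rewrite andbT (le_trans a0).
Qed.

Lemma poweRVK (r : R) (a : \bar R) : (0 < r)%R -> 0 <= a -> (a `^ r^-1) `^ r = a.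
Proof. by move=> r0 a0; rewrite -poweRrM mulVf ?gt_eqF// poweRe1. Qed.

Lemma poweRKV (r : R) (a : \bar R) : (0 < r)%R -> 0 <= a -> (a `^ r) `^ r^-1 = a.
Proof. by move=> r0 a0; rewrite -poweRrM mulfV ?gt_eqF// poweRe1. Qed.

Lemma nneseries_ge_term (u : nat -> \bar R) k : (forall i, 0 <= u i) ->
  u k <= \sum_(i <oo) u i.
Proof.
move=> u0; rewrite (@nneseriesD1 _ _ k)// leeDl// nneseries_ge0//.
Qed.

(** One of the two factors [y ^+ k] of the weight makes the [k]-th term at most
    the [r]-th root of the sum on the right, and the other factors have the sum
    [(1 - y)^-1]. The argument treats [r < 1] and [1 <= r] alike. *)
Lemma poweR_geometric_le (r y : R) (c : nat -> \bar R) :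
  (0 < r)%R -> (0 < y)%R -> (y < 1)%R -> (forall k, 0 <= c k) ->
  (\sum_(k <oo) ((y * y) ^+ k)%:E * c k) `^ r <=
  ((1 - y)^-1 `^ r)%:E * \sum_(k <oo) ((y `^ r) ^+ k)%:E * c k `^ r.
Proof.
move=> r0 y0 y1 c0; set S := \sum_(k <oo) ((y `^ r) ^+ k)%:E * c k `^ r.
have t0 k : 0 <= ((y `^ r) ^+ k)%:E * c k `^ r.
  by rewrite mule_ge0 ?poweR_ge0// lee_fin exprn_ge0// powR_ge0.
have S0 : 0 <= S by exact: nneseries_ge0.
have yk0 k : (0 <= y ^+ k)%R by rewrite exprn_ge0// ltW.
have le_s k : (y ^+ k)%:E * c k <= S `^ r^-1.
  have -> : (y ^+ k)%:E * c k = (((y `^ r) ^+ k)%:E * c k `^ r) `^ r^-1.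
    rewrite poweRM ?lee_fin ?exprn_ge0 ?powR_ge0 ?poweR_ge0// poweRKV//.
    congr (_ * _); rewrite poweR_EFin; congr EFin.
    rewrite -!powR_mulrn ?powR_ge0 ?(ltW y0)//.
    by rewrite -!powRrM [(r * _)%R]mulrC -!mulrA mulVf ?gt_eqF// mulr1.
  by apply: poweR_le; rewrite ?invr_ge0 ?(ltW r0)//; exact: nneseries_ge_term.
have le_S : \sum_(k <oo) ((y * y) ^+ k)%:E * c k <= (1 - y)^-1%:E * S `^ r^-1.
  have [Soo|Soo] := eqVneq (S `^ r^-1) +oo.
    by rewrite Soo gt0_muley ?leey// lte_fin invr_gt0 subr_gt0.
  have Sfin : S `^ r^-1 \is a fin_num.
    by rewrite ge0_fin_numE ?poweR_ge0// lt_neqAle Soo leey.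
  rewrite -(fineK Sfin) -EFinM [(_^-1 * _)%R]mulrC -nneseries_geometric ?(ltW y0)//.
  apply: lee_nneseries => k _; first by rewrite mule_ge0// lee_fin exprn_ge0// mulr_ge0// ltW.
  rewrite EFinM fineK// exprMn EFinM -muleA muleC.
  by apply: lee_wpmul2r; rewrite ?lee_fin.
apply: le_trans (poweR_le (ltW r0) _ le_S) _.
  apply: nneseries_ge0 => k _ _.
  by rewrite mule_ge0// lee_fin exprn_ge0// mulr_ge0// ltW.
rewrite poweRM ?poweR_ge0 ?lee_fin ?invr_ge0 ?subr_ge0 ?(ltW y1)//.
by rewrite poweRVK.
Qed.

End series.

Lemma powR2N_lt1 (R : realType) (t : R) : 0 < t -> 2 `^ (- t) < 1 :> R.
Proof.
move=> t0; have l2 : 0 < ln (2 : R) by rewrite ln_gt0// ltr1n.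
by rewrite /powR gt_eqF// expR_lt1 mulNr oppr_lt0 mulr_gt0.
Qed.

Lemma poweRD_le (R : realType) (a b : \bar R) (p : R) :
  (0 <= a -> 0 <= b -> 0 <= p%:E ->
  (a + b) `^ p <= (2 `^ p)%:E * (a `^ p + b `^ p))%E.
Proof.
move=> a0 b0; rewrite lee_fin => p0.
have [->|p0'] := eqVneq p 0; first by rewrite !poweRe0 powRr0 mul1e leeDl.
have y0 x : (0 <= x -> (2 `^ p)%:E * (+oo + x) = +oo :> \bar R)%E.
  move=> x0; rewrite addye ?gt0_muley ?lte_fin ?powR_gt0//.
  by rewrite -ltNye (lt_le_trans _ x0).
case: a b a0 b0 => [a| |] [b| |]//; rewrite ?lee_fin => a0 b0.
- exact: powRD_le.
- by rewrite addeC [(_ `^ p + _)%E]addeC poweRyr// y0 ?leey// poweR_ge0.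
- by rewrite poweRyr// y0 ?leey// poweR_ge0.
- by rewrite poweRyr// y0 ?leey.
Qed.

Lemma le_absz_succ (n : int) : n + 1 <= (`|n|.+1)%:Z.
Proof. lia. Qed.

Lemma cvg0_at_right (R : realType) (g : R -> \bar R) :
  (forall r, 0 < r -> (0 <= g r)%E) ->
  (forall e, 0 < e -> exists2 d, 0 < d & forall r, 0 < r -> r < d -> (g r <= e%:E)%E) ->
  g r @[r --> 0^'+] --> 0%E.
Proof.
move=> g0 small; apply/fine_cvgP; split.
  have [d d0 gd] := small 1 ltr01; near=> r.
  have r0 : 0 < r by near: r; exact: nbhs_right_gt.
  rewrite ge0_fin_numE ?g0//; apply: le_lt_trans (gd _ r0 _) _; last by rewrite ltry.
  by near: r; exact: nbhs_right_lt.
apply/cvgrPdist_le => e e0; have [d d0 gd] := small e e0; near=> r.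
have r0 : 0 < r by near: r; exact: nbhs_right_gt.
have rd : r < d by near: r; exact: nbhs_right_lt.
have := gd _ r0 rd; rewrite /= sub0r normrN => h.
have gf : g r \is a fin_num by rewrite ge0_fin_numE ?g0// (le_lt_trans h)// ltry.
by rewrite ger0_norm ?fine_ge0 ?g0// -lee_fin fineK.
Unshelve. all: by end_near. Qed.

Section dyadic_integral.
Local Open Scope ereal_scope.
Context {R : realType}.
Let I (n : int) : set (measurableTypeR R) := `[2 ^ n, 2 ^ (n + 1)[%classic.
Let F (k : nat) : set (measurableTypeR R) := if @pickle_inv int k is Some n then I n else set0.

Let I_measurable n : measurable (I n).
Proof. exact: measurable_itv. Qed.

Let F_measurable k : measurable (F k).
Proof. by rewrite /F; case: pickle_inv. Qed.

Let lebesgue_I n : lebesgue_measure (I n) = (2 ^ n)%:E.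
Proof.
rewrite /I lebesgue_measure_itv/= lte_fin exprz2S.
have := exprz2_gt0 (R := R) n => n0.
by rewrite ifT -?EFinB; [congr EFin; ring|lra].
Qed.

Let bigcup_F : \bigcup_k F k = `]0%R, +oo[%classic.
Proof.
apply/seteqP; split => [t [k _]|t].
  rewrite /F; case: pickle_inv => // n; rewrite /I/= !in_itv/= andbT => /andP[+ _].
  exact/lt_le_trans/exprz2_gt0.
rewrite /= in_itv/= andbT => /dyadic_floor[n nt]; exists (pickle n); first exact: Logic.I.
by rewrite /F pickleK_inv /I/= in_itv.
Qed.

Let trivIset_F : trivIset setT F.
Proof.
move=> i j _ _ [t []]; rewrite /F.
case ei : pickle_inv => [n|//]; case ej : pickle_inv => [k|//].
rewrite /I/= !in_itv/= => /dyadic_uniq h /h nk.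
have := @pickle_invK int i; have := @pickle_invK int j; rewrite ei ej/= => <- <-.
by rewrite nk.
Qed.

(** The intervals [I n] are a partition of the half-line and [I n] has length
    [2 ^ n]; they are numbered by the natural numbers through [pickle]. *)
Let integral_step (s : R -> \bar R) (c : int -> \bar R) :
  (forall n, 0 <= c n) ->
  (forall n t, (2 ^ n <= t < 2 ^ (n + 1))%R -> s t = c n) ->
  \int[lebesgue_measure]_(t in `]0%R, +oo[) s t =
  \esum_(n in [set: int]) (c n * (2 ^ n)%:E).
Proof.
move=> c0 sc; rewrite -bigcup_F ge0_integral_bigcup//.
- transitivity (\sum_(k <oo)
    (if @pickle_inv int k is Some n then c n * (2 ^ n)%:E else 0)).
    apply: eq_eseriesr => k _; rewrite /F; case: pickle_inv => [n|].
      rewrite (eq_integral (cst (c n))); last first.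
        by move=> t; rewrite inE /I/= in_itv/= => /sc.
      apply: etrans; first exact: (integral_cst _ (I_measurable n) (c n)).
      by congr (_ * _); exact: lebesgue_I.
    by rewrite integral_set0.
  rewrite nneseries_esumT; last first.
    move=> k; case: pickle_inv => // n; rewrite mule_ge0// lee_fin.
    exact/ltW/exprz2_gt0.
  rewrite (esumID (range (@pickle int)))//; last first.
    move=> k _; case: pickle_inv => // n; rewrite mule_ge0// lee_fin.
    exact/ltW/exprz2_gt0.
  rewrite [X in _ + X]esum1 ?adde0 ?setTI; last first.
    move=> k /=; case e : pickle_inv => [n|//] []; exists n => //.
    by have := @pickle_invK int k; rewrite e.
  rewrite esum_image.
    by apply: eq_esum => n _; rewrite pickleK_inv.
  by move=> i j _ _ /(congr1 (@pickle_inv int)); rewrite !pickleK_inv => -[].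
- apply/measurable_fun_bigcup => // k; rewrite /F; case: pickle_inv => [n|].
    apply: (eq_measurable_fun (cst (c n))) => // t.
    by rewrite inE /I/= in_itv/= => /sc.
  exact: measurable_fun_set0.
- move=> t [k _]; rewrite /F; case: pickle_inv => // n.
  by rewrite /I/= in_itv/= => /sc ->.
Qed.

Let idx (t : R) : int := xget 0%R [set n | (2 ^ n <= t < 2 ^ (n + 1))%R].

Let idxE n t : (2 ^ n <= t < 2 ^ (n + 1))%R -> idx t = n.
Proof.
move=> nt; rewrite /idx; case: xgetP => [k -> /= kt|/(_ n)//].
exact: dyadic_uniq kt nt.
Qed.

Lemma dyadic_integral_ge (h : R -> \bar R) (c : int -> \bar R) :
  (forall n, 0 <= c n) ->
  (forall n t, (2 ^ n <= t < 2 ^ (n + 1))%R -> c n <= h t) ->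
  \esum_(n in [set: int]) (c n * (2 ^ n)%:E) <=
  \int[lebesgue_measure]_(t in `]0%R, +oo[) h t.
Proof.
move=> c0 ch; rewrite -(integral_step (s := c \o idx))//; last first.
  by move=> n t /idxE/= ->.
apply: le_integral_ge0 => t /=; rewrite ?in_itv/= ?andbT => t0 //.
by have [n nt] := dyadic_floor t0; rewrite (idxE nt); exact: ch.
Qed.

Lemma dyadic_integral_le (h : R -> \bar R) (c : int -> \bar R) :
  (forall t, (0 < t)%R -> 0 <= h t) -> (forall n, 0 <= c n) ->
  (forall n t, (2 ^ n <= t < 2 ^ (n + 1))%R -> h t <= c n) ->
  \int[lebesgue_measure]_(t in `]0%R, +oo[) h t <=
  \esum_(n in [set: int]) (c n * (2 ^ n)%:E).
Proof.
move=> h0 c0 ch; rewrite -(integral_step (s := c \o idx))//; last first.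
  by move=> n t /idxE/= ->.
apply: le_integral_ge0 => t /=; rewrite ?in_itv/= ?andbT => t0; first exact: h0.
by have [n nt] := dyadic_floor t0; rewrite (idxE nt); exact: ch.
Qed.

End dyadic_integral.

(** * Besov seminorms as sums over the dyadic scales *)

Lemma powR_half_exp (R : realType) (p : R) k : (2^-1 ^+ k) `^ p = (2 `^ (- p)) ^+ k :> R.
Proof.
have h : 2^-1 = 2 `^ (-1) :> R by rewrite powR_inv1.
by rewrite h -(powR_mulrn k (powR_ge0 2 (-1))) -(powR_mulrn k (powR_ge0 2 (- p)))
  -!powRrM; congr (_ `^ _); ring.
Qed.

Section esum.
Local Open Scope ereal_scope.
Context {R : realType}.

Lemma le_esumZl (T : choiceType) (k : R) (a : T -> \bar R) : (0 <= k)%R ->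
  (forall i, 0 <= a i) ->
  \esum_(i in [set: T]) (k%:E * a i) <= k%:E * \esum_(i in [set: T]) a i.
Proof.
move=> k0 a0; apply: ge_ereal_sup => _ [F [finF FT] <-].
rewrite -ge0_mule_fsumr//; apply: lee_wpmul2l; first by rewrite lee_fin.
by apply: esum_ge; exists F.
Qed.

Lemma esum_exchange (T U : choiceType) (a : T -> U -> \bar R) :
  (forall i j, 0 <= a i j) ->
  \esum_(i in [set: T]) \esum_(j in [set: U]) a i j =
  \esum_(j in [set: U]) \esum_(i in [set: T]) a i j.
Proof.
move=> a0; rewrite !esum_esum//.
rewrite (@reindex_esum _ _ _ ([set: U] `*`` (fun=> [set: T])) _ (fun z => (z.2, z.1)))//.
split => //; first by move=> [i j] [i' j'] _ _ [-> ->].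
by move=> [i j] _; exists (j, i).
Qed.

Lemma esum_shift (m : int) (a : int -> \bar R) :
  \esum_(n in [set: int]) a (n + m)%R = \esum_(n in [set: int]) a n.
Proof.
rewrite [RHS](@reindex_esum _ _ _ [set: int] _ (fun n => n + m)%R)//.
split => //; first by move=> i j _ _ /addIr.
by move=> i _; exists (i - m)%R => //; rewrite subrK.
Qed.

(** Young's inequality for the convolution of two summable sequences: each
    translate of [a] has the same sum. *)
Lemma esum_convolution_le (w : nat -> R) (m : nat) (a : int -> \bar R) :
  (forall k, 0 <= w k)%R -> (forall n, 0 <= a n) ->
  \esum_(n in [set: int]) \sum_(k <oo) (w k)%:E * a (n + (k + m)%N%:Z)%R <=
  (\sum_(k <oo) (w k)%:E) * \esum_(n in [set: int]) a n.
Proof.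
move=> w0 a0.
have t0 n k : 0 <= (w k)%:E * a (n + (k + m)%N%:Z)%R by rewrite mule_ge0// lee_fin.
under eq_esum do rewrite nneseries_esumT//.
rewrite esum_exchange// -nneseries_esumT//; last by move=> k; exact: esum_ge0.
have [->|S0] := eqVneq (\esum_(n in [set: int]) a n) +oo.
  have [w1|w1] := pselect (exists k, (0 < w k)%R).
    rewrite gt0_muley ?leey//; have [k wk] := w1.
    by apply: lt_le_trans (nneseries_ge_term k _); rewrite ?lte_fin// => i; rewrite lee_fin.
  have wE k : w k = 0%R by apply/eqP; rewrite eq_le w0 andbT leNgt; apply/negP => wk; apply: w1; exists k.
  rewrite !eseries0 ?mul0e// => k _ _; rewrite ?wE//.
  by rewrite esum1// => n _; rewrite mul0e.
have Sf : \esum_(n in [set: int]) a n \is a fin_num.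
  by rewrite ge0_fin_numE ?esum_ge0// lt_neqAle S0 leey.
rewrite muleC -(fineK Sf) -nneseriesZl ?fine_ge0 ?esum_ge0//; last by move=> k _; rewrite lee_fin.
apply: lee_nneseries => [k _ _|k _]; first exact: esum_ge0.
apply: le_trans (le_esumZl (a := fun n => a (n + (k + m)%N%:Z)%R) _ _) _ => //.
by rewrite esum_shift muleC fineK.
Qed.

End esum.

(** The Besov seminorm as a function of the energies, which are all that it
    depends on. *)
Definition energy_seminorm {R : realType} (alpha p : R) (q : \bar R)
    (e : R -> \bar R) : \bar R :=
  match q with
  | q'%:E => ((\int[@lebesgue_measure R]_(t in `]0%R, +oo[)
               (e t `^ (q' / p) * (t `^ (- (alpha * q' + 1)))%:E)) `^ q'^-1)%E
  | +oo%E => ereal_sup [set ((t `^ (- alpha))%:E * e t `^ p^-1)%E | t in `]0%R, +oo[]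
  | -oo%E => 0%E
  end.

Section energy_seminorm.
Context {R : realType}.

Lemma energy_seminorm_ge0 (alpha p : R) q (e : R -> \bar R) :
  (forall t, 0 <= e t)%E -> (0 <= energy_seminorm alpha p q e)%E.
Proof.
case: q => [q| |]// e0; first exact: poweR_ge0.
apply: (@le_trans _ _ ((1 `^ (- alpha))%:E * e 1%R `^ p^-1)%E).
  by rewrite mule_ge0 ?poweR_ge0// lee_fin powR_ge0.
by apply: ereal_sup_ubound; exists 1 => //=; rewrite in_itv/= ltr01.
Qed.

Lemma energy_seminorm0 (alpha p : R) q (e : R -> \bar R) : 0 < p -> (1%:E <= q)%E ->
  (forall t, 0 < t -> e t = 0%E) -> energy_seminorm alpha p q e = 0%E.
Proof.
move=> p0; case: q => [q| |]//= q1 e0; rewrite ?lee_fin in q1.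
  have q0 : 0 < q := lt_le_trans ltr01 q1.
  rewrite integral0_eq ?poweR0r ?gt_eqF ?invr_gt0// => t; rewrite /= in_itv/= andbT => t0.
  by rewrite e0// poweR0r ?mul0e// gt_eqF// divr_gt0.
apply/eqP; rewrite eq_le; apply/andP; split; last first.
  apply: (@le_trans _ _ ((1 `^ (- alpha))%:E * e 1%R `^ p^-1)%E).
    by rewrite mule_ge0 ?poweR_ge0// lee_fin powR_ge0.
  by apply: ereal_sup_ubound; exists 1 => //=; rewrite in_itv/= ltr01.
apply: ge_ereal_sup => _ [t + <-]; rewrite /= in_itv/= andbT => t0.
by rewrite e0// poweR0r ?mule0// gt_eqF// invr_gt0.
Qed.

Lemma besov_seminormE (X : completeMetricType R) m (A : set X) (alpha p : R) q f :
  besov_seminorm m A alpha p q f = energy_seminorm alpha p q (besov_energy m A p f).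
Proof. by []. Qed.

Context (p q : R).
Hypotheses (p1 : 1 <= p) (q1 : 1 <= q).
Let r := q / p.
Let p0 : 0 < p := lt_le_trans ltr01 p1.
Let q0 : 0 < q := lt_le_trans ltr01 q1.
Let r0 : 0 < r := divr_gt0 q0 p0.

Local Open Scope ereal_scope.

(** With this weight the seminorm of smoothness [s] is equivalent to the
    l^(q/p) size of these numbers, to the power [p^-1]. *)
Definition dyadic_energy (s : R) (e : R -> \bar R) (n : int) : \bar R :=
  ((2 ^ n) `^ (- (s * p)))%:E * e (2 ^ n)%R.

Section energy.
Context (s c : R) (e : R -> \bar R).
Hypotheses (c1 : (1 <= c)%R) (e0 : forall t, 0 <= e t).
Hypothesis e_doubling : forall t u, (0 < t)%R -> (t <= u)%R -> (u <= 2 * t)%R ->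
  e t <= c%:E * e u.

Lemma dyadic_energy_ge0 n : 0 <= dyadic_energy s e n.
Proof. by rewrite mule_ge0// lee_fin powR_ge0. Qed.

Let c0 : (0 < c)%R := lt_le_trans ltr01 c1.

Lemma dyadic_energy_powR n : dyadic_energy s e n `^ r =
  ((2 ^ n) `^ (- (s * q)))%:E * e (2 ^ n)%R `^ r.
Proof.
rewrite poweRM ?lee_fin ?powR_ge0// poweR_EFin -powRrM.
by congr ((_ `^ _)%:E * _); rewrite /r; field; rewrite gt_eqF.
Qed.

Let h t := e t `^ r * (t `^ (- (s * q + 1)))%:E.

Let powRN_le (x y u : R) : (0 < x)%R -> (x <= y)%R -> (0 <= u)%R ->
  (y `^ (- u) <= x `^ (- u))%R.
Proof.
move=> x0 xy u0; rewrite !powRN lef_pV2 ?posrE ?powR_gt0 ?(lt_le_trans x0)//.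
by apply: ge0_ler_powR; rewrite ?nnegrE ?(ltW x0)// (le_trans (ltW x0)).
Qed.

Let powRND1 (x u : R) : (0 < x)%R -> (x `^ (- (u + 1)) = x `^ (- u) / x)%R.
Proof.
move=> x0; rewrite !powRN -invfM; congr (_^-1)%R.
by rewrite powRD ?powRr1 ?(ltW x0)// (gt_eqF x0) implybT.
Qed.

Let e_powR t u : (0 < t)%R -> (t <= u)%R -> (u <= 2 * t)%R ->
  e t `^ r <= (c `^ r)%:E * e u `^ r.
Proof.
move=> t0 tu ut; apply: le_trans (poweR_le (ltW r0) (e0 t) (e_doubling t0 tu ut)) _.
by rewrite poweRM ?lee_fin ?(ltW c0)// poweR_EFin.
Qed.

(** For [2 ^ n <= t < 2 ^ (n + 1)] the energy at [t] is at least the energy at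
    [2 ^ n] up to the doubling constant, and the weight varies by a bounded
    factor. *)
Lemma dyadic_energy_le_integral : (0 <= s * q + 1)%R ->
  \esum_(n in [set: int]) dyadic_energy s e n `^ r <=
  (c `^ r * 2 `^ (s * q + 1))%:E * \int[lebesgue_measure]_(t in `]0%R, +oo[) h t.
Proof.
move=> sq0; set K := (c `^ r * 2 `^ (s * q + 1))%R.
have K0 : (0 < K)%R by rewrite mulr_gt0// powR_gt0.
pose b n := (K^-1)%:E * (dyadic_energy s e n `^ r * ((2 ^ n)^-1)%:E).
have b0 n : 0 <= b n.
  by rewrite !mule_ge0 ?poweR_ge0// lee_fin invr_ge0 ltW// exprz2_gt0.
apply: (@le_trans _ _ (K%:E * \esum_(n in [set: int]) (b n * (2 ^ n)%:E))).
  apply: le_trans (le_esumZl _ _) => //; last 2 first.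
  - exact: ltW.
  - by move=> n; rewrite mule_ge0// lee_fin ltW// exprz2_gt0.
  rewrite le_eqVlt; apply/orP; left; apply/eqP; apply: eq_esum => n _.
  rewrite /b !muleA -EFinM mulfV ?gt_eqF// mul1e -muleA -EFinM mulVf ?mule1//.
  by rewrite gt_eqF// exprz2_gt0.
apply: lee_wpmul2l; first by rewrite lee_fin ltW.
apply: dyadic_integral_ge => // n t /andP[nt tn].
have n0 : (0 < (2 : R) ^ n)%R := exprz2_gt0 n.
have t0 := lt_le_trans n0 nt.
rewrite exprz2S in tn.
rewrite /b dyadic_energy_powR (muleAC _ (e _ `^ r)) -EFinM muleA -EFinM.
set A := (K^-1 * _)%R.
have A0 : (0 <= A)%R.
  by rewrite mulr_ge0 ?invr_ge0 ?(ltW K0)// mulr_ge0 ?powR_ge0// invr_ge0 ltW.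
apply: (@le_trans _ _ (A%:E * ((c `^ r)%:E * e t `^ r))).
  apply: lee_wpmul2l; first by rewrite lee_fin.
  by apply: e_powR => //; exact: ltW.
rewrite muleA muleC /h; apply: lee_wpmul2l; first exact: poweR_ge0.
rewrite -EFinM lee_fin; apply: (@le_trans _ _ ((2 * 2 ^ n) `^ (- (s * q + 1)))%R).
  rewrite (powRM _ _ (ltW n0))// (powRND1 _ n0) (powRN 2) /A /K le_eqVlt.
  by apply/orP; left; apply/eqP; field; rewrite !gt_eqF ?powR_gt0.
by apply: powRN_le => //; exact: ltW.
Qed.

(** Here the energy at [t] is compared with the energy at [2 ^ (n + 1)], hence a
    shift of the index in the sum. *)
Lemma integral_le_dyadic_energy : (0 <= s * q + 1)%R ->
  \int[lebesgue_measure]_(t in `]0%R, +oo[) h t <=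
  (c `^ r * 2 `^ (s * q))%:E * \esum_(n in [set: int]) dyadic_energy s e n `^ r.
Proof.
move=> sq0; set K := (c `^ r * 2 `^ (s * q))%R.
have K0 : (0 < K)%R by rewrite mulr_gt0// powR_gt0.
pose b n := (K%:E * dyadic_energy s e (n + 1) `^ r) * ((2 ^ n)^-1)%:E.
have b0 n : 0 <= b n.
  by rewrite !mule_ge0 ?poweR_ge0 ?lee_fin ?(ltW K0)// invr_ge0 ltW// exprz2_gt0.
apply: le_trans (dyadic_integral_le (c := b) _ _ _) _ => //.
- by move=> t t0; rewrite mule_ge0 ?poweR_ge0// lee_fin powR_ge0.
- move=> n t /andP[nt tn].
  have n0 : (0 < (2 : R) ^ n)%R := exprz2_gt0 n.
  have t0 := lt_le_trans n0 nt.
  have n10 : (0 < (2 : R) ^ (n + 1))%R := exprz2_gt0 _.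
  rewrite /h /b dyadic_energy_powR.
  apply: (@le_trans _ _ ((c `^ r)%:E * e (2 ^ (n + 1)%R)%R `^ r * ((2 ^ n) `^ (- (s * q + 1)))%:E)).
    apply: lee_pmul; rewrite ?poweR_ge0 ?lee_fin ?powR_ge0//.
      by apply: e_powR => //; [exact: ltW|rewrite exprz2S ler_pM2l].
    exact: powRN_le.
  rewrite (muleAC _ (e _ `^ r)) -EFinM [X in _ <= X * _]muleA -EFinM (muleAC _ (e _ `^ r)) -EFinM.
  apply: lee_wpmul2r; first exact: poweR_ge0.
  rewrite lee_fin /K exprz2S (powRM _ _ (ltW n0))// (powRND1 _ n0) (powRN 2) le_eqVlt.
  by apply/orP; left; apply/eqP; field; rewrite !gt_eqF ?powR_gt0.
rewrite (eq_esum (b := fun n => K%:E * dyadic_energy s e (n + 1) `^ r)); last first.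
  move=> n _; rewrite /b -muleA -EFinM mulVf ?mule1//.
  by rewrite gt_eqF// exprz2_gt0.
apply: le_trans (le_esumZl (a := fun n => dyadic_energy s e (n + 1) `^ r) _ _) _ => //.
- exact: ltW.
- by move=> n; exact: poweR_ge0.
by rewrite (esum_shift 1 (fun n => dyadic_energy s e n `^ r)).
Qed.

End energy.

Context (alpha theta : R).
Hypotheses (alpha0 : (0 < alpha)%R) (theta0 : (0 < theta)%R).
Let s := (alpha + theta / p)%R.
Hypothesis s1 : (s < 1)%R.

(** The geometric ratio is [y * y = 2 `^ (- (p * (1 - s)))]; it is split in two
    for [poweR_geometric_le]. *)
Let y : R := (2 `^ (- (p * (1 - s) / 2)))%R.

Let y0 : (0 < y)%R. Proof. exact: powR_gt0. Qed.

Let y1 : (y < 1)%R.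
Proof. by apply: powR2N_lt1; rewrite divr_gt0// mulr_gt0// subr_gt0. Qed.

(** In passing from the scale [t] and the smoothness [s] to the scale
    [t * 2 ^+ (k + 6)] and the smoothness [alpha], the powers of [t] cancel, as
    [s * p = alpha * p + theta], and the powers of 2 leave a geometric weight. *)
Let scaled_weight (t : R) (k : nat) : (0 < t)%R ->
  (t `^ (- (s * p)) * ((2 `^ (- p)) ^+ k * (t * 2 ^+ k.+3) `^ theta) =
  2 `^ (3 * theta + 6 * (alpha * p)) *
    ((y * y) ^+ k * (t * 2 ^+ (k + 6)) `^ (- (alpha * p))))%R.
Proof.
move=> t0; have t_ge0 := ltW t0.
have two : ((2 : R) != 0)%R by [].
have D2 (a b : R) : (2 `^ a * 2 `^ b = 2 `^ (a + b))%R by rewrite powRD// two implybT.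
have Dt (a b : R) : (t `^ a * t `^ b = t `^ (a + b))%R by rewrite powRD// (gt_eqF t0) implybT.
have E (a : R) j : ((2 `^ a) ^+ j = 2 `^ (a * j%:R))%R by rewrite powRrM powR_mulrn// powR_ge0.
have F (a : R) j : ((2 ^+ j) `^ a = 2 `^ (j%:R * a))%R by rewrite powRrM powR_mulrn.
have yE : (y * y = 2 `^ (- (p * (1 - s) / 2) + - (p * (1 - s) / 2)))%R by rewrite -D2.
rewrite !(powRM _ t_ge0) ?exprn_ge0// yE !E !F.
rewrite [LHS](_ : _ = (t `^ (- (s * p)) * t `^ theta) *
  (2 `^ (- p * k%:R) * 2 `^ (k.+3%:R * theta)))%R; last by ring.
rewrite [RHS](_ : _ = t `^ (- (alpha * p)) * ((2 `^ (3 * theta + 6 * (alpha * p)) *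
  2 `^ ((- (p * (1 - s) / 2) + - (p * (1 - s) / 2)) * k%:R)) *
  2 `^ ((k + 6)%:R * - (alpha * p))))%R; last by ring.
rewrite Dt !D2; congr (_ `^ _ * _ `^ _)%R; rewrite ?natrD -?(addn3 k) ?natrD /s.
  by field; rewrite gt_eqF.
by field; rewrite gt_eqF.
Qed.

Section dyadic.
Context (e g : R -> \bar R) (K : R).
Hypotheses (K0 : (0 <= K)%R) (e0 : forall t, 0 <= e t) (g0 : forall t, 0 <= g t).
Hypothesis g_le : forall t, (0 < t)%R ->
  g t <= K%:E * \sum_(k <oo) ((2 `^ (- p)) ^+ k * (t * 2 ^+ k.+3) `^ theta)%:E *
    e (t * 2 ^+ (k + 6))%R.

Let K1 := (K * 2 `^ (3 * theta + 6 * (alpha * p)))%R.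

Let K1_ge0 : (0 <= K1)%R. Proof. by rewrite mulr_ge0// powR_ge0. Qed.

Let a_ge0 n : 0 <= dyadic_energy alpha e n.
Proof. exact: dyadic_energy_ge0. Qed.

Lemma dyadic_energy_convolution (n : int) :
  dyadic_energy s g n <= K1%:E * \sum_(k <oo) ((y * y) ^+ k)%:E *
    dyadic_energy alpha e (n + (k + 6)%N%:Z)%R.
Proof.
have n0 : (0 < (2 : R) ^ n)%R := exprz2_gt0 n.
have yy0 k : (0 <= (y * y) ^+ k)%R by rewrite exprn_ge0// mulr_ge0 ?ltW.
rewrite /dyadic_energy; apply: le_trans (lee_wpmul2l _ (g_le n0)) _.
  by rewrite lee_fin powR_ge0.
rewrite muleCA /K1 [(K * _)%:E]EFinM -muleA; apply: lee_wpmul2l; first by rewrite lee_fin.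
rewrite -!nneseriesZl ?lee_fin ?powR_ge0//; last 2 first.
- by move=> k _; rewrite !mule_ge0 ?lee_fin ?powR_ge0.
- by move=> k _; rewrite mule_ge0 ?lee_fin ?mulr_ge0 ?exprn_ge0 ?powR_ge0.
rewrite le_eqVlt; apply/orP; left; apply/eqP; apply: eq_eseriesr => k _.
by rewrite muleA -EFinM scaled_weight// expfzDr// -exprnP !EFinM -!muleA.
Qed.

Lemma esum_dyadic_energy_le :
  \esum_(n in [set: int]) dyadic_energy s g n `^ r <=
  (K1 `^ r * ((1 - y)^-1 `^ r * (1 - y `^ r)^-1))%:E *
    \esum_(n in [set: int]) dyadic_energy alpha e n `^ r.
Proof.
have yr1 : (y `^ r < 1)%R.
  rewrite /y -powRrM mulNr; apply: powR2N_lt1.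
  by rewrite mulr_gt0// divr_gt0// mulr_gt0// subr_gt0.
have y1V : (0 <= (1 - y)^-1)%R by rewrite invr_ge0 subr_ge0 ltW.
have yr0 : (0 <= y `^ r)%R by exact: powR_ge0.
pose k1 := (K1 `^ r * (1 - y)^-1 `^ r)%R.
apply: (@le_trans _ _ (\esum_(n in [set: int]) (k1%:E *
  \sum_(k <oo) ((y `^ r) ^+ k)%:E *
    dyadic_energy alpha e (n + (k + 6)%N%:Z)%R `^ r))).
  apply: le_esum => n _.
  apply: le_trans (poweR_le (ltW r0) _ (dyadic_energy_convolution n)) _.
    exact: dyadic_energy_ge0.
  rewrite poweRM ?lee_fin//; last first.
    apply: nneseries_ge0 => k _ _.
    by rewrite mule_ge0// lee_fin exprn_ge0// mulr_ge0 ?ltW.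
  rewrite /k1 poweR_EFin [(_ * _)%:E]EFinM -[leRHS]muleA; apply: lee_wpmul2l; first by rewrite lee_fin powR_ge0.
  exact: poweR_geometric_le.
apply: le_trans (le_esumZl _ _) _.
- by rewrite mulr_ge0 ?powR_ge0.
- move=> n; apply: nneseries_ge0 => k _ _.
  by rewrite mule_ge0 ?poweR_ge0// lee_fin exprn_ge0.
rewrite mulrA [(_ * (1 - y `^ r)^-1)%:E]EFinM -muleA; apply: lee_wpmul2l.
  by rewrite lee_fin mulr_ge0 ?powR_ge0.
apply: le_trans (esum_convolution_le 6 (w := fun k => ((y `^ r) ^+ k)%R)
  (a := fun n => dyadic_energy alpha e n `^ r) _ _) _.
- by move=> k; exact: exprn_ge0.
- by move=> n; exact: poweR_ge0.
have := nneseries_geometric 1 yr0 yr1; under eq_eseriesr do rewrite mul1r.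
by move=> ->; rewrite mul1r.
Qed.

(** For [q = +oo] the seminorm bounds the energy at each scale. *)
Lemma energy_le_seminorm_oo (t : R) : (0 < t)%R ->
  (t `^ (- (alpha * p)))%:E * e t <= energy_seminorm alpha p +oo e `^ p.
Proof.
move=> t0; set N := energy_seminorm _ _ _ _.
have : (t `^ (- alpha))%:E * e t `^ p^-1 <= N.
  by apply: ereal_sup_ubound; exists t => //=; rewrite in_itv/= t0.
move=> /(poweR_le (ltW p0) _); rewrite mule_ge0 ?poweR_ge0 ?lee_fin ?powR_ge0//.
move=> /(_ isT); rewrite poweRM ?poweR_ge0 ?lee_fin ?powR_ge0// poweRVK//.
by rewrite poweR_EFin -powRrM mulNr.
Qed.

Lemma energy_seminorm_oo_le :
  energy_seminorm s p +oo g <=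
  ((K1 / (1 - y * y)) `^ p^-1)%:E * energy_seminorm alpha p +oo e.
Proof.
have yy1 : (y * y < 1)%R by rewrite mulr_ilt1// ltW.
have yy0 k : (0 <= (y * y) ^+ k)%R by rewrite exprn_ge0// mulr_ge0 ?ltW.
set N := energy_seminorm alpha p +oo e.
have e_le t : (0 < t)%R -> (t `^ (- (alpha * p)))%:E * e t <= N `^ p.
  exact: energy_le_seminorm_oo.
have N0 : 0 <= N.
  apply: le_trans (_ : (1 `^ (- alpha))%:E * e 1%R `^ p^-1 <= _).
    by rewrite mule_ge0 ?poweR_ge0// lee_fin powR_ge0.
  by apply: ereal_sup_ubound; exists 1%R => //=; rewrite in_itv/= ltr01.
rewrite /energy_seminorm; apply: ge_ereal_sup => _ [t + <-]; rewrite /= in_itv/= andbT => t0.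
have -> : (t `^ (- s))%:E * g t `^ p^-1 = ((t `^ (- (s * p)))%:E * g t) `^ p^-1.
  rewrite poweRM ?lee_fin ?powR_ge0// poweR_EFin -powRrM.
  by congr ((_ `^ _)%:E * _); field; rewrite gt_eqF.
have -> : ((K1 / (1 - y * y)) `^ p^-1)%:E * N = ((K1 / (1 - y * y))%:E * N `^ p) `^ p^-1.
  rewrite poweRM ?poweR_ge0 ?lee_fin ?divr_ge0 ?subr_ge0 ?(ltW yy1)// poweR_EFin.
  by rewrite poweRKV.
apply: poweR_le; rewrite ?invr_ge0 ?(ltW p0)// ?mule_ge0 ?lee_fin ?powR_ge0//.
apply: le_trans (lee_wpmul2l _ (g_le t0)) _; first by rewrite lee_fin powR_ge0.
rewrite muleCA -mulrA [(K * _)%:E]EFinM -muleA; apply: lee_wpmul2l; first by rewrite lee_fin.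
rewrite -nneseriesZl ?lee_fin ?powR_ge0//; last first.
  by move=> k _; rewrite !mule_ge0 ?lee_fin ?mulr_ge0 ?exprn_ge0 ?powR_ge0.
set L : R := (2 `^ (3 * theta + _))%R.
have L0 : (0 <= L)%R by exact: powR_ge0.
rewrite -nneseries_geometric ?mulr_ge0 ?(ltW y0)//.
have [->|Noo] := eqVneq N +oo.
  rewrite poweRyr ?gt_eqF// gt0_muley ?leey//.
  apply: lt_le_trans (nneseries_ge_term 0 _) => [|k]; last by rewrite lee_fin mulr_ge0.
  by rewrite lte_fin expr0 mulr1 powR_gt0.
have Nf : N `^ p \is a fin_num.
  by rewrite -(fineK (_ : N \is a fin_num)) ?poweR_EFin// ge0_fin_numE// lt_neqAle Noo leey.
rewrite muleC -(fineK Nf) -nneseriesZl ?fine_ge0 ?poweR_ge0//; last first.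
  by move=> k _; rewrite lee_fin mulr_ge0.
apply: lee_nneseries => [k _ _|k _].
  by rewrite !mule_ge0 ?lee_fin ?mulr_ge0 ?exprn_ge0 ?powR_ge0.
rewrite muleA -EFinM scaled_weight// fineK// -/L mulrA [(_ * (t * 2 ^+ (k + 6)) `^ _)%:E]EFinM -muleA [leRHS]muleC.
apply: lee_wpmul2l; first by rewrite lee_fin mulr_ge0.
by apply: e_le; rewrite mulr_gt0// exprn_gt0.
Qed.

End dyadic.

Section doubling_energy.
Context (c c' K : R).
Hypotheses (c1 : (1 <= c)%R) (c1' : (1 <= c')%R) (K0 : (0 <= K)%R).

Definition doubling_energy (c : R) (e : R -> \bar R) := (forall t, 0 <= e t) /\
  forall t u, (0 < t)%R -> (t <= u)%R -> (u <= 2 * t)%R -> e t <= c%:E * e u.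

Lemma energy_seminorm_fin_le : exists2 C : R, (0 <= C)%R &
  forall e g : R -> \bar R, doubling_energy c e -> doubling_energy c' g ->
  (forall t, (0 < t)%R ->
    g t <= K%:E * \sum_(k <oo) ((2 `^ (- p)) ^+ k * (t * 2 ^+ k.+3) `^ theta)%:E *
      e (t * 2 ^+ (k + 6))%R) ->
  energy_seminorm s p q%:E g <= C%:E * energy_seminorm alpha p q%:E e.
Proof.
have s0 : (0 < s)%R by rewrite addr_gt0// divr_gt0.
have sq : (0 <= s * q + 1)%R by rewrite addr_ge0// mulr_ge0// ltW.
have aq : (0 <= alpha * q + 1)%R by rewrite addr_ge0// mulr_ge0// ltW.
have yr1 : (y `^ r < 1)%R.
  rewrite /y -powRrM mulNr; apply: powR2N_lt1.
  by rewrite mulr_gt0// divr_gt0// mulr_gt0// subr_gt0.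
pose A := (c' `^ r * 2 `^ (s * q))%R.
pose B := ((K * 2 `^ (3 * theta + 6 * (alpha * p))) `^ r *
  ((1 - y)^-1 `^ r * (1 - y `^ r)^-1))%R.
pose D := (c `^ r * 2 `^ (alpha * q + 1))%R.
have A0 : (0 <= A)%R by rewrite mulr_ge0 ?powR_ge0.
have B0 : (0 <= B)%R by rewrite !mulr_ge0 ?powR_ge0// invr_ge0 subr_ge0 ltW.
have D0 : (0 <= D)%R by rewrite mulr_ge0 ?powR_ge0.
have ABD0 : (0 <= A * (B * D))%R by exact: mulr_ge0 A0 (mulr_ge0 B0 D0).
exists ((A * (B * D)) `^ q^-1)%R; first exact: powR_ge0.
move=> e g [e0 ed] [g0 gd] ge; rewrite /energy_seminorm -/r.
rewrite -poweR_EFin -poweRM ?lee_fin//; last first.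
  by apply: integral_ge0 => t _; rewrite mule_ge0 ?poweR_ge0// lee_fin powR_ge0.
apply: poweR_le; first by rewrite invr_ge0 ltW.
  by apply: integral_ge0 => t _; rewrite mule_ge0 ?poweR_ge0// lee_fin powR_ge0.
apply: le_trans (integral_le_dyadic_energy c1' g0 gd sq) _.
rewrite [(A * _)%:E]EFinM -muleA; apply: lee_wpmul2l; first by rewrite lee_fin.
apply: le_trans (esum_dyadic_energy_le K0 e0 g0 ge) _.
rewrite [(B * _)%:E]EFinM -muleA; apply: lee_wpmul2l; first by rewrite lee_fin.
exact: dyadic_energy_le_integral.
Qed.

Lemma dyadic_energy_bounded e : doubling_energy c e ->
  energy_seminorm alpha p q%:E e < +oo ->
  exists2 A : R, (0 <= A)%R & forall n, dyadic_energy alpha e n <= A%:E.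
Proof.
move=> [e0 ed] efin.
have aq : (0 <= alpha * q + 1)%R by rewrite addr_ge0// mulr_ge0// ltW.
set S := \esum_(n in [set: int]) dyadic_energy alpha e n `^ r.
have S0 : 0 <= S by apply: esum_ge0 => n _; exact: poweR_ge0.
have Soo : S < +oo.
  apply: le_lt_trans (dyadic_energy_le_integral c1 e0 ed aq) _.
  rewrite lte_mul_pinfty ?lee_fin ?mulr_ge0 ?powR_ge0//.
  rewrite ltey; apply/eqP => I; move: efin; rewrite /energy_seminorm -/r I.
  by rewrite poweRyr ?ltxx// gt_eqF// invr_gt0.
have Sf : S \is a fin_num by rewrite ge0_fin_numE.
exists ((fine S) `^ r^-1)%R; first exact: powR_ge0.
move=> n; rewrite -poweR_EFin fineK//.
rewrite -[leLHS](@poweRKV _ r)//; last exact: dyadic_energy_ge0.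
apply: poweR_le; rewrite ?invr_ge0 ?(ltW r0) ?poweR_ge0//.
by apply: esum_ge; exists [set n]; [split => //; exact: finite_set1|rewrite fsbig_set1].
Qed.

End doubling_energy.
End energy_seminorm.

Section energy_seminorm_extended.
Local Open Scope ereal_scope.
Context {R : realType} (alpha p theta c : R).
Hypotheses (p1 : (1 <= p)%R) (alpha0 : (0 < alpha)%R) (c1 : (1 <= c)%R).

Let p0 : (0 < p)%R := lt_le_trans ltr01 p1.

Lemma energy_seminorm_le (q : \bar R) (c' K : R) : 1%:E <= q ->
  (0 < theta)%R -> (alpha + theta / p < 1)%R -> (1 <= c')%R -> (0 <= K)%R ->
  exists2 C : R, (1 <= C)%R &
  forall e g : R -> \bar R, doubling_energy c e -> doubling_energy c' g ->
  (forall t, (0 < t)%R ->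
    g t <= K%:E * \sum_(k <oo) ((2 `^ (- p)) ^+ k * (t * 2 ^+ k.+3) `^ theta)%:E *
      e (t * 2 ^+ (k + 6))%R) ->
  energy_seminorm (alpha + theta / p) p q g <= C%:E * energy_seminorm alpha p q e.
Proof.
move=> q1 theta0 s1 c1' K0.
suff [C C0 h] : exists2 C : R, (0 <= C)%R & forall e g : R -> \bar R,
    doubling_energy c e -> doubling_energy c' g -> (forall t, (0 < t)%R ->
    g t <= K%:E * \sum_(k <oo) ((2 `^ (- p)) ^+ k * (t * 2 ^+ k.+3) `^ theta)%:E *
      e (t * 2 ^+ (k + 6))%R) ->
    energy_seminorm (alpha + theta / p) p q g <= C%:E * energy_seminorm alpha p q e.
  exists (C + 1)%R; first by rewrite lerDr.
  move=> e g de dg ge; apply: le_trans (h e g de dg ge) _; apply: lee_wpmul2r.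
    by apply: energy_seminorm_ge0; have [] := de.
  by rewrite lee_fin lerDl.
case: q q1 => [q| |]//; rewrite ?lee_fin => q1.
  exact: energy_seminorm_fin_le.
eexists; last first.
  by move=> e g [e0 _] [g0 _] ge; exact: (energy_seminorm_oo_le p1 s1 K0 e0 g0 ge).
exact: powR_ge0.
Qed.

Context (q : \bar R) (e : R -> \bar R).
Hypotheses (q1 : 1%:E <= q) (de : doubling_energy c e).
Hypothesis efin : energy_seminorm alpha p q e < +oo.

Let e0 t : 0 <= e t. Proof. by have [] := de. Qed.

(** For [q] finite a single term of the sum over the dyadic scales is bounded by
    the whole sum; for [q = +oo] the bound holds by definition. *)
Let energy_decay : exists2 A : R, (0 <= A)%R &
  forall n : int, e (2 ^ n)%R <= (A * (2 ^ n) `^ (alpha * p))%:E.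
Proof.
suff [A A0 h] : exists2 A : R, (0 <= A)%R & forall n, dyadic_energy p alpha e n <= A%:E.
  exists A => // n; have n0 : (0 < (2 : R) ^ n)%R := exprz2_gt0 n.
  have := h n; rewrite /dyadic_energy powRN => hn.
  have w0 : (0 < (2 ^ n) `^ (alpha * p) :> R)%R by rewrite powR_gt0.
  have w1 : 0 <= ((2 ^ n) `^ (alpha * p))%:E by rewrite lee_fin ltW.
  have := lee_wpmul2l w1 hn.
  by rewrite muleA -!EFinM mulfV ?gt_eqF// mul1e [(A * _)%R]mulrC.
case: q q1 efin => [r| |]//; rewrite ?lee_fin => r1 ef.
  apply: (dyadic_energy_bounded _ _ _ c1 de ef) => //.
set N := energy_seminorm alpha p +oo e in ef.
have h (t : R) : (0 < t)%R -> (t `^ (- (alpha * p)))%:E * e t <= N `^ p.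
  exact: energy_le_seminorm_oo.
have poweR_fin (M : \bar R) : M < +oo -> M `^ p \is a fin_num.
  case: M => [M| |]// _.
  by rewrite /poweR; case: ifP.
have N0 : 0 <= N `^ p by exact: poweR_ge0.
exists (fine (N `^ p)); first exact: fine_ge0.
move=> n; apply: le_trans (h _ (exprz2_gt0 n)) _; rewrite fineK//.
exact: poweR_fin.
Qed.

Lemma energy_fin (n : int) : e (2 ^ n)%R < +oo.
Proof. by have [A _ h] := energy_decay; apply: le_lt_trans (h n) _; rewrite ltry. Qed.

Lemma energy_summable : \sum_(k <oo) e (2^-1 ^+ k)%R < +oo.
Proof.
have [A A0 h] := energy_decay.
apply: (@le_lt_trans _ _ (\sum_(k <oo) (A * (2 `^ (- (alpha * p))) ^+ k)%:E)).
  apply: lee_nneseries => [k _ _//|k _].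
  have := h (- k%:Z)%R; rewrite -exprz_inv -exprnP => /le_trans; apply.
  by rewrite lee_fin -powR_half_exp.
rewrite nneseries_geometric ?ltry// ?powR_ge0//.
by apply: powR2N_lt1; rewrite mulr_gt0.
Qed.

End energy_seminorm_extended.

(** * Distances, separability and product measurability *)

Section metric_space.
Context {R : realType} {X : completeMetricType R}.
Implicit Types (x y z : X) (Z A : set X).

Lemma ball_mdist x r y : ball x r y = (mdist x y < r) :> Prop.
Proof. by rewrite ballEmdist. Qed.

Lemma open_ball x (r : R) : open (ball x r).
Proof.
rewrite openE => y; rewrite ball_mdist => xyr.
apply/nbhs_ballP; exists (r - mdist x y) => /=; first by rewrite subr_gt0.
move=> z; rewrite !ball_mdist => yz.
by apply: le_lt_trans (metric_triangle _ y _) _; lra.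
Qed.

Definition dist_to Z x : R := inf [set mdist x z | z in Z].

Section dist_to.
Context (Z : set X) (Z0 : Z !=set0).

Let has_inf_dist x : has_inf [set mdist x z | z in Z].
Proof.
split; first by have [z Zz] := Z0; exists (mdist x z), z.
by exists 0 => _ [z _ <-]; exact: mdist_ge0.
Qed.

Lemma dist_to_ge0 x : 0 <= dist_to Z x.
Proof.
apply: lb_le_inf; first exact: (has_inf_dist x).1.
by move=> _ [z _ <-]; exact: mdist_ge0.
Qed.

Lemma dist_to_le x z : Z z -> dist_to Z x <= mdist x z.
Proof. by move=> Zz; apply: ge_inf; [exact: (has_inf_dist x).2|exists z]. Qed.

Lemma dist_to_lt x r : dist_to Z x < r -> exists2 z, Z z & mdist x z < r.
Proof.
by move=> /(inf_lt (has_inf_dist x).1)[_ [z Zz <-] zr]; exists z.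
Qed.

Lemma le_dist_to x c : (forall z, Z z -> c <= mdist x z) -> c <= dist_to Z x.
Proof.
move=> cz; apply: lb_le_inf; first exact: (has_inf_dist x).1.
by move=> _ [z Zz <-]; exact: cz.
Qed.

Lemma dist_to_lip x y : dist_to Z x <= mdist x y + dist_to Z y.
Proof.
rewrite -lerBlDl; apply: le_dist_to => z Zz; rewrite lerBlDl.
exact: le_trans (dist_to_le _ Zz) (metric_triangle _ _ _).
Qed.

Lemma dist_to_gt0 x : closed Z -> ~ Z x -> 0 < dist_to Z x.
Proof.
move=> cZ Zx; rewrite lt_neqAle dist_to_ge0 andbT; apply/eqP => d0; apply: Zx.
apply: cZ => B /nbhs_ballP[e /= e0 eB].
have [|z Zz xz] := @dist_to_lt x e; first by rewrite -d0.
by exists z; split => //; apply: eB; rewrite ball_mdist.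
Qed.

End dist_to.

Lemma dense_ball A x (r : R) : dense A -> 0 < r -> exists2 y, A y & mdist x y < r.
Proof.
move=> dA r0; have [||y []] := dA (ball x r).
- by exists x; exact: ballxx.
- exact: open_ball.
- by rewrite ball_mdist; exists y.
Qed.

(** The compact neighbourhood [U] of [x] in [A] is closed in [X], and it contains
    the points of [A] near [x]; by density it contains all the points near [x]. *)
Lemma locally_compact_dense_open A : dense A ->
  locally_compact [set: set_type A] -> open A.
Proof.
move=> dA lA; rewrite openE => x Ax.
have [U] := lA (exist _ x (mem_set Ax)) Logic.I.
rewrite withinET nbhsE => -[B [[V oV VB] Bx] BU] [cU _].
have Vx : V x by move: Bx; rewrite -VB.
have : nbhs x V by exact: open_nbhs_nbhs.
move=> /nbhs_ballP[e /= e0 eV]; apply/nbhs_ballP; exists e => //= y xy.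
have cK : compact (set_val @` U).
  apply: continuous_compact => //; apply: continuous_subspaceT.
  exact: initial_continuous.
have clK : closed (set_val @` U) by exact: (compact_closed (@metric_hausdorff _ _)).
suff [u Uu <-] : (set_val @` U) y by exact: set_valP.
apply: clK => W /nbhs_ballP[r /= r0 rW].
have [||w [[xw yw] Aw]] := dA (ball x e `&` ball y r).
- by exists y; split => //; exact: ballxx.
- by apply: openI; exact: open_ball.
exists w; split; last exact: rW.
exists (exist _ w (mem_set Aw)) => //; apply: BU; rewrite -VB /=.
exact: eV.
Qed.

(** If the boundary is empty then [A] is the whole of the complete space [X]. *)
Lemma not_complete_boundary A : ~ complete_space (set_type A) ->
  boundary A !=set0.
Proof.
move=> nc; apply/set0P/eqP => A0; apply: nc => F FF cF.
have PF : ProperFilter (set_val @ F) by exact: fmap_proper_filter.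
have : cauchy (set_val @ F).
  move=> E entE; have [|[P Q] /= [FP FQ] PQ] :=
      cF ((fun p : set_type A * set_type A => (set_val p.1, set_val p.2)) @^-1` E).
    by exists E.
  exists (set_val @` P, set_val @` Q) => /=.
    by split; [apply: filterS FP|apply: filterS FQ] => u Pu; exists u.
  move=> [_ _] [/= [u Pu <-] [v Qv <-]].
  exact: (PQ (u, v)).
move=> /cauchy_cvg /cvg_ex[l Fl].
have Al : A l by apply: contrapT => nAl; have : boundary A l by []; rewrite A0.
exists (exist _ l (mem_set Al)) => W.
rewrite nbhsE => -[B [[V oV VB] Bx] BW].
have /Fl : nbhs l V by apply: open_nbhs_nbhs; split => //; move: Bx; rewrite -VB.
by rewrite !nbhs_simpl/=; apply: filterS => u Vu; apply: BW; rewrite -VB.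
Qed.

Lemma open_borel A : open A -> measurable (A : set (borel X)).
Proof. by move=> oA; exact: sub_sigma_algebra. Qed.

Lemma closed_borel A : closed A -> measurable (A : set (borel X)).
Proof.
move=> cA; rewrite -[A]setCK; apply: (@measurableC _ (borel X)).
by apply: open_borel; exact: closed_openC.
Qed.

Lemma ball_borel x (r : R) : measurable (ball x r : set (borel X)).
Proof. by apply: open_borel; exact: open_ball. Qed.

Lemma continuous_at_borel (A : set X) (f : X -> R) : open A ->
  {in A, continuous f} -> measurable_fun (A : set (borel X)) (f : borel X -> R).
Proof.
move=> oA cf; have mA := open_borel oA.
apply: (measurability _ (RGenOpens.measurableE R)).
move=> _ [_ [a [b ->] <-]]; apply: open_borel; rewrite openE => x [Ax fx].
apply: filterI; first exact: open_nbhs_nbhs.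
by apply: (cf _ (mem_set Ax)); apply: open_nbhs_nbhs; split => //; exact: interval_open.
Qed.

End metric_space.

(** Only finitely many disjoint subsets of [B] have measure at least
    [k.+1%:R^-1]. *)
Lemma disjoint_positive_countable d (T : measurableType d) (R : realType)
    (m : {measure set T -> \bar R}) (I : choiceType) (D : set I) (F : I -> set T)
    (B : set T) :
  (forall i, D i -> measurable (F i)) -> measurable B ->
  (forall i, D i -> F i `<=` B) -> trivIset D F -> (m B < +oo)%E ->
  (forall i, D i -> 0 < m (F i))%E -> countable D.
Proof.
move=> mF mB FB tF Boo F0.
pose E k := [set i | D i /\ ((k.+1%:R^-1)%:E <= m (F i))%E].
suff fE k : finite_set (E k).
  apply: (@sub_countable _ _ _ (\bigcup_k E k)); last first.
    by apply: bigcup_countable => // k _; exact: finite_set_countable.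
  apply: subset_card_le => i Di; have := F0 _ Di; have [Foo|Foo] := eqVneq (m (F i)) +oo%E.
    by exists 0%N => //; split => //; rewrite Foo leey.
  have Ffin : m (F i) \is a fin_num by rewrite ge0_fin_numE// lt_neqAle Foo leey.
  rewrite -(fineK Ffin) lte_fin => f0.
  exists (Num.truncn (fine (m (F i)))^-1) => //; split => //.
  rewrite -(fineK Ffin) lee_fin invf_ple ?posrE//; exact/ltW/truncnS_gt.
apply: contrapT => infE.
have Bfin : m B \is a fin_num by rewrite ge0_fin_numE.
pose n := (Num.truncn (fine (m B) * k.+1%:R)).+1.
have [S SE nS] := infinite_set_fset n infE.
have SD : [set` S] `<=` D by move=> i /SE[].
have : (m (\bigcup_(i in [set` S]) F i) <= m B)%E.
  apply: le_measure; [apply/mem_set|exact/mem_set|].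
    by apply: fin_bigcup_measurable => // i /SD/mF.
  by move=> t [i /SD Di Ft]; exact: FB Di _ Ft.
rewrite bigcup_fset measure_fbigsetU; last 2 first.
  by move=> i /SD/mF.
  exact: sub_trivIset tF.
apply/negP; rewrite -ltNge.
apply: (@lt_le_trans _ _ (\sum_(i <- S) (k.+1%:R^-1)%:E)%E); last first.
  rewrite [leLHS]big_seq_cond [leRHS]big_seq_cond.
  by apply: lee_sum => i; rewrite andbT => /SE[].
rewrite sumEFin big_const_seq count_predT iter_addr_0 -(fineK Bfin) lte_fin.
rewrite -[ltRHS]mulr_natl ltr_pdivlMr//.
apply: lt_le_trans (truncnS_gt _) _; rewrite ler_nat.
exact: nS.
Qed.

Lemma countable_bigcup_measurable d (T : sigmaRingType d) (I : Type)
    (D : set I) (F : I -> set T) :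
  countable D -> (forall i, D i -> measurable (F i)) ->
  measurable (\bigcup_(i in D) F i).
Proof.
move=> /pfcard_geP[->|[f]] mF; first by rewrite bigcup_set0.
rewrite -(image_eq f) bigcup_image; apply: bigcupT_measurable => n.
by apply: mF; exact: funS.
Qed.

Section separability.
Context {R : realType} {X : completeMetricType R}.
Implicit Types (A : set X) (m : {measure set (borel X) -> \bar R}).

(** A maximal family of disjoint balls of radius [e] is countable, since only
    countably many disjoint sets of positive measure lie in a ball, and the
    centres of a maximal family come within [3 * e] of every point. *)
Lemma positive_measure_separable m A : dense A -> measurable (A : set (borel X)) ->
  (forall x (r : R), A x -> 0 < r ->
    (0 < m (ball x r `&` A))%E /\ (m (ball x r `&` A) < +oo)%E) ->
  exists2 D : set X, countable D &
    forall x (e : R), 0 < e -> exists2 s, D s & mdist x s < e.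
Proof.
move=> dA mA mballs.
have net (e : R) : 0 < e -> exists2 D : set X, countable D &
    forall x, exists2 s, D s & mdist x s < 3 * e.
  move=> e0.
  have [D [DA tD maxD]] := ex_maximal_disjoint_subcollection
    (fun x => ball x e `&` A) A.
  exists D.
    have [/eqP->//|/set0P[x0 Dx0]] := boolP (D == set0).
    have Ax0 := DA _ Dx0.
    pose DN (N : nat) := [set x | D x /\ mdist x0 x < N%:R].
    apply: (@sub_countable _ _ _ (\bigcup_N DN N)).
      apply: subset_card_le => x Dx; exists (Num.truncn (mdist x0 x)).+1 => //.
      by split => //; exact: truncnS_gt.
    apply: bigcup_countable => // N _.
    apply: (@disjoint_positive_countable _ _ R m X (DN N)
      (fun x => ball x e `&` A) (ball x0 (N%:R + e) `&` A)).
    - by move=> x _; apply: measurableI => //; exact: ball_borel.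
    - by apply: measurableI => //; exact: ball_borel.
    - move=> x [Dx x0x] y [+ Ay]; rewrite !ball_mdist => xy; split => //.
      rewrite ball_mdist.
      by apply: le_lt_trans (metric_triangle _ x _) _; lra.
    - by apply: sub_trivIset tD => x [].
    - by apply: (mballs _ _ Ax0 _).2; rewrite ltr_wpDl.
    - by move=> x [Dx _]; apply: (mballs _ _ (DA _ Dx) _).1.
  move=> x; have [y Ay xy] := dense_ball x dA e0.
  have [s Ds ys] : exists2 s, D s & mdist y s < 2 * e.
    have [Dy|nDy] := pselect (D y); first by exists y => //; rewrite mdistxx; lra.
    apply: contrapT => far; apply: (maxD (D `|` [set y])).
    - rewrite properEneq; split; last by move=> z Dz; left.
      by apply/eqP => DE; apply: nDy; rewrite DE; right.
    - by move=> z [/DA//|->].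
    have disj s : D s -> (ball s e `&` A) `&` (ball y e `&` A) = set0.
      move=> Ds; apply/seteqP; split => // z [[sz _] [yz _]]; apply: far.
      exists s => //; move: sz yz; rewrite !ball_mdist (metric_sym s) => sz yz.
      by apply: le_lt_trans (metric_triangle _ z _) _; lra.
    apply/trivIsetP => i j; move/trivIsetP : tD => tD.
    move=> [Di|->] [Dj|->]; first exact: tD.
    - by move=> _; exact: disj.
    - by move=> _; rewrite setIC; exact: disj.
    - by rewrite eqxx.
  by exists s => //; apply: le_lt_trans (metric_triangle _ y _) _; lra.
have /choice[D Dnet] : forall k, exists D : set X, countable D /\
    forall x, exists2 s, D s & mdist x s < 3 * k.+1%:R^-1.
  move=> k; have k0 : 0 < k.+1%:R^-1 :> R by rewrite invr_gt0.
  by have [D cD Dx] := net _ k0; exists D.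
exists (\bigcup_k D k); first by apply: bigcup_countable => // k _; exact: (Dnet k).1.
move=> x e e0; pose k := Num.truncn (3 / e).
have [s Ds xs] := (Dnet k).2 x; exists s; first by exists k.
apply: lt_trans xs _; rewrite ltr_pdivrMr// mulrC -ltr_pdivrMr//.
exact: truncnS_gt.
Qed.

Context (D : set X) (cD : countable D).
Hypothesis sD : forall x (e : R), 0 < e -> exists2 s, D s & mdist x s < e.

(** Separability matters here: the set of the pairs at distance less than [r] is
    open in the product, but it belongs to the product sigma-algebra because it
    is a countable union of products of balls. *)
Lemma measurable_mdist :
  measurable_fun [set: borel X * borel X] (fun z => mdist (z.1 : X) (z.2 : X)).
Proof.
have lt_measurable (r : R) :
    measurable [set z : borel X * borel X | mdist (z.1 : X) (z.2 : X) < r].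
  have -> : [set z : borel X * borel X | mdist (z.1 : X) (z.2 : X) < r] =
      \bigcup_(s in D) \bigcup_(q : rat)
        ((ball s (ratr q) : set (borel X)) `*` (ball s (r - ratr q) : set (borel X))).
    apply/seteqP; split => [[x y]/= xyr|[x y] [s Ds [q _]]]/=; last first.
      rewrite !ball_mdist (metric_sym s) => -[xs sy].
      by apply: le_lt_trans (metric_triangle _ s _) _; lra.
    pose e := (r - mdist x y) / 2.
    have [s Ds xs] : exists2 s, D s & mdist x s < e / 2.
      by apply: sD; rewrite !divr_gt0// subr_gt0.
    have [q] := rat_in_itvoo xs; rewrite in_itv/= => /andP[q1 q2].
    exists s => //; exists q => //; rewrite /= !ball_mdist metric_sym; split => //.
    apply: le_lt_trans (metric_triangle _ x _) _; rewrite metric_sym.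
    by rewrite /e in q2 xs; lra.
  apply: countable_bigcup_measurable => // s _; apply: bigcupT_measurable_rat => q.
  by apply: measurableX; exact: ball_borel.
apply: (measurability _ (RGenInftyO.measurableE R)).
move=> _ [_ [r ->] <-]; rewrite setTI.
rewrite (_ : _ @^-1` _ = [set z : borel X * borel X | mdist (z.1 : X) (z.2 : X) < r]).
  exact: lt_measurable.
by apply/seteqP; split => z /=; rewrite in_itv.
Qed.

End separability.

(** * Doubling measures *)

Section inverse.
Local Open Scope ereal_scope.
Context {R : realType}.

Lemma inve_fine (a : \bar R) : 0 < a -> a < +oo -> a^-1 = ((fine a)^-1)%:E.
Proof. by case: a => [r| |]//; rewrite lte_fin => r0 _; rewrite inver gt_eqF. Qed.

End inverse.

Section volume.
Context {R : realType} {X : completeMetricType R}.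

Definition volume (m : {measure set (borel X) -> \bar R}) (A : set X)
  (x : X) (r : R) : R := fine (m (ball x r `&` A)).

End volume.

(** The integrand of [besov_energy], with the volume as a real number. *)
HB.lock Definition osc {R : realType} {X : completeMetricType R}
    (m : {measure set (borel X) -> \bar R}) (A : set X)
    (p : R) (f : X -> R) (r : R) (v : X) : \bar R :=
  (((volume m A v r)^-1)%:E *
   \int[m]_(w in ball v r `&` A) (`|f w - f v| `^ p)%:E)%E.

Section doubling_space.
Context {R : realType} {X : completeMetricType R}.
Variables (m : {measure set (borel X) -> \bar R}) (A S : set X) (c : R).

Local Notation volume := (volume m A).
Local Notation osc := (osc m A).

(** The measure lives on [A], and the centres of the balls range over [S]: the
    balls of centres on the boundary have to be measured by [mu] as well. *)
Definition doubling_centers := forall x r, S x -> 0 < r ->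
  [/\ (0 < m (ball x r `&` A))%E,
      (m (ball x (2 * r) `&` A) <= c%:E * m (ball x r `&` A))%E &
      (m (ball x r `&` A) < +oo)%E].

Hypotheses (mA : measurable (A : set (borel X))) (AS : A `<=` S) (c1 : 1 <= c).
Hypothesis dm : doubling_centers.

Lemma ball_setI_borel x (r : R) : measurable (ball x r `&` A : set (borel X)).
Proof. by apply: measurableI => //; exact: ball_borel. Qed.

Lemma volumeE x r : S x -> 0 < r -> m (ball x r `&` A) = (volume x r)%:E.
Proof. by move=> Sx r0; rewrite fineK// ge0_fin_numE//; case: (dm Sx r0). Qed.

Lemma volume_gt0 x r : S x -> 0 < r -> 0 < volume x r.
Proof. by move=> Sx r0; rewrite -lte_fin -volumeE//; case: (dm Sx r0). Qed.

Lemma measure_inveE x r : S x -> 0 < r ->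
  ((m (ball x r `&` A))^-1 = ((volume x r)^-1)%:E)%E.
Proof. by move=> Sx r0; case: (dm Sx r0) => ? _ ?; rewrite inve_fine. Qed.

Lemma volume_doubling x r n : S x -> 0 < r ->
  volume x (2 ^+ n * r) <= c ^+ n * volume x r.
Proof.
move=> Sx r0; elim: n => [|n ih]; first by rewrite !expr0 !mul1r.
have n0 : 0 < 2 ^+ n * r by rewrite mulr_gt0// exprn_gt0.
rewrite !exprS -!mulrA; apply: (@le_trans _ _ (c * volume x (2 ^+ n * r))).
  rewrite -lee_fin EFinM -!volumeE//; last by rewrite mulr_gt0.
  by case: (dm Sx n0).
by rewrite ler_pM2l// (lt_le_trans _ c1).
Qed.

(** The ball of centre [y] and radius [s] is contained in the ball of centre [x]
    and radius [2 ^+ n * r]. *)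
Lemma volume_le_ball x y r s n : S x -> S y -> 0 < r -> 0 < s ->
  mdist x y + s <= 2 ^+ n * r -> volume y s <= c ^+ n * volume x r.
Proof.
move=> Sx Sy r0 s0 xys; apply: le_trans (volume_doubling n Sx r0).
rewrite -lee_fin -!volumeE//; last by rewrite mulr_gt0// exprn_gt0.
apply: le_measure; [apply/mem_set; exact: ball_setI_borel..|].
move=> z [+ Az]; rewrite ball_mdist => yz; split => //; rewrite ball_mdist.
by apply: le_lt_trans (metric_triangle _ y _) _; lra.
Qed.

Local Open Scope ereal_scope.

Lemma integral_ball x (r : R) (h : X -> \bar R) :
  \int[m]_(y in ball x r `&` A) h y =
  \int[m]_(y in A) (h y * (\1_[set y | (mdist x y < r)%R] y)%:E).
Proof.
rewrite setIC integral_mkcondr; apply: eq_integral => y _.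
rewrite patchE indicE ballEmdist.
by case: ifPn => _; rewrite ?mule1 ?mule0.
Qed.

Hypothesis sm : sigma_finite setT m.
Hypothesis mdist_measurable :
  measurable_fun [set: borel X * borel X] (fun z => mdist (z.1 : X) (z.2 : X)).

Lemma measurable_indic_mdist (r : R) : measurable_fun [set: borel X * borel X]
  (fun z => (\1_[set y : X | (mdist (z.1 : X) y < r)%R] (z.2 : X))%:E : \bar R).
Proof.
apply/measurable_EFinP.
rewrite (_ : (fun _ => _) =
   \1_[set z : borel X * borel X | (mdist (z.1 : X) (z.2 : X) < r)%R])//.
apply: measurable_indic.
have := measurable_fun_ltr mdist_measurable (@measurable_cst _ _ _ _ setT r).
move=> /(_ measurableT [set true] _); rewrite setTI; apply.
by [].
Qed.

Lemma measurable_volume (r : R) : measurable_fun (setT : set (borel X))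
  ((fun x => volume x r) : borel X -> R).
Proof.
have h : measurable_fun (setT : set (borel X))
    ((fun x => m (ball x r `&` A)) : borel X -> \bar R).
  rewrite (_ : (fun x => _) = fun x => \int[m]_(y in A)
    (\1_[set y | (mdist x y < r)%R] y)%:E).
    by apply: measurable_integralr => //; exact: measurable_indic_mdist.
  apply/funext => x; rewrite -[LHS]mul1e -(integral_cst m (ball_setI_borel x r)).
  by rewrite integral_ball; apply: eq_integral => y _; rewrite mul1e.
by apply: measurableT_comp h; exact: fine_measurable.
Qed.

Lemma measurable_volumeV (r : R) : measurable_fun (setT : set (borel X))
  ((fun x => ((volume x r)^-1)%R) : borel X -> R).
Proof.
have h := measurableT_comp (@measurable_powR R (-1)) (measurable_volume r).
apply: eq_measurable_fun h => x _ /=.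
by rewrite powR_inv1// fine_ge0.
Qed.

Lemma measurable_ball_integral (r : R) (h : X -> X -> \bar R) :
  (forall x y, 0 <= h x y) ->
  measurable_fun [set: borel X * borel X] (fun z => h z.1 z.2) ->
  measurable_fun (setT : set (borel X))
    ((fun x => \int[m]_(y in ball x r `&` A) h x y) : borel X -> \bar R).
Proof.
move=> h0 mh.
under eq_fun do rewrite integral_ball.
apply: measurable_integralr => //.
  by move=> x y; rewrite mule_ge0// lee_fin.
by apply: emeasurable_funM => //; exact: measurable_indic_mdist.
Qed.

(** A point [y] is averaged over by the points [x] of the ball [ball y r], whose
    balls have the same volume as [ball y r] up to the factor [c]: averaging
    over balls is bounded on L^1. *)
Lemma integral_average_le (r : R) (h : X -> \bar R) : (0 < r)%R ->
  (forall x, 0 <= h x) -> measurable_fun (setT : set (borel X)) (h : borel X -> \bar R) ->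
  \int[m]_(x in A) (((volume x r)^-1)%:E * \int[m]_(y in ball x r `&` A) h y) <=
  c%:E * \int[m]_(x in A) h x.
Proof.
move=> r0 h0 mh.
have c0 : (0 <= c)%R by exact: le_trans ler01 c1.
have V0 x s : (0 <= (volume x s)^-1)%R by rewrite invr_ge0 fine_ge0.
pose k x y := ((volume x r)^-1)%:E * (h y * (\1_[set y | (mdist x y < r)%R] y)%:E).
have k0 x y : 0 <= k x y by rewrite !mule_ge0// lee_fin.
have mk : measurable_fun [set: borel X * borel X] (fun z => k z.1 z.2).
  apply: emeasurable_funM.
    by apply/measurable_EFinP; apply: (measurableT_comp (measurable_volumeV r)).
  apply: emeasurable_funM; last exact: measurable_indic_mdist.
  exact: (measurableT_comp mh).
rewrite (eq_integral (fun x : borel X => \int[m]_(y in A) k x y)); last first.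
  move=> x _; rewrite integral_ball ge0_integralZl_EFin//.
  - by move=> y _; rewrite mule_ge0// lee_fin.
  - apply: emeasurable_funM; first exact: measurable_funTS.
    have := measurableT_comp (measurable_indic_mdist r) (pair1_measurable (x : borel X)).
    exact: measurable_funTS.
rewrite (tonelli sm sm)// -ge0_integralZl_EFin//; last exact: measurable_funTS.
apply: le_integral_ge0 => y Ay; first exact: integral_ge0.
apply: (@le_trans _ _ (\int[m]_(x in ball y r `&` A) (c%:E * ((volume y r)^-1)%:E * h y))).
  rewrite integral_ball; apply: le_integral_ge0 => x Ax; first exact: k0.
  rewrite /k !indicE muleA; have [yx|yx] := boolP (mdist (y : X) (x : X) < r)%R; last first.
    by rewrite !memNset ?mule0//=; apply/negP => //; rewrite metric_sym.
  rewrite !mem_set//=; last by rewrite metric_sym.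
  rewrite !mule1 -EFinM.
  apply: lee_wpmul2r => //; rewrite lee_fin.
  have Vx := volume_gt0 (AS Ax) r0; have Vy := volume_gt0 (AS Ay) r0.
  rewrite ler_pdivlMr// mulrC ler_pdivrMr//.
  rewrite -[c]expr1; apply: volume_le_ball => //; try exact: AS.
  by rewrite metric_sym; lra.
rewrite integral_cst; last exact: ball_setI_borel.
rewrite volumeE//; last exact: AS.
rewrite muleAC -!EFinM -mulrA mulVf ?mulr1//.
by rewrite gt_eqF// volume_gt0//; exact: AS.
Qed.

Lemma oscE p f r v : osc p f r v =
  ((volume v r)^-1)%:E * \int[m]_(w in ball v r `&` A) (`|f w - f v| `^ p)%:E.
Proof. by rewrite osc.unlock. Qed.

Lemma osc_ge0 p f r v : 0 <= osc p f r v.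
Proof.
rewrite oscE mule_ge0 ?lee_fin ?invr_ge0 ?fine_ge0//.
by apply: integral_ge0 => w _; rewrite lee_fin powR_ge0.
Qed.

Lemma besov_energyE p f r : (0 < r)%R ->
  besov_energy m A p f r = \int[m]_(x in A) osc p f r x.
Proof.
move=> r0; apply: eq_integral => x /set_mem Ax.
by rewrite oscE measure_inveE//; exact: AS.
Qed.

Lemma measurable_powR_diff (p : R) (f : X -> R) :
  measurable_fun (setT : set (borel X)) (f : borel X -> R) ->
  measurable_fun [set: borel X * borel X]
    (fun z => (`|f z.2 - f z.1| `^ p)%:E : \bar R).
Proof.
move=> mf; apply/measurable_EFinP.
apply: (measurableT_comp (measurable_powR p)).
apply: measurableT_comp => //.
by apply: measurable_funB; apply: measurableT_comp.
Qed.

Lemma measurable_osc p (f : X -> R) r :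
  measurable_fun (setT : set (borel X)) (f : borel X -> R) ->
  measurable_fun (setT : set (borel X)) (osc p f r : borel X -> \bar R).
Proof.
move=> mf; rewrite osc.unlock.
apply: emeasurable_funM.
  by apply/measurable_EFinP; exact: measurable_volumeV.
apply: measurable_ball_integral; last exact: measurable_powR_diff.
by move=> x y; rewrite lee_fin powR_ge0.
Qed.

Lemma osc_le p (f : X -> R) r s x : S x ->
  (0 < r)%R -> (r <= s)%R -> (s <= 2 * r)%R -> osc p f r x <= c%:E * osc p f s x.
Proof.
move=> Sx r0 rs sr; have s0 := lt_le_trans r0 rs.
rewrite !oscE muleA; apply: lee_pmul.
- by rewrite lee_fin invr_ge0 fine_ge0.
- by apply: integral_ge0 => w _; rewrite lee_fin powR_ge0.
- rewrite -EFinM lee_fin ler_pdivlMr ?volume_gt0// mulrC ler_pdivrMr ?volume_gt0//.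
  rewrite -[c]expr1; apply: volume_le_ball => //; rewrite mdistxx; lra.
- apply: subset_integral_ge0 => w; first by rewrite lee_fin powR_ge0.
  by move=> [+ Aw]; rewrite !ball_mdist => xw; split => //; rewrite ball_mdist; lra.
Qed.

Lemma besov_energy_le p (f : X -> R) r s :
  measurable_fun (setT : set (borel X)) (f : borel X -> R) ->
  (0 < r)%R -> (r <= s)%R -> (s <= 2 * r)%R ->
  besov_energy m A p f r <= c%:E * besov_energy m A p f s.
Proof.
move=> mf r0 rs sr; have s0 := lt_le_trans r0 rs.
have c0 : (0 <= c)%R by exact: le_trans ler01 c1.
rewrite !besov_energyE// -ge0_integralZl_EFin//; last 2 first.
  by move=> x _; exact: osc_ge0.
  by apply: measurable_funTS; exact: measurable_osc.
apply: le_integral_ge0 => x Ax; first exact: osc_ge0.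
exact: osc_le (AS Ax) _ _ _.
Qed.

End doubling_space.

(** * Doubling and codimension of the boundary measure *)

Section setting.
Context {R : realType} {X : completeMetricType R}.
Implicit Types (Omega Z : set X) (m mu nu : {measure set (borel X) -> \bar R}).
Local Open Scope ereal_scope.

Lemma sigma_finite_balls m (A : set X) (x0 : X) : measurable (A : set (borel X)) ->
  (forall r : R, (0 < r)%R -> m (ball x0 r `&` A) < +oo) -> m (~` A) = 0 ->
  sigma_finite setT m.
Proof.
move=> mA fin0 mC.
have mb (r : R) : measurable (ball x0 r : set (borel X)) by exact: ball_borel.
exists (fun n => ball x0 n.+1%:R).
  apply/esym/seteqP; split => // y _; exists (Num.truncn (mdist x0 y)) => //.
  by rewrite ball_mdist; exact: truncnS_gt.
move=> n; split => //; rewrite -(setIT (ball _ _)) -(setUv A) setIUr.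
have mCA : measurable (~` A : set (borel X)) by exact: (@measurableC _ (borel X)).
apply: le_lt_trans (measureU2 _ _ _) _; [exact: measurableI..|].
apply: lte_add_pinfty; first exact: fin0.
apply: le_lt_trans (le_measure _ _ _ _) (_ : m (~` A) < +oo).
- by apply/mem_set; exact: measurableI.
- exact/mem_set.
- exact: subIsetr.
- by rewrite mC.
Qed.

(** A point [y] of the dense set [Omega] within [r / 2] of the centre [x] has
    [ball y (r / 2)] inside [ball x r] and [ball x (2 * r)] inside
    [ball y (4 * r)]; the radii of the two balls of centre [y] differ by three
    doublings. *)
Lemma doubling_dense mu Omega (C : R) : dense Omega ->
  measurable (Omega : set (borel X)) -> (1 <= C)%R ->
  doubling mu Omega C -> doubling_centers mu Omega setT (C ^+ 3).
Proof.
move=> dO mO C1 dmu.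
have mI (x : X) (r : R) : measurable (ball x r `&` Omega : set (borel X)).
  by apply: measurableI => //; exact: ball_borel.
have sub (x y : X) (r s : R) : (mdist y x + r <= s)%R ->
    mu (ball x r `&` Omega) <= mu (ball y s `&` Omega).
  move=> xy; apply: le_measure; [exact/mem_set..|] => z [+ Oz].
  rewrite !ball_mdist => xz; split => //; rewrite ball_mdist.
  by apply: le_lt_trans (metric_triangle _ x _) _; lra.
move=> x r _ r0; have [y Oy xy] := dense_ball x dO (divr_gt0 r0 (ltr0Sn _ 1)).
have r4 : (0 < r / 4)%R by rewrite divr_gt0.
have yx : (mdist y x < r / 2)%R by rewrite metric_sym.
split.
- have [h _ _] := dmu _ _ Oy r4.
  by apply: lt_le_trans h (sub _ _ _ _ _); lra.
- have step (s : R) : (0 < s)%R -> mu (ball y (2 * s) `&` Omega) <= C%:E * mu (ball y s `&` Omega).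
    by move=> s0; have [] := dmu _ _ Oy s0.
  have C0 : 0 <= C%:E :> \bar R by rewrite lee_fin; lra.
  apply: (@le_trans _ _ (mu (ball y (2 * (2 * (2 * (r / 2)))) `&` Omega))).
    by apply: sub; lra.
  apply: le_trans (step _ _) _; first by lra.
  apply: le_trans (lee_wpmul2l C0 (step _ _)) _; first by lra.
  apply: le_trans (lee_wpmul2l C0 (lee_wpmul2l C0 (step _ _))) _; first by lra.
  rewrite !exprS expr0 mulr1 !EFinM -!muleA; do 3 apply: lee_wpmul2l => //.
  by apply: sub; lra.
- have r2 : (0 < 2 * r)%R by lra.
  have [_ _ h] := dmu _ _ Oy r2.
  by apply: le_lt_trans (sub _ _ _ _ _) h; lra.
Qed.

Lemma mdist_diam Z x y : Z x -> Z y -> (mdist x y)%:E <= diam Z.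
Proof. by move=> Zx Zy; apply: ereal_sup_ubound; exists x => //; exists y. Qed.

Lemma ball_diam Z x (r : R) : Z x -> diam Z < r%:E -> ball x r `&` Z = Z.
Proof.
move=> Zx Dr; apply/seteqP; split => [y []//|y Zy]; split => //.
by rewrite ball_mdist -lte_fin; apply: le_lt_trans Dr; exact: mdist_diam.
Qed.

Section codimension.
Context (Omega : set X) (mu nu : {measure set (borel X) -> \bar R}).
Context (theta c0 C : R).
Let Z := boundary Omega.
Hypotheses (mO : measurable (Omega : set (borel X))) (C1 : (1 <= C)%R) (c01 : (1 <= c0)%R).
Hypothesis dmu : doubling_centers mu Omega setT c0.
Hypothesis codim : codim_Ahlfors_regular mu nu Omega theta C.
Hypothesis theta0 : (0 < theta)%R.
Hypothesis D0 : 0 < diam Z.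

(** Above the diameter the radius can be decreased without changing the ball, so
    that the codimension condition applies to every ball. *)
Let le_diam z (r : R) : Z z -> (0 < r)%R -> exists2 r' : R,
  (0 < r')%R /\ r'%:E <= 2%:E * diam Z & ball z r `&` Z = ball z r' `&` Z.
Proof.
move=> Zz r0; have [rD|] := leP r%:E (2%:E * diam Z); first by exists r.
case ED : (diam Z) D0 => [d| |]//; last by rewrite gt0_muley// ltNge leey.
rewrite lte_fin -EFinM lte_fin => d0 dr; exists (2 * d)%R.
  by rewrite lexx mulr_gt0.
by rewrite !ball_diam// ED lte_fin; lra.
Qed.

Let muE z (r : R) : (0 < r)%R -> mu (ball z r `&` Omega) = (volume mu Omega z r)%:E.
Proof. by move=> r0; apply: volumeE; first exact: dmu. Qed.

Lemma codim_volume z (r : R) : Z z -> (0 < r)%R -> r%:E <= 2%:E * diam Z ->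
  [/\ 0 < nu (ball z r `&` Z), nu (ball z r `&` Z) < +oo,
    (volume mu Omega z r <= C * (r `^ theta * volume nu Z z r))%R &
    (r `^ theta * volume nu Z z r <= C * volume mu Omega z r)%R].
Proof.
move=> Zz r0 rD; have := codim Zz r0 rD; rewrite muE// -!EFinM => /andP[lo up].
have V0 : (0 < volume mu Omega z r)%R by apply: volume_gt0; first exact: dmu.
have C0 : (0 < C)%R := lt_le_trans ltr01 C1.
have t0 : (0 < r `^ theta)%R by exact: powR_gt0.
have n0 : 0 < nu (ball z r `&` Z).
  by apply: lt_le_trans lo; rewrite lte_fin !mulr_gt0 ?invr_gt0 ?powR_gt0.
have noo : nu (ball z r `&` Z) < +oo by apply: le_lt_trans up _; rewrite ltry.
have nf : nu (ball z r `&` Z) \is a fin_num by rewrite ge0_fin_numE.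
split => //.
  move: lo; rewrite -(fineK nf) lee_fin -/(volume nu Z z r) powRN => lo.
  rewrite -ler_pdivrMl// mulrC -ler_pdivrMl// mulrC.
  by move: lo; congr (_ <= _)%R; ring.
move: up; rewrite -(fineK nf) lee_fin -/(volume nu Z z r) powRN => up.
by rewrite mulrC -ler_pdivlMr// -mulrA.
Qed.

(** Two balls of [Z] of the same centre are compared through their measures for
    [mu]; the powers of the radii only help. *)
Lemma doubling_boundary : doubling_centers nu Z Z (C * C * c0).
Proof.
have C0 : (0 < C)%R := lt_le_trans ltr01 C1.
have cc1 : (1 <= C * C * c0)%R by rewrite !mulr_ege1.
have posfin z r : Z z -> (0 < r)%R ->
    0 < nu (ball z r `&` Z) /\ nu (ball z r `&` Z) < +oo.
  move=> Zz r0; have [r' [r'0 r'D] ->] := le_diam Zz r0.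
  by have [] := codim_volume Zz r'0 r'D.
move=> z r Zz r0; have [n0 noo] := posfin _ _ Zz r0; split => //.
have r20 : (0 < 2 * r)%R by rewrite mulr_gt0.
have [rD|Dr] := leP (2 * r)%:E (2%:E * diam Z); last first.
  have Dr' : diam Z < r%:E by rewrite -(@lte_pmul2l _ 2%:E)// -EFinM.
  rewrite !ball_diam//; first by rewrite -[leLHS]mul1e; apply: lee_wpmul2r; rewrite ?lee_fin.
  by apply: lt_trans Dr' _; rewrite lte_fin; lra.
have rD' : r%:E <= 2%:E * diam Z by apply: le_trans rD; rewrite lee_fin; lra.
have [_ _ _ up] := codim_volume Zz r20 rD.
have [_ _ lo _] := codim_volume Zz r0 rD'.
have fin s : (0 < s)%R -> nu (ball z s `&` Z) = (volume nu Z z s)%:E.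
  by move=> s0; have [_ h] := posfin _ _ Zz s0; rewrite fineK// ge0_fin_numE.
rewrite !fin// -EFinM lee_fin.
have t0 : (0 < r `^ theta)%R by exact: powR_gt0.
have V20 : (0 <= volume nu Z z (2 * r))%R by rewrite fine_ge0.
rewrite -(ler_pM2l t0).
have h1 : (r `^ theta * volume nu Z z (2 * r) <= C * volume mu Omega z (2 * r))%R.
  apply: le_trans up; apply: ler_wpM2r => //.
  by apply: ge0_ler_powR; rewrite ?nnegrE ?(ltW theta0) ?(ltW r0) ?(ltW r20)//; lra.
have h2 : (volume mu Omega z (2 * r) <= c0 * volume mu Omega z r)%R.
  by rewrite -[2%R]expr1 -[c0]expr1; apply: (volume_doubling _ dmu).
apply: le_trans h1 _; apply: (@le_trans _ _ (C * (c0 * (C * (r `^ theta * volume nu Z z r))))%R).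
  rewrite ler_pM2l//; apply: le_trans h2 _; rewrite ler_wpM2l//.
  exact: le_trans ler01 c01.
by rewrite le_eqVlt; apply/orP; left; apply/eqP; ring.
Qed.

End codimension.

End setting.

(** * The kernel of the extension *)

Lemma clip_lip (R : realDomainType) (a b : R) :
  `|Num.min 1 (Num.max 0 (3 - a)) - Num.min 1 (Num.max 0 (3 - b))| <= `|a - b|.
Proof.
have h (u v : R) : u <= v ->
  `|Num.min 1 (Num.max 0 (3 - u)) - Num.min 1 (Num.max 0 (3 - v))| <= v - u.
  have clip (w : R) : Num.min 1 (Num.max 0 (3 - w)) =
      (if 1 <= 3 - w then 1 else if 0 <= 3 - w then 3 - w else 0).
    by rewrite minEle maxEle; case: (leP 0 (3 - w)) => ?; case: (leP 1 (3 - w)) => ?;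
      rewrite ?ler10 //; lra.
  move=> uv; rewrite ler_norml !clip.
  by case: (leP 1 (3 - u)) => ?; case: (leP 1 (3 - v)) => ?;
    case: (leP 0 (3 - u)) => ?; case: (leP 0 (3 - v)) => ?; apply/andP; split; lra.
have [ab|/ltW ba] := leP a b.
  by apply: le_trans (h _ _ ab) _; rewrite distrC ger0_norm// subr_ge0.
by rewrite distrC; apply: le_trans (h _ _ ba) _; rewrite ger0_norm// subr_ge0.
Qed.

(** [m / d - n / e = ((m - n) + (n / e) * (e - d)) / d]. *)
Lemma ratio_dist_le (R : realFieldType) (d e m n t : R) : 0 < d -> 0 < e -> 0 <= n ->
  `|m - n| <= t -> `|e - d| <= t -> `|m / d - n / e| <= t * (1 + n / e) / d.
Proof.
move=> d0 e0 n0 mn ed; rewrite ler_pdivlMr// -[X in (_ * X)%R](gtr0_norm d0) -normrM.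
have -> : ((m / d - n / e) * d = (m - n) + (n / e) * (e - d))%R.
  by field; rewrite ?gt_eqF.
apply: le_trans (ler_normD _ _) _; rewrite (_ : t * _ = t + t * (n / e))%R; last by ring.
rewrite lerD// normrM.
have ne : (0 <= n / e)%R by rewrite divr_ge0// ltW.
by rewrite ger0_norm// mulrC ler_wpM2r.
Qed.

Section cutoff.
Context {R : realType} {X : completeMetricType R}.
Context (Z : set X) (nu : {measure set (borel X) -> \bar R}).

(** It equals 1 up to the distance [2 * dist_to Z x], 0 from the distance
    [3 * dist_to Z x] on, and it is Lipschitz in between. *)
Definition cutoff (x v : X) : R :=
  Num.min 1 (Num.max 0 (3 - mdist x v / dist_to Z x)).

Definition mass (x : X) : R := fine (\int[nu]_(v in Z) (cutoff x v)%:E)%E.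

End cutoff.

HB.lock Definition extension_kernel {R : realType} {X : completeMetricType R}
    (Z : set X) (nu : {measure set (borel X) -> \bar R}) (x v : X) : R :=
  cutoff Z x v / mass Z nu x.

HB.lock Definition average_kernel {R : realType} {X : completeMetricType R}
    (Z : set X) (nu : {measure set (borel X) -> \bar R})
    (h : X -> \bar R) (y : X) : \bar R :=
  (\int[nu]_(v in Z) ((extension_kernel Z nu y v)%:E * h v))%E.

HB.lock Definition extend {R : realType} {X : completeMetricType R}
    (Z : set X) (nu : {measure set (borel X) -> \bar R})
    (f : X -> R) (x : X) : R :=
  fine (\int[nu]_(v in Z) (extension_kernel Z nu x v * f v)%:E)%E.

Section collar.
Context {R : realType} {X : completeMetricType R}.

(** The bound by the diameter keeps the heights within the range of the radii of
    the codimension condition; higher up the extension is constant. *)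
Definition collar (Z : set X) (T : R) : set X :=
  [set y | ~ Z y /\ dist_to Z y < T /\ ((dist_to Z y)%:E < 2%:E * diam Z)%E].

End collar.

(** The majorant of the difference of two values of the extension at distance
    less than [t]: the [k]-th term is the oscillation of [f] at the scale
    [t * 2 ^+ k], damped by the Lipschitz continuity of the extension at the
    points whose distance to the boundary is about [t * 2 ^+ k]. *)
HB.lock Definition osc_series {R : realType} {X : completeMetricType R}
    (Z : set X) (nu : {measure set (borel X) -> \bar R})
    (f : X -> R) (p t : R) (y : X) : \bar R :=
  (\sum_(k <oo) ((2 `^ (- p)) ^+ k)%:E *
    ((\1_(collar Z (t * 2 ^+ k.+3)) y)%:E *
     average_kernel Z nu (osc nu Z p f (t * 2 ^+ (k + 6))) y))%E.

Section kernel.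
Context {R : realType} {X : completeMetricType R}.
Context (Z : set X) (mu nu : {measure set (borel X) -> \bar R}).
Context (theta c0 c1 cA : R).
Hypotheses (cZ : closed Z) (Z0 : Z !=set0).
Hypotheses (c01 : 1 <= c0) (c11 : 1 <= c1) (cA1 : 1 <= cA).
Hypothesis dmu : doubling_centers mu (~` Z) setT c0.
Hypothesis dnu : doubling_centers nu Z Z c1.
Hypotheses (smu : sigma_finite setT mu) (snu : sigma_finite setT nu).
Hypothesis mdist_measurable :
  measurable_fun [set: borel X * borel X] (fun z => mdist (z.1 : X) (z.2 : X)).

Local Notation delta := (dist_to Z).
Local Notation V := (volume nu Z).
Local Notation cutoff := (cutoff Z).
Local Notation mass := (mass Z nu).
Local Notation kernel := (extension_kernel Z nu).
Local Notation average_kernel := (average_kernel Z nu).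
Local Notation extend := (extend Z nu).
Local Notation collar := (collar Z).

Let mZ : measurable (Z : set (borel X)). Proof. exact: closed_borel. Qed.

Let mO : measurable (~` Z : set (borel X)).
Proof. by apply: open_borel; exact: closed_openC. Qed.

Let delta_gt0 x : ~ Z x -> 0 < delta x.
Proof. exact: dist_to_gt0. Qed.

Let c1_gt0 : 0 < c1. Proof. exact: lt_le_trans ltr01 c11. Qed.

Lemma measurable_dist_to : measurable_fun (setT : set (borel X)) (delta : borel X -> R).
Proof.
apply: continuous_at_borel => [|x _]; first exact: openT.
apply/cvgrPdist_lt => e e0; apply/nbhs_ballP; exists e => //= y.
rewrite ball_mdist => xy.
have h1 := dist_to_lip Z0 x y; have h2 := dist_to_lip Z0 y x.
by rewrite ltr_norml; rewrite [mdist y x]metric_sym in h2; apply/andP; split; lra.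
Qed.

Lemma nearly_closest x : ~ Z x -> exists2 z, Z z & mdist x z < 3 / 2 * delta x.
Proof. by move=> Zx; apply: dist_to_lt => //; have := delta_gt0 Zx; lra. Qed.

Lemma cutoff_ge0 x v : 0 <= cutoff x v.
Proof. by rewrite /cutoff le_min ler01 le_max lexx. Qed.

Lemma cutoff_le1 x v : cutoff x v <= 1.
Proof. by rewrite /cutoff ge_min lexx. Qed.

Lemma cutoff_eq1 x v : ~ Z x -> mdist x v <= 2 * delta x -> cutoff x v = 1.
Proof.
move=> Zx xv; apply/min_idPl; rewrite le_max; apply/orP; right.
have : mdist x v / delta x <= 2 by rewrite ler_pdivrMr ?delta_gt0.
lra.
Qed.

Lemma cutoff_eq0 x v : ~ Z x -> 3 * delta x <= mdist x v -> cutoff x v = 0.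
Proof.
move=> Zx xv; rewrite /cutoff (max_idPl _) ?(min_idPr _) ?ler01//.
by rewrite subr_le0 ler_pdivlMr ?delta_gt0.
Qed.

Lemma measurable_cutoff : measurable_fun [set: borel X * borel X]
  (fun z => cutoff (z.1 : X) (z.2 : X)).
Proof.
apply: measurable_minr => //; apply: measurable_maxr => //.
apply: measurable_funB => //; apply: measurable_funM => //.
have h : measurable_fun (setT : set (borel X)) ((fun x => (delta x)^-1) : borel X -> R).
  have := measurableT_comp (@measurable_powR R (-1)) measurable_dist_to.
  by apply: eq_measurable_fun => x _ /=; rewrite powR_inv1// dist_to_ge0.
exact: (measurableT_comp h measurable_fst).
Qed.

Lemma measurable_cutoffr x :
  measurable_fun (setT : set (borel X)) (cutoff x : borel X -> R).
Proof. exact: measurableT_comp measurable_cutoff (pair1_measurable (x : borel X)). Qed.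

Local Open Scope ereal_scope.

(** The cutoff is 1 on the ball of radius [delta x / 2] around a nearly closest
    boundary point [z], and it vanishes outside the ball of centre [z] and
    radius [5 * delta x]. *)
Lemma mass_bounds x : ~ Z x -> exists2 z, Z z /\ (mdist x z < 3 / 2 * delta x)%R &
  [/\ \int[nu]_(v in Z) (cutoff x v)%:E = (mass x)%:E, (0 < mass x)%R &
      (V z (delta x / 2) <= mass x)%R].
Proof.
move=> Zx; have [z Zz xz] := nearly_closest Zx; exists z => //.
have d0 := delta_gt0 Zx.
have d2 : (0 < delta x / 2)%R by rewrite divr_gt0.
have d5 : (0 < 5 * delta x)%R by rewrite mulr_gt0.
have u0 v : 0 <= (cutoff x v)%:E by rewrite lee_fin cutoff_ge0.
have int1 (r : R) : \int[nu]_(v in ball z r `&` Z) cst 1 v = nu (ball z r `&` Z).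
  by rewrite integral_cst ?mul1e//; exact: ball_setI_borel.
have lo : (V z (delta x / 2))%:E <= \int[nu]_(v in Z) (cutoff x v)%:E.
  rewrite -(volumeE dnu Zz d2) -int1.
  apply: (@le_trans _ _ (\int[nu]_(v in ball z (delta x / 2) `&` Z) (cutoff x v)%:E)).
    apply: le_integral_ge0 => // v [+ Zv]; rewrite ball_mdist => zv.
    rewrite cutoff_eq1//; apply: le_trans (metric_triangle _ z _) _; lra.
  by apply: subset_integral_ge0 => // v [].
have up : \int[nu]_(v in Z) (cutoff x v)%:E <= (V z (5 * delta x))%:E.
  rewrite -(volumeE dnu Zz d5) -int1 integral_ball.
  apply: le_integral_ge0 => // v Zv; rewrite mul1e indicE.
  have [zv|zv] := boolP (mdist z v < 5 * delta x)%R.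
    by rewrite mem_set// lee_fin cutoff_le1.
  rewrite cutoff_eq0 ?lee_fin//; rewrite -leNgt in zv.
  have := metric_triangle z x v; rewrite [mdist z x]metric_sym; lra.
have V0 := volume_gt0 dnu Zz d2.
have mE : \int[nu]_(v in Z) (cutoff x v)%:E = (mass x)%:E.
  rewrite fineK// ge0_fin_numE; last exact: integral_ge0.
  by apply: le_lt_trans up _; rewrite ltry.
by rewrite mE lee_fin in lo; split => //; exact: lt_le_trans lo.
Qed.

Lemma massE x : ~ Z x -> \int[nu]_(v in Z) (cutoff x v)%:E = (mass x)%:E.
Proof. by move=> /mass_bounds[z _ []]. Qed.

Lemma mass_gt0 x : ~ Z x -> (0 < mass x)%R.
Proof. by move=> /mass_bounds[z _ []]. Qed.

Lemma mass_ge0 x : (0 <= mass x)%R.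
Proof. by rewrite fine_ge0// integral_ge0// => v _; rewrite lee_fin cutoff_ge0. Qed.

Lemma measurable_massV : measurable_fun (setT : set (borel X))
  ((fun x => (mass x)^-1)%R : borel X -> R).
Proof.
have h : measurable_fun (setT : set (borel X)) (mass : borel X -> R).
  apply: (@measurableT_comp _ _ _ _ _ _ fine); first exact: fine_measurable.
  apply: (@measurable_integralr _ _ _ _ _ nu snu
    (fun x v : borel X => (cutoff x v)%:E)) => //.
    by move=> x v; rewrite lee_fin cutoff_ge0.
  by apply/measurable_EFinP; exact: measurable_cutoff.
have := measurableT_comp (@measurable_powR R (-1)) h.
by apply: eq_measurable_fun => x _ /=; rewrite powR_inv1// mass_ge0.
Qed.

Lemma kernelE x v : kernel x v = (cutoff x v / mass x)%R.
Proof. by rewrite extension_kernel.unlock. Qed.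

Lemma kernel_ge0 x v : (0 <= kernel x v)%R.
Proof. by rewrite kernelE mulr_ge0 ?cutoff_ge0// invr_ge0 mass_ge0. Qed.

Lemma measurable_kernel : measurable_fun [set: borel X * borel X]
  (fun z => kernel (z.1 : X) (z.2 : X)).
Proof.
under eq_fun do rewrite kernelE.
apply: measurable_funM; first exact: measurable_cutoff.
exact: (measurableT_comp measurable_massV measurable_fst).
Qed.

Lemma measurable_kernelr x :
  measurable_fun (setT : set (borel X)) (kernel x : borel X -> R).
Proof. exact: measurableT_comp measurable_kernel (pair1_measurable (x : borel X)). Qed.

Lemma integral_kernel x : ~ Z x -> \int[nu]_(v in Z) (kernel x v)%:E = 1.
Proof.
move=> Zx; under eq_integral do rewrite kernelE mulrC EFinM.
rewrite ge0_integralZl_EFin//.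
- by rewrite massE// -EFinM mulVf// gt_eqF// mass_gt0.
- by move=> v _; rewrite lee_fin cutoff_ge0.
- by apply/measurable_EFinP; apply: measurable_funTS; exact: measurable_cutoffr.
- by rewrite invr_ge0 mass_ge0.
Qed.

Lemma kernel_eq0 x v : ~ Z x -> (3 * delta x <= mdist x v)%R -> kernel x v = 0%R.
Proof. by move=> Zx xv; rewrite kernelE cutoff_eq0// mul0r. Qed.

(** All the balls of radius comparable to [delta x] and of centre at distance
    less than [3 * delta x] from [x] have comparable volumes, so that the kernel
    is about the inverse of any of them. *)
Lemma kernel_le x v (r : R) : ~ Z x -> Z v -> (0 < r)%R -> (r <= 7 / 2 * delta x)%R ->
  (mdist x v < 3 * delta x)%R -> (kernel x v <= c1 ^+ 4 / V v r)%R.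
Proof.
move=> Zx Zv r0 rd xv; have [z [Zz xz] [_ m0 Vm]] := mass_bounds Zx.
have d0 := delta_gt0 Zx; have d2 : (0 < delta x / 2)%R by rewrite divr_gt0.
have Vv := volume_gt0 dnu Zv r0; have Vz := volume_gt0 dnu Zz d2.
have h : (V v r <= c1 ^+ 4 * V z (delta x / 2))%R.
  apply: (volume_le_ball _ c11 dnu) => //.
  have := metric_triangle z x v; rewrite [mdist z x]metric_sym.
  by rewrite (_ : 2 ^+ 4 = 16)%R; [lra|ring].
apply: (@le_trans _ _ (mass x)^-1%R).
  by rewrite kernelE ler_piMl ?cutoff_le1// invr_ge0 ltW.
have C0 : (0 < c1 ^+ 4)%R by exact: exprn_gt0.
rewrite -(invrK (_ / _)%R) lef_pV2 ?posrE ?invr_gt0 ?divr_gt0//.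
by apply: le_trans Vm; rewrite invf_div ler_pdivrMr// mulrC.
Qed.

(** * From the boundary to the collars *)

Hypothesis theta0 : (0 < theta)%R.
Hypothesis codim : forall v (r : R), Z v -> (0 < r)%R -> r%:E <= 2%:E * diam Z ->
  (volume mu (~` Z) v r <= cA * (r `^ theta * V v r))%R.

(** The points of Omega at height between [s] and [2 * s] above the boundary. *)
Definition layer (s : R) : set X :=
  [set y | ~ Z y /\ (s <= delta y < 2 * s)%R].

(** On the layer the kernel is at most the inverse of the volume of a ball of
    radius [2 * s] of [Z], it vanishes at distance [8 * s] from [v], and the
    ball of radius [8 * s] has, for [mu] and up to constants, at most
    [s `^ theta] times this volume. *)
Lemma layer_mass v (s : R) : Z v -> (0 < s)%R -> s%:E <= 2%:E * diam Z ->
  \int[mu]_(y in layer s) (kernel y v)%:E <=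
  (c1 ^+ 4 * c0 ^+ 3 * cA * (2 * s) `^ theta)%:E.
Proof.
move=> Zv s0 sD.
have s20 : (0 < 2 * s)%R by rewrite mulr_gt0.
have s80 : (0 < 2 ^+ 3 * s)%R by rewrite mulr_gt0// exprn_gt0.
have V0 := volume_gt0 dnu Zv s20.
pose k : R := (c1 ^+ 4 / V v (2 * s))%R.
have c40 : (0 < c1 ^+ 4)%R by exact: exprn_gt0.
have k0 : (0 <= k)%R by rewrite mulr_ge0// ?invr_ge0 ltW.
have Ik : \int[mu]_(y in ball v (2 ^+ 3 * s) `&` ~` Z) k%:E =
    (k * volume mu (~` Z) v (2 ^+ 3 * s))%:E.
  by rewrite integral_cst ?(volumeE dmu)//; exact: ball_setI_borel.
apply: (@le_trans _ _ (\int[mu]_(y in ball v (2 ^+ 3 * s) `&` ~` Z) k%:E)).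
  rewrite (integral_mkcond (layer s : set (borel X))) (integral_mkcond (_ `&` _ : set (borel X))).
  apply: le_integral_ge0 => y _; first by apply: erestrict_ge0 => z _; rewrite lee_fin kernel_ge0.
  rewrite !patchE; have [|_] := boolP (y \in layer s); last by case: ifPn.
  move/set_mem => [Zy /andP[sd ds]].
  have [yv|yv] := leP (3 * delta y)%R (mdist y v).
    by rewrite kernel_eq0//; case: ifPn.
  rewrite mem_set.
    by rewrite lee_fin; apply: kernel_le => //; lra.
  by split => //; rewrite ball_mdist metric_sym (_ : 2 ^+ 3 = 8)%R; [lra|ring].
rewrite Ik lee_fin /k.
have h1 := volume_doubling c01 dmu 3 (Logic.I : setT v) s0.
have h2 := codim Zv s0 sD.
have h3 : (V v s <= V v (2 * s))%R.
  rewrite -[leRHS]mul1r -(expr0 c1); apply: (volume_le_ball _ c11 dnu) => //.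
  by rewrite mdistxx expr0; lra.
have h4 : (s `^ theta <= (2 * s) `^ theta)%R.
  by apply: (ge0_ler_powR (ltW theta0)); rewrite ?nnegrE; lra.
have c0_gt0 : (0 < c0 ^+ 3)%R by rewrite exprn_gt0// (lt_le_trans ltr01).
have cA_gt0 : (0 < cA)%R := lt_le_trans ltr01 cA1.
have h : (volume mu (~` Z) v (2 ^+ 3 * s) <=
    c0 ^+ 3 * (cA * ((2 * s) `^ theta * V v (2 * s))))%R.
  apply: le_trans h1 _; rewrite ler_pM2l//; apply: le_trans h2 _.
  by rewrite ler_pM2l// ler_pM ?powR_ge0 ?fine_ge0.
rewrite mulrAC ler_pdivrMr//; apply: le_trans (ler_wpM2l (ltW c40) h) _.
by rewrite le_eqVlt; apply/orP; left; apply/eqP; ring.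
Qed.

Lemma measurable_layer s : measurable (layer s : set (borel X)).
Proof.
have := measurable_dist_to.
move=> /(_ measurableT `[s, (2 * s)%R[%classic (measurable_itv _)).
rewrite setTI => h.
rewrite (_ : layer s = ~` Z `&` delta @^-1` `[s, (2 * s)%R[%classic).
  exact: measurableI.
by apply/seteqP; split => y; rewrite /layer/= in_itv.
Qed.

Lemma measurable_collar T : measurable (collar T : set (borel X)).
Proof.
have mdelta : measurable_fun (setT : set (borel X)) (EFin \o delta : borel X -> \bar R).
  by apply/measurable_EFinP; exact: measurable_dist_to.
have h1 := emeasurable_fun_infty_o measurableT mdelta T%:E.
have h2 := emeasurable_fun_infty_o measurableT mdelta (2%:E * diam Z).
rewrite (_ : collar T = (~` Z `&` (setT `&` [set x | (EFin \o delta) x < T%:E])) `&`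
    (setT `&` [set x | (EFin \o delta) x < 2%:E * diam Z])).
  by apply: measurableI => //; exact: measurableI.
apply/seteqP; split => y; rewrite /collar/= lte_fin; first by move=> [? []].
by move=> [[? []] _ ? [] _ ?].
Qed.

Definition cmass : R := (c1 ^+ 4 * c0 ^+ 3 * cA / (1 - 2 `^ (- theta)))%R.

(** The collar of width [T] splits into dyadic layers, the layer of height [s]
    contributes [s `^ theta] by codimension: the sum is geometric. *)
Lemma collar_mass v (T : R) : Z v -> (0 < T)%R ->
  \int[mu]_(y in collar T) (kernel y v)%:E <= (cmass * T `^ theta)%:E.
Proof.
move=> Zv T0.
pose s j : R := (T / 2 ^+ j.+1)%R.
have e0 j : (0 < (2 : R) ^+ j)%R by rewrite exprn_gt0.
have s0 j : (0 < s j)%R by rewrite divr_gt0.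
have s2 j : (2 * s j = T / 2 ^+ j)%R.
  by rewrite /s exprS; field; rewrite gt_eqF.
pose L j := layer (s j) `&` collar T.
have mL j : measurable (L j : set (borel X)).
  by apply: measurableI; [exact: measurable_layer|exact: measurable_collar].
have LE : \bigcup_j L j = collar T.
  apply/seteqP; split => [y [j _ []//]|y Cy]; have [Zy [yT yD]] := Cy.
  have d0 := delta_gt0 Zy.
  have [j0 hj0] : exists j, (s j <= delta y)%R.
    have [n /andP[_ nT]] := dyadic_floor (divr_gt0 T0 d0).
    exists `|n|%N; rewrite /s ler_pdivrMr// -ler_pdivrMl// mulrC.
    have nn := le_absz_succ n.
    by apply: le_trans (ltW nT) _; rewrite exprnP ler_weXz2l// ler1n.
  case: (ex_minnP (P := fun j => (s j <= delta y)%R)); first by exists j0.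
  move=> j jd jmin; exists j => //; split => //; split => //; rewrite jd/= s2.
  case: j jd jmin => [|j] jd jmin; first by rewrite expr0 divr1.
  by rewrite ltNge; apply/negP => /jmin; rewrite ltnn.
have tL : trivIset setT L.
  move=> i j _ _ [y [[[_ /andP[i1 i2]] _] [[_ /andP[j1 j2]] _]]].
  have key a b : (a < b)%N -> (s a <= delta y)%R -> (delta y < 2 * s b)%R -> False.
    move=> ab h1 h2; have := le_lt_trans h1 h2; rewrite s2 /s ltNge => /negP; apply.
    by rewrite ler_pM2l// lef_pV2 ?posrE// ler_weXn2l// ler1n.
  by have [ij|ij|//] := ltngtP i j; [case: (key _ _ ij i1 j2)|case: (key _ _ ij j1 i2)].
have mk : measurable_fun (setT : set (borel X)) ((fun y => (kernel y v)%:E) : borel X -> \bar R).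
  apply/measurable_EFinP.
  exact: (measurableT_comp measurable_kernel (pair2_measurable (v : borel X))).
rewrite -LE ge0_integral_bigcup//; last 2 first.
  exact: measurable_funTS.
  by move=> y _; rewrite lee_fin kernel_ge0.
pose a : R := (c1 ^+ 4 * c0 ^+ 3 * cA * T `^ theta)%R.
have x0 : (0 <= 2 `^ (- theta) :> R)%R by rewrite powR_ge0.
have x1 : (2 `^ (- theta) < 1 :> R)%R := powR2N_lt1 theta0.
apply: (@le_trans _ _ (\sum_(j <oo) (a * (2 `^ (- theta)) ^+ j)%:E)); last first.
  by rewrite nneseries_geometric// lee_fin /a /cmass mulrAC.
apply: lee_nneseries => [j _ _|j _]; first by apply: integral_ge0 => y _; rewrite lee_fin kernel_ge0.
have aj0 : (0 <= a * (2 `^ (- theta)) ^+ j)%R.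
  by rewrite /a !mulr_ge0 ?exprn_ge0 ?powR_ge0// (le_trans ler01).
have [[y [[_ /andP[sy _]] [_ [_ yD]]]]|nL] := pselect (L j !=set0); last first.
  rewrite (_ : L j = set0); last by apply/eqP/negPn/negP => /set0P.
  by rewrite integral_set0 lee_fin.
have sD : (s j)%:E <= 2%:E * diam Z by apply: le_trans (ltW yD); rewrite lee_fin.
apply: (@le_trans _ _ (\int[mu]_(y in layer (s j)) (kernel y v)%:E)).
  by apply: subset_integral_ge0 => [z _|z []//]; rewrite lee_fin kernel_ge0.
apply: le_trans (layer_mass Zv (s0 j) sD) _.
rewrite lee_fin s2 /a powRM ?invr_ge0 ?(ltW T0)// ?(ltW (e0 j))// -!mulrA.
rewrite (_ : (2 ^+ j)^-1 `^ theta = (2 `^ (- theta)) ^+ j :> R)%R//.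
rewrite -!powR_mulrn ?powR_ge0// -powRN -!powRrM; congr (_ `^ _)%R; ring.
Qed.

Lemma average_kernelE h y :
  average_kernel h y = \int[nu]_(v in Z) ((kernel y v)%:E * h v).
Proof. by rewrite average_kernel.unlock. Qed.

Section average_kernel.
Context (h : X -> \bar R).
Hypotheses (h0 : forall v, 0 <= h v)
  (mh : measurable_fun (setT : set (borel X)) (h : borel X -> \bar R)).

Let kh0 y v : 0 <= (kernel y v)%:E * h v.
Proof. by rewrite mule_ge0// lee_fin kernel_ge0. Qed.

Let mkh : measurable_fun [set: borel X * borel X]
  (fun z => (kernel (z.1 : X) (z.2 : X))%:E * h (z.2 : X)).
Proof.
apply: emeasurable_funM; first by apply/measurable_EFinP; exact: measurable_kernel.
exact: (measurableT_comp mh measurable_snd).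
Qed.

Lemma average_kernel_ge0 y : 0 <= average_kernel h y.
Proof. by rewrite average_kernelE; exact: integral_ge0. Qed.

Lemma measurable_average_kernel : measurable_fun (setT : set (borel X))
  (average_kernel h : borel X -> \bar R).
Proof.
rewrite average_kernel.unlock.
exact: (@measurable_integralr _ _ _ _ _ nu snu
    (fun y v : borel X => (kernel y v)%:E * h v)).
Qed.

(** By Tonelli, only the integral of the kernel in its first variable matters. *)
Lemma integral_average_kernel (T : R) : (0 < T)%R ->
  \int[mu]_(y in collar T) average_kernel h y <=
  (cmass * T `^ theta)%:E * \int[nu]_(v in Z) h v.
Proof.
move=> T0; under eq_integral do rewrite average_kernelE.
have mC := measurable_collar T.
rewrite (@tonelli _ _ _ _ _ mu nu smu snu
  (fun y v : borel X => (kernel y v)%:E * h v))//.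
have mk v : measurable_fun (setT : set (borel X)) ((fun y => (kernel y v)%:E) : borel X -> \bar R).
  apply/measurable_EFinP.
  exact: (measurableT_comp measurable_kernel (pair2_measurable (v : borel X))).
rewrite -ge0_integralZl//; last 2 first.
  exact: measurable_funTS.
  have [v Zv] := Z0; apply: le_trans (collar_mass Zv T0); apply: integral_ge0 => y _.
  by rewrite lee_fin kernel_ge0.
apply: le_integral_ge0 => v Zv; first exact: integral_ge0.
rewrite ge0_integralZr//; last 2 first.
  exact: measurable_funTS.
  by move=> y _; rewrite lee_fin kernel_ge0.
by apply: lee_wpmul2r => //; exact: collar_mass.
Qed.

End average_kernel.

(** * The extension and the oscillations at its scale *)

Definition integrable_balls (f : X -> R) : Prop := forall z (r : R), Z z -> (0 < r)%R ->
  nu.-integrable (ball z r `&` Z) (EFin \o f).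

Section extend.
Context (f : X -> R).
Hypotheses (mf : measurable_fun (setT : set (borel X)) (f : borel X -> R))
  (If : integrable_balls f).

(** The kernel is bounded and vanishes outside a ball. *)
Lemma integrable_kernel x : ~ Z x ->
  nu.-integrable Z (EFin \o (fun v => kernel x v * f v)%R).
Proof.
move=> Zx; have [z Zz xz] := nearly_closest Zx.
have d0 := delta_gt0 Zx.
have d5 : (0 < 5 * delta x)%R by rewrite mulr_gt0.
have mkf : measurable_fun (setT : set (borel X)) ((fun v => kernel x v * f v)%R : borel X -> R).
  by apply: measurable_funM => //; exact: measurable_kernelr.
have m0 : (0 <= (mass x)^-1)%R by rewrite invr_ge0 mass_ge0.
apply/integrableP; split; first by apply/measurable_EFinP; exact: measurable_funTS.
have /integrableP[_ Ifoo] := If Zz d5.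
apply: (@le_lt_trans _ _ ((mass x)^-1%:E *
    \int[nu]_(v in ball z (5 * delta x) `&` Z) `|(EFin \o f) v|)).
  rewrite -ge0_integralZl_EFin//; last 2 first.
    exact: ball_setI_borel.
    by apply: measurableT_comp => //; apply/measurable_EFinP; exact: measurable_funTS.
  rewrite integral_ball; apply: le_integral_ge0 => // v Zv.
  have [xv|xv] := leP (3 * delta x)%R (mdist x v).
    by rewrite /= kernel_eq0// mul0r normr0 !mule_ge0// ?lee_fin.
  rewrite indicE mem_set/= ?mule1; last first.
    have := metric_triangle z x v; rewrite [mdist z x]metric_sym; lra.
  rewrite -EFinM lee_fin normrM ler_wpM2r// ger0_norm ?kernel_ge0//.
  by rewrite kernelE ler_piMl ?cutoff_le1.
by rewrite lte_mul_pinfty// lee_fin.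
Qed.

Lemma extendE x : ~ Z x ->
  (extend f x)%:E = \int[nu]_(v in Z) (kernel x v * f v)%:E.
Proof. by move=> Zx; rewrite extend.unlock fineK//; exact: (integrable_fin_num _ (integrable_kernel Zx)). Qed.

Lemma integrable_kernel1 x : ~ Z x -> nu.-integrable Z (EFin \o kernel x).
Proof.
move=> Zx; apply/integrableP; split.
  by apply/measurable_EFinP; apply: measurable_funTS; exact: measurable_kernelr.
rewrite (eq_integral (fun v : borel X => (kernel x v)%:E)) ?integral_kernel ?ltry// => v _.
by rewrite /= ger0_norm// kernel_ge0.
Qed.

Lemma integrable_kernelB x (a : R) : ~ Z x ->
  nu.-integrable Z (EFin \o (fun v => kernel x v * (f v - a))%R).
Proof.
move=> Zx.
have := integrableB mZ (integrable_kernel Zx) (integrableZr mZ a (integrable_kernel1 Zx)).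
apply: eq_integrable => // v _ /=.
by rewrite -EFinB mulrBr.
Qed.

(** The kernel has integral 1. *)
Lemma extend_sub x (a : R) : ~ Z x ->
  (extend f x - a)%:E = \int[nu]_(v in Z) (kernel x v * (f v - a))%:E.
Proof.
move=> Zx; rewrite EFinB extendE//.
have -> : a%:E = \int[nu]_(v in Z) ((kernel x v)%:E * a%:E).
  rewrite integralZr//; last exact: integrable_kernel1.
  by rewrite integral_kernel// mul1e.
rewrite -integralB//; last 2 first.
- exact: integrable_kernel.
- by apply: integrableZr => //; exact: integrable_kernel1.
by apply: eq_integral => v _; rewrite -EFinM -EFinB mulrBr.
Qed.

Lemma extend_dist x (a : R) : ~ Z x ->
  `|extend f x - a|%:E <= \int[nu]_(v in Z) (kernel x v * `|f v - a|)%:E.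
Proof.
move=> Zx; rewrite -abse_EFin extend_sub//.
have /integrableP[mk _] := integrable_kernelB a Zx.
apply: le_trans (le_abse_integral _ mZ mk) _; apply: le_integral_ge0 => // v _.
by rewrite /= normrM ger0_norm ?kernel_ge0.
Qed.

Definition mean_dist (S : set X) (a : R) : \bar R :=
  (fine (nu S))^-1%:E * \int[nu]_(w in S) `|f w - a|%:E.

Lemma mean_dist_ge0 S a : 0 <= mean_dist S a.
Proof.
rewrite mule_ge0 ?lee_fin ?invr_ge0 ?fine_ge0//.
by apply: integral_ge0 => w _; rewrite lee_fin.
Qed.

Lemma mean_distD (S : set X) (a b : R) : measurable (S : set (borel X)) ->
  0 < nu S -> nu S < +oo -> `|a - b|%:E <= mean_dist S a + mean_dist S b.
Proof.
move=> mS S0 Soo; rewrite /mean_dist.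
have n0 : (0 < fine (nu S))%R by rewrite fine_gt0// S0.
have ma c : measurable_fun (S : set (borel X)) ((fun w => `|f w - c|%:E) : borel X -> \bar R).
  apply/measurable_EFinP; apply: measurableT_comp => //.
  by apply: measurable_funB => //; exact: measurable_funTS.
rewrite -ge0_muleDr ?integral_ge0// -ge0_integralD//.
apply: (@le_trans _ _ ((fine (nu S))^-1%:E * \int[nu]_(w in S) (cst `|a - b|%:E w))).
  rewrite integral_cst// -(fineK (_ : nu S \is a fin_num)) ?ge0_fin_numE//.
  by rewrite -!EFinM mulrCA mulVf ?mulr1// gt_eqF.
apply: lee_wpmul2l; first by rewrite lee_fin invr_ge0 ltW.
apply: le_integral_ge0 => [w _|w _]; first by rewrite lee_fin.
rewrite -EFinD lee_fin.
by rewrite (le_trans (ler_distD (f w) a b))// [(`|a - _|)%R]distrC.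
Qed.

Context (p : R).
Hypothesis p1 : (1 <= p)%R.

Lemma mean_dist_powR (S : set X) (a : R) : measurable (S : set (borel X)) ->
  0 < nu S -> nu S < +oo -> mean_dist S a `^ p <=
  \int[nu]_(w in S) ((fine (nu S))^-1 * `|f w - a| `^ p)%:E.
Proof.
move=> mS S0 Soo.
have n0 : (0 < fine (nu S))%R by rewrite fine_gt0// S0.
have nE : nu S = (fine (nu S))%:E by rewrite fineK// ge0_fin_numE.
have nV0 : (0 <= (fine (nu S))^-1)%R by rewrite invr_ge0 ltW.
have mfa : measurable_fun (S : set (borel X)) ((fun w => `|f w - a|%R) : borel X -> R).
  by apply: measurableT_comp => //; apply: measurable_funB => //; exact: measurable_funTS.
have i1 : \int[nu]_(x in S) (cst (fine (nu S))^-1%R x)%:E = 1.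
  apply: etrans (integral_cst nu mS (fine (nu S))^-1%:E) _.
  by rewrite [X in _ * X]nE -EFinM mulVf// gt_eqF.
have := @jensen_powR _ _ _ nu S (cst (fine (nu S))^-1%R) (fun w => `|f w - a|%R) p mS p1
  (measurable_cst _) mfa (fun _ _ => nV0) (fun _ _ => normr_ge0 _) i1.
congr (_ `^ _ <= _).
rewrite /mean_dist -ge0_integralZl_EFin//.
by apply/measurable_EFinP.
Qed.

(** Jensen's inequality is used twice: for the mean over [S], and for the mean
    that defines the extension at [y]. The double integral of
    [`|f w - f v| `^ p] over [S] and the kernel is then read with [v] first: for
    each [v] in the support of the kernel the set [S] is a large part of a ball
    of centre [v]. *)
Lemma mean_dist_powR_le (S : set X) (y : X) (rho c : R) : ~ Z y ->
  measurable (S : set (borel X)) -> S `<=` Z -> 0 < nu S -> nu S < +oo ->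
  (0 < rho)%R -> (0 <= c)%R ->
  (forall v, Z v -> (mdist y v < 3 * delta y)%R ->
     S `<=` ball v rho /\ (V v rho <= c * fine (nu S))%R) ->
  mean_dist S (extend f y) `^ p <= c%:E * average_kernel (osc nu Z p f rho) y.
Proof.
move=> Zy mS SZ S0 Soo rho0 c0' Sv.
have n0 : (0 < fine (nu S))%R by rewrite fine_gt0// S0.
have nE : nu S = (fine (nu S))%:E by rewrite fineK// ge0_fin_numE.
set n := fine (nu S) in n0 nE Sv *.
have nV0 : (0 <= n^-1)%R by rewrite invr_ge0 ltW.
have p0 : (0 <= p)%R := le_trans ler01 p1.
set F := extend f y.
have step1 : mean_dist S F `^ p <=
    \int[nu]_(w in S) (n^-1 * `|f w - F| `^ p)%:E.
  exact: mean_dist_powR.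
apply: le_trans step1 _.
have mpow : measurable_fun [set: borel X * borel X]
    (fun z => (kernel y (z.2 : X) * `|f z.2 - f z.1| `^ p)%:E).
  under eq_fun do rewrite EFinM.
  apply: emeasurable_funM; last exact: measurable_powR_diff.
  apply/measurable_EFinP.
  exact: (measurableT_comp (measurable_kernelr y) measurable_snd).
have kp0 w v : 0 <= (kernel y v * `|f v - f w| `^ p)%:E.
  by rewrite lee_fin mulr_ge0 ?kernel_ge0 ?powR_ge0.
have step2 w : (`|f w - F| `^ p)%:E <=
    \int[nu]_(v in Z) (kernel y v * `|f v - f w| `^ p)%:E.
  rewrite -poweR_EFin distrC.
  have mfw : measurable_fun (Z : set (borel X)) ((fun v => `|f v - f w|%R) : borel X -> R).
    by apply: measurableT_comp => //; apply: measurable_funB => //; exact: measurable_funTS.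
  have mky : measurable_fun (Z : set (borel X)) (kernel y : borel X -> R).
    by apply: measurable_funTS; exact: measurable_kernelr.
  apply: le_trans (jensen_powR mZ p1 mky mfw _ _ (integral_kernel Zy)) => //; last first.
    by move=> v _; exact: kernel_ge0.
  by apply: poweR_le => //; exact: extend_dist.
apply: (@le_trans _ _ (\int[nu]_(w in S) \int[nu]_(v in Z)
    (n^-1%:E * (kernel y v * `|f v - f w| `^ p)%:E))).
  apply: le_integral_ge0 => w Sw; first by rewrite lee_fin mulr_ge0 ?powR_ge0.
  rewrite ge0_integralZl_EFin//; first by rewrite EFinM; exact: lee_wpmul2l.
  apply: measurable_funTS.
  exact: (measurableT_comp mpow (pair1_measurable (w : borel X))).
rewrite (@tonelli _ _ _ _ _ nu nu snu snu (fun w v : borel X =>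
  (n^-1%:E * (kernel y v * `|f v - f w| `^ p)%:E)))//; last 2 first.
- by move=> w v; rewrite mule_ge0.
- exact: measurable_funeM.
have mosc := measurable_osc mZ snu mdist_measurable p rho mf.
rewrite average_kernelE -ge0_integralZl_EFin//; last 2 first.
- by move=> v _; rewrite mule_ge0 ?osc_ge0// lee_fin kernel_ge0.
- apply: measurable_funTS; apply: emeasurable_funM => //.
  by apply/measurable_EFinP; exact: measurable_kernelr.
apply: le_integral_ge0 => v Zv.
  by apply: integral_ge0 => w _; rewrite mule_ge0.
have [yv|yv] := leP (3 * delta y)%R (mdist y v).
  rewrite (kernel_eq0 Zy yv) mul0e mule0 integral0_eq// => w _.
  by rewrite mul0r mule0.
have [Sball Vc] := Sv _ Zv yv.
have Vv := volume_gt0 dnu Zv rho0.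
have mfv : measurable_fun (setT : set (borel X))
    ((fun w => (`|f w - f v| `^ p)%:E) : borel X -> \bar R).
  exact: (measurableT_comp (measurable_powR_diff p mf) (pair1_measurable (v : borel X))).
rewrite (eq_integral (fun w : borel X =>
    ((n^-1 * kernel y v)%:E * (`|f w - f v| `^ p)%:E))); last first.
  by move=> w _; rewrite [(`|f v - f w|)%R]distrC EFinM muleA EFinM.
rewrite ge0_integralZl_EFin//; last 2 first.
- exact: measurable_funTS.
- by rewrite mulr_ge0 ?kernel_ge0.
rewrite oscE muleA muleA -!EFinM; apply: lee_pmul.
- by rewrite lee_fin mulr_ge0 ?kernel_ge0.
- by apply: integral_ge0 => w _; rewrite lee_fin powR_ge0.
- rewrite lee_fin [leRHS]mulrAC ler_wpM2r ?kernel_ge0//.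
  by rewrite ler_pdivlMr// mulrC ler_pdivrMr.
- apply: subset_integral_ge0 => [w _|w Sw]; first by rewrite lee_fin powR_ge0.
  by split; [exact: Sball|exact: SZ].
Qed.

Lemma mdist_le_diam y v (D : R) : diam Z <= D%:E -> Z v -> (mdist y v <= delta y + D)%R.
Proof.
move=> ZD Zv; rewrite -lerBlDr; apply: le_dist_to => // z Zz; rewrite lerBlDr.
apply: le_trans (metric_triangle _ z _) _; rewrite lerD2l -lee_fin.
exact: le_trans (mdist_diam Zz Zv) ZD.
Qed.

(** From the distance of the diameter on, all the points of the boundary are at
    distance at most [2 * delta y] from [y], where the cutoff is 1: the kernel is
    constant and so is the extension. *)
Lemma kernel_far y v : ~ Z y -> diam Z <= (delta y)%:E -> Z v ->
  kernel y v = (fine (nu Z))^-1%R.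
Proof.
move=> Zy Dy Zv.
have c1Z w : Z w -> cutoff y w = 1%R.
  by move=> Zw; rewrite cutoff_eq1//; have := mdist_le_diam y Dy Zw; lra.
rewrite kernelE c1Z// /mass mul1r (eq_integral (cst 1)) ?integral_cst ?mul1e//.
by move=> w /set_mem/c1Z ->.
Qed.

Lemma extend_far x y : ~ Z x -> ~ Z y ->
  diam Z <= (delta x)%:E -> diam Z <= (delta y)%:E -> extend f x = extend f y.
Proof.
move=> Zx Zy Dx Dy.
apply: EFin_inj.
rewrite (extendE Zx) (extendE Zy); apply: eq_integral => v /set_mem Zv.
by rewrite !kernel_far.
Qed.

Lemma extend_far_dist y a : ~ Z y -> diam Z <= (delta y)%:E ->
  `|extend f y - a|%:E <= mean_dist Z a.
Proof.
move=> Zy Dy; apply: le_trans (extend_dist a Zy) _; rewrite /mean_dist.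
rewrite -ge0_integralZl_EFin ?invr_ge0 ?fine_ge0//; last first.
  apply/measurable_EFinP; apply: measurableT_comp => //.
  by apply: measurable_funB => //; exact: measurable_funTS.
rewrite le_eqVlt; apply/orP; left; apply/eqP.
by apply: eq_integral => v /set_mem Zv; rewrite kernel_far.
Qed.

Local Notation osc_series := (osc_series Z nu f p).

Lemma osc_seriesE t y : osc_series t y =
  \sum_(k <oo) ((2 `^ (- p)) ^+ k)%:E *
    ((\1_(collar (t * 2 ^+ k.+3)) y)%:E *
     average_kernel (osc nu Z p f (t * 2 ^+ (k + 6))) y).
Proof. by rewrite osc_series.unlock. Qed.

Lemma osc_series_term_ge0 t y k : 0 <= ((2 `^ (- p)) ^+ k)%:E *
    ((\1_(collar (t * 2 ^+ k.+3)) y)%:E *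
     average_kernel (osc nu Z p f (t * 2 ^+ (k + 6))) y).
Proof.
rewrite !mule_ge0 ?lee_fin ?exprn_ge0 ?powR_ge0//.
by apply: average_kernel_ge0 => v; exact: osc_ge0.
Qed.

Lemma osc_series_ge0 t y : 0 <= osc_series t y.
Proof. by rewrite osc_seriesE; apply: nneseries_ge0 => k _ _; exact: osc_series_term_ge0. Qed.

Lemma osc_series_ge t y k : collar (t * 2 ^+ k.+3) y ->
  ((2 `^ (- p)) ^+ k)%:E * average_kernel (osc nu Z p f (t * 2 ^+ (k + 6))) y <=
  osc_series t y.
Proof.
move=> Cy; rewrite osc_seriesE.
apply: le_trans (nneseries_ge_term k (osc_series_term_ge0 t y)).
by rewrite indicE mem_set// mul1e.
Qed.

Let p0 : (0 < p)%R. Proof. exact: lt_le_trans ltr01 p1. Qed.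

Let c14_ge0 : (0 <= c1 ^+ 4)%R.
Proof. by rewrite exprn_ge0// ltW. Qed.

(** The constant of [extend_near_mean_dist], to the power [p], times the
    constant of the comparison of means with oscillations. *)
Definition cdiff : R := ((6 * c1 ^+ 5) `^ p * c1 ^+ 4)%R.

Lemma cdiff_ge0 : (0 <= cdiff)%R.
Proof. by rewrite mulr_ge0// powR_ge0. Qed.

(** For points at distance less than [5 * t] from the boundary, the ball of
    radius [16 * t] contains the support of the kernels, and its oscillations
    are those of the term [k = 0] of the series. *)
Lemma far_ball_mean_dist x y (t : R) : (0 < t)%R -> ~ Z x -> ~ Z y ->
  (mdist x y < t)%R -> (delta x < 5 * t)%R -> (delta y < 5 * t)%R ->
  (delta y)%:E < diam Z ->
  mean_dist (ball x (16 * t) `&` Z) (extend f y) `^ p <=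
  (c1 ^+ 4)%:E * osc_series t y.
Proof.
move=> t0 Zx Zy xy dx dy dyD.
have [z Zz xz] := nearly_closest Zx.
have t8 : (0 < 8 * t)%R by rewrite mulr_gt0.
have t64 : (0 < t * 2 ^+ (0 + 6))%R by rewrite mulr_gt0// exprn_gt0.
have t64E : (t * 2 ^+ (0 + 6) = 64 * t)%R by rewrite add0n; ring.
have dD0 : 0 < diam Z.
  by apply: le_lt_trans dyD; rewrite lee_fin dist_to_ge0.
have sub : ball z (8 * t) `&` Z `<=` ball x (16 * t) `&` Z.
  move=> v [+ Zv]; rewrite !ball_mdist => zv; split => //; rewrite ball_mdist.
  by apply: le_lt_trans (metric_triangle _ z _) _; lra.
have mS : measurable (ball x (16 * t) `&` Z : set (borel X)) by exact: ball_setI_borel.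
have mB : measurable (ball z (8 * t) `&` Z : set (borel X)) by exact: ball_setI_borel.
have le_S : nu (ball z (8 * t) `&` Z) <= nu (ball x (16 * t) `&` Z).
  by apply: le_measure => //; exact/mem_set.
have t32 : (0 < 32 * t)%R by rewrite mulr_gt0.
have S_le : nu (ball x (16 * t) `&` Z) <= nu (ball z (32 * t) `&` Z).
  apply: le_measure; [exact/mem_set|apply/mem_set; exact: ball_setI_borel|].
  move=> v [+ Zv]; rewrite !ball_mdist => xv; split => //; rewrite ball_mdist.
  by apply: le_lt_trans (metric_triangle _ x _) _; rewrite metric_sym; lra.
have S0 : 0 < nu (ball x (16 * t) `&` Z).
  by apply: lt_le_trans le_S; case: (dnu Zz t8).
have Soo : nu (ball x (16 * t) `&` Z) < +oo.
  by apply: le_lt_trans S_le _; case: (dnu Zz t32).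
have Cy : collar (t * 2 ^+ 3) y.
  split => //; split; first by rewrite (_ : 2 ^+ 3 = 8)%R; [lra|ring].
  case ED : (diam Z) dyD dD0 => [D| |]//.
    by rewrite -EFinM !lte_fin; lra.
  by rewrite gt0_muley// ltry.
apply: le_trans (mean_dist_powR_le Zy mS (@subIsetr _ _ _) S0 Soo t64 c14_ge0 _) _.
  move=> v Zv yv; rewrite t64E; split.
    move=> w [+ _]; rewrite !ball_mdist => xw.
    have := metric_triangle v y w; have := metric_triangle y x w.
    by rewrite [mdist v y]metric_sym [mdist y x]metric_sym; lra.
  apply: (@le_trans _ _ (c1 ^+ 4 * V z (8 * t))%R).
    apply: (volume_le_ball _ c11 dnu) => //; first by rewrite mulr_gt0.
    have := metric_triangle z x v; have := metric_triangle x y v.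
    rewrite [mdist z x]metric_sym (_ : 2 ^+ 4 = 16)%R; [lra|ring].
  apply: ler_wpM2l => //; apply: fine_le => //; rewrite ge0_fin_numE//.
  exact: le_lt_trans le_S Soo.
apply: lee_wpmul2l; first by rewrite lee_fin.
by have := osc_series_ge Cy; rewrite expr0 mul1e.
Qed.

(** Close to the boundary, [t] is the larger scale: both values are compared
    with the values of [f] on a ball of radius [16 * t], or on the whole
    boundary when the distance to the boundary exceeds its diameter. *)
Lemma extend_diff_far x y (t : R) : (0 < t)%R -> ~ Z x -> ~ Z y ->
  (mdist x y < t)%R -> (delta y < 4 * t)%R ->
  (`|extend f x - extend f y| `^ p)%:E <=
  cdiff%:E * (osc_series t x + osc_series t y).
Proof.
move=> t0 Zx Zy xy dy.
have dx : (delta x < 5 * t)%R by have := dist_to_lip Z0 x y; lra.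
have dy5 : (delta y < 5 * t)%R by lra.
have yx : (mdist y x < t)%R by rewrite metric_sym.
set S := ball x (16 * t) `&` Z.
have mS : measurable (S : set (borel X)) by exact: ball_setI_borel.
have xx : (mdist x x < t)%R by rewrite mdistxx.
have hx := far_ball_mean_dist t0 Zx Zx xx dx dx.
have hy := far_ball_mean_dist t0 Zx Zy xy dx dy5.
have Sx0 := osc_series_ge0 t x; have Sy0 := osc_series_ge0 t y.
have c14_le : (2 `^ p * c1 ^+ 4 <= cdiff)%R.
  rewrite /cdiff ler_wpM2r//; apply: (ge0_ler_powR (ltW p0)); rewrite ?nnegrE//.
    by rewrite mulr_ge0// exprn_ge0// ltW.
  have : (1 <= c1 ^+ 5)%R by rewrite exprn_ege1.
  lra.
have c1_le : (c1 ^+ 4 <= cdiff)%R.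
  apply: le_trans c14_le; rewrite ler_peMl//.
  by rewrite -[leLHS](powRr0 2) ler_powR ?ler1n// ltW.
have SZ y' : ~ Z y' -> (mdist x y' < t)%R -> (delta y' < 5 * t)%R ->
    diam Z <= (delta y')%:E -> S = Z.
  move=> Zy' xy' dy' Dy'; apply/seteqP; split => [v []//|v Zv]; split => //.
  rewrite ball_mdist; apply: le_lt_trans (metric_triangle _ y' _) _.
  by have := mdist_le_diam y' Dy' Zv; lra.
have one (A : \bar R) (a : R) : 0 <= A -> a%:E `^ p <= (c1 ^+ 4)%:E * A ->
    (a `^ p)%:E <= cdiff%:E * A.
  move=> A0 h; apply: le_trans h _; apply: lee_wpmul2r => //.
have [Dx|xD] := leP (diam Z) (delta x)%:E; have [Dy|yD] := leP (diam Z) (delta y)%:E.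
- rewrite (extend_far Zx Zy)// subrr normr0 powR0 ?gt_eqF//.
  by rewrite mule_ge0 ?adde_ge0// lee_fin cdiff_ge0.
- apply: le_trans (_ : cdiff%:E * osc_series t y <= _); last first.
    by apply: lee_wpmul2l; rewrite ?lee_fin ?cdiff_ge0// leeDr.
  apply: one => //; apply: le_trans (hy yD); (apply: poweR_le; [exact: ltW|by rewrite lee_fin|]).
  by rewrite -/S (SZ x)//; exact: extend_far_dist.
- apply: le_trans (_ : cdiff%:E * osc_series t x <= _); last first.
    by apply: lee_wpmul2l; rewrite ?lee_fin ?cdiff_ge0// leeDl.
  apply: one => //; apply: le_trans (hx xD); (apply: poweR_le; [exact: ltW|by rewrite lee_fin|]).
  by rewrite -/S (SZ y)// distrC; exact: extend_far_dist.
have [z Zz xz] := nearly_closest Zx.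
have t8 : (0 < 8 * t)%R by rewrite mulr_gt0.
have t32 : (0 < 32 * t)%R by rewrite mulr_gt0.
have S0 : 0 < nu S.
  have [h _ _] := dnu Zz t8; apply: lt_le_trans h _.
  apply: le_measure; [apply/mem_set; exact: ball_setI_borel|exact/mem_set|].
  move=> v [+ Zv]; rewrite !ball_mdist => zv; split => //; rewrite ball_mdist.
  by apply: le_lt_trans (metric_triangle _ z _) _; lra.
have Soo : nu S < +oo.
  have [_ _ h] := dnu Zz t32; apply: le_lt_trans _ h.
  apply: le_measure; [exact/mem_set|apply/mem_set; exact: ball_setI_borel|].
  move=> v [+ Zv]; rewrite !ball_mdist => xv; split => //; rewrite ball_mdist.
  by apply: le_lt_trans (metric_triangle _ x _) _; rewrite metric_sym; lra.
rewrite -poweR_EFin.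
apply: le_trans (poweR_le (ltW p0) _ (mean_distD (extend f x) (extend f y) mS S0 Soo)) _.
  by rewrite lee_fin.
apply: le_trans (poweRD_le (mean_dist_ge0 _ _) (mean_dist_ge0 _ _) (ltW p0)) _.
apply: (@le_trans _ _ ((2 `^ p)%:E * ((c1 ^+ 4)%:E * osc_series t x + (c1 ^+ 4)%:E * osc_series t y))).
  by apply: lee_wpmul2l; [rewrite lee_fin powR_ge0|apply: leeD; [exact: hx|exact: hy]].
rewrite -ge0_muleDr// muleA -EFinM; apply: lee_wpmul2r; first exact: adde_ge0.
by rewrite lee_fin.
Qed.

(** The cutoff is a 1-Lipschitz function of the ratio of the distances, and the
    ratio varies by at most a multiple of [t / delta y] as long as one of the two
    ratios is less than 3. *)
Lemma cutoff_diff_le x y w (t : R) : (0 < t)%R -> ~ Z x -> ~ Z y ->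
  (mdist x y < t)%R -> (4 * t <= delta y)%R ->
  (`|cutoff x w - cutoff y w| <= 6 * (t / delta y))%R.
Proof.
move=> t0 Zx Zy xy yt.
have dx0 := delta_gt0 Zx; have dy0 := delta_gt0 Zy.
have xyd : (`|delta x - delta y| <= t)%R.
  have h1 := dist_to_lip Z0 x y; have h2 := dist_to_lip Z0 y x.
  by rewrite [mdist y x]metric_sym in h2; rewrite ler_norml; apply/andP; split; lra.
have xyw : (`|mdist x w - mdist y w| <= t)%R.
  have h1 := metric_triangle x y w; have h2 := metric_triangle y x w.
  by rewrite [mdist y x]metric_sym in h2; rewrite ler_norml; apply/andP; split; lra.
have dxy : (3 * delta y <= 4 * delta x)%R by move: xyd; rewrite ler_norml => /andP[? ?]; lra.
have td : (0 <= t / delta y)%R by rewrite divr_ge0// ltW.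
have [yw|yw] := ltP (mdist y w / delta y)%R 3%R.
  apply: le_trans (clip_lip _ _) _.
  apply: le_trans (ratio_dist_le dx0 dy0 (mdist_ge0 _ _) xyw _) _; first by rewrite distrC.
  rewrite ler_pdivrMr// [leRHS](_ : _ = t * (6 * (delta x / delta y)))%R; last by ring.
  rewrite ler_pM2l// (_ : 6 * (delta x / delta y) = (6 * delta x) / delta y)%R ?mulrA//.
  apply: (@le_trans _ _ 4%R); first by lra.
  by rewrite ler_pdivlMr//; lra.
have [xw|xw] := ltP (mdist x w / delta x)%R 3%R.
  rewrite distrC; apply: le_trans (clip_lip _ _) _.
  apply: le_trans (ratio_dist_le dy0 dx0 (mdist_ge0 _ _) _ xyd) _; first by rewrite distrC.
  rewrite mulrAC mulrC ler_wpM2r//; lra.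
rewrite (cutoff_eq0 Zx) ?(cutoff_eq0 Zy) ?subrr ?normr0 -?ler_pdivlMr//.
by rewrite mulr_ge0.
Qed.

(** Away from the boundary, the difference is the integral of the difference of
    the two cutoffs against [f - extend f y] for the single normalization
    [mass x], since the integral of [f - extend f y] against the cutoff at [y]
    vanishes. *)
Lemma extend_near_mean_dist x y (t : R) : (0 < t)%R -> ~ Z x -> ~ Z y ->
  (mdist x y < t)%R -> (4 * t <= delta y)%R ->
  `|extend f x - extend f y|%:E <=
  (6 * c1 ^+ 5 * (t / delta y))%:E *
    mean_dist (ball y (4 * delta y) `&` Z) (extend f y).
Proof.
move=> t0 Zx Zy xy yt; set a := extend f y; set S := ball y _ `&` Z.
have dx0 := delta_gt0 Zx; have dy0 := delta_gt0 Zy.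
have h1 := dist_to_lip Z0 x y; have h2 := dist_to_lip Z0 y x.
rewrite [mdist y x]metric_sym in h2.
have mx0 := mass_gt0 Zx; have my0 := mass_gt0 Zy.
have mS : measurable (S : set (borel X)) by exact: ball_setI_borel.
have td : (0 <= t / delta y)%R by rewrite divr_ge0// ltW.
have Ix := integrable_kernelB a Zx; have Iy := integrable_kernelB a Zy.
have E0 : \int[nu]_(v in Z) (kernel y v * (f v - a))%:E = 0.
  by rewrite -extend_sub// subrr.
have E1 : (extend f x - a)%:E =
    \int[nu]_(v in Z) ((mass x)^-1 * ((cutoff x v - cutoff y v) * (f v - a)))%:E.
  rewrite extend_sub// -[LHS]sube0 -(mule0 (mass y / mass x)%:E) -E0.
  rewrite -integralZl// -integralB//; last exact: integrableZl.
  apply: eq_integral => v _; rewrite -EFinM -EFinB !kernelE; congr EFin.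
  by field; rewrite !gt_eqF.
have mdiff : measurable_fun (Z : set (borel X))
    ((fun v => ((mass x)^-1 * ((cutoff x v - cutoff y v) * (f v - a)))%:E) : borel X -> \bar R).
  apply/measurable_EFinP; apply: measurable_funM => //; apply: measurable_funM.
    apply: measurable_funB; apply: measurable_funTS; exact: measurable_cutoffr.
  by apply: measurable_funB => //; exact: measurable_funTS.
have mfa : measurable_fun (S : set (borel X)) ((fun v => `|f v - a|%:E) : borel X -> \bar R).
  apply/measurable_EFinP; apply: measurableT_comp => //.
  by apply: measurable_funB => //; exact: measurable_funTS.
rewrite -abse_EFin E1; apply: le_trans (le_abse_integral _ mZ mdiff) _.
pose k : R := ((mass x)^-1 * (6 * (t / delta y)))%R.
have k0 : (0 <= k)%R by rewrite mulr_ge0 ?invr_ge0 ?(ltW mx0)// mulr_ge0.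
apply: (@le_trans _ _ (\int[nu]_(v in S) (k%:E * `|f v - a|%:E))).
  rewrite integral_ball; apply: le_integral_ge0 => // v Zv.
  rewrite indicE; have [yv|yv] := ltP (mdist y v) (4 * delta y)%R.
    rewrite mem_set// mule1 -EFinM /= lee_fin normrM /k -mulrA.
    rewrite ger0_norm ?invr_ge0 ?(ltW mx0)// ler_wpM2l ?invr_ge0 ?(ltW mx0)//.
    by rewrite normrM ler_wpM2r//; exact: cutoff_diff_le.
  rewrite !cutoff_eq0 ?subrr ?mul0r ?mulr0 ?abse0 ?mule_ge0 ?lee_fin//; first by lra.
  by have := metric_triangle y x v; rewrite [mdist y x]metric_sym; lra.
rewrite ge0_integralZl_EFin// /mean_dist muleA; apply: lee_wpmul2r.
  by apply: integral_ge0 => w _; rewrite lee_fin.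
have [z [Zz xz] [_ _ Vm]] := mass_bounds Zx.
have dx2 : (0 < delta x / 2)%R by rewrite divr_gt0.
have dx32 : (0 < 2 ^+ 5 * (delta x / 2))%R by rewrite mulr_gt0// exprn_gt0.
have Sz : S `<=` ball z (2 ^+ 5 * (delta x / 2)) `&` Z.
  move=> v [+ Zv]; rewrite ball_mdist => yv; split => //; rewrite ball_mdist.
  have := metric_triangle z x v; have := metric_triangle x y v.
  by rewrite [mdist z x]metric_sym (_ : 2 ^+ 5 = 32)%R; [lra|ring].
have nuS : nu S <= (c1 ^+ 5 * mass x)%:E.
  apply: (@le_trans _ _ (nu (ball z (2 ^+ 5 * (delta x / 2)) `&` Z))).
    by apply: le_measure; [exact/mem_set|apply/mem_set; exact: ball_setI_borel|].
  rewrite (volumeE dnu)// lee_fin; apply: le_trans (volume_doubling c11 dnu 5 Zz dx2) _.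
  by rewrite ler_wpM2l// exprn_ge0// ltW.
have S0 : 0 < nu S.
  have [z' Zz' yz'] := nearly_closest Zy.
  have [h _ _] := dnu Zz' dy0; apply: lt_le_trans h _.
  apply: le_measure; [apply/mem_set; exact: ball_setI_borel|exact/mem_set|].
  move=> v [+ Zv]; rewrite !ball_mdist => zv; split => //; rewrite ball_mdist.
  by apply: le_lt_trans (metric_triangle _ z' _) _; lra.
have Sfin : nu S \is a fin_num by rewrite ge0_fin_numE// (le_lt_trans nuS) ?ltry.
have n0 : (0 < fine (nu S))%R by rewrite fine_gt0// S0 -ge0_fin_numE.
move: nuS; rewrite -(fineK Sfin) lee_fin => nuS.
rewrite -EFinM lee_fin /k ler_pdivlMr//; apply: le_trans (ler_wpM2l k0 nuS) _.
by rewrite /k le_eqVlt; apply/orP; left; apply/eqP; field; rewrite !gt_eqF.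
Qed.

(** The index [k] is such that [delta y] is between [t * 2 ^+ (k + 2)] and
    [t * 2 ^+ k.+3]; the gain is the factor [t / delta y <= 2^-1 ^+ k]. *)
Lemma extend_diff_near x y (t : R) : (0 < t)%R -> ~ Z x -> ~ Z y ->
  (mdist x y < t)%R -> (4 * t <= delta y)%R ->
  (`|extend f x - extend f y| `^ p)%:E <=
  cdiff%:E * (osc_series t x + osc_series t y).
Proof.
move=> t0 Zx Zy xy yt.
have dy0 := delta_gt0 Zy.
have Sx0 := osc_series_ge0 t x; have Sy0 := osc_series_ge0 t y.
have D0 : 0 <= diam Z.
  by have [z Zz] := Z0; apply: le_trans (mdist_diam Zz Zz); rewrite lee_fin mdist_ge0.
have [Dy|yD] := leP (2%:E * diam Z) (delta y)%:E.
  rewrite (extend_far Zx Zy).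
  - rewrite subrr normr0 powR0 ?gt_eqF//.
    by rewrite mule_ge0 ?adde_ge0// lee_fin cdiff_ge0.
  - have := dist_to_lip Z0 y x; rewrite [mdist y x]metric_sym.
    case: (diam Z) D0 Dy => [D| |]//; last by rewrite gt0_muley.
    by rewrite -EFinM !lee_fin; lra.
  - case: (diam Z) D0 Dy => [D| |]//; last by rewrite gt0_muley.
    by rewrite -EFinM !lee_fin; lra.
have [n /andP[n1 n2]] := dyadic_floor (divr_gt0 dy0 t0).
have n_ge2 : (2 <= n)%R.
  (* [4 <= delta y / t < 2 ^ (n + 1)] *)
  have : (2 ^ 2 < 2 ^ (n + 1) :> R)%R.
    by apply: le_lt_trans n2; rewrite ler_pdivlMr// -exprnP (_ : 2 ^+ 2 = 4)%R; [|ring].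
  by rewrite ltr_eXz2l ?ltr1n//; clear; lia.
pose k := `|n - 2|%N.
have kE : n = (k + 2)%N :> int by rewrite /k; move: n_ge2; clear; lia.
rewrite kE -exprnP in n1.
rewrite kE (_ : ((k + 2)%N%:Z + 1)%R = (k.+3)%:Z) -?exprnP in n2; last by clear; lia.
have {}n1 : (t * 2 ^+ (k + 2) <= delta y)%R by rewrite mulrC -ler_pdivlMr.
have {}n2 : (delta y < t * 2 ^+ k.+3)%R.
  by rewrite mulrC -ltr_pdivrMr.
have e0 j : (0 < (2 : R) ^+ j)%R by rewrite exprn_gt0.
have Cy : collar (t * 2 ^+ k.+3) y by [].
set S := ball y (4 * delta y) `&` Z.
set rho := (t * 2 ^+ (k + 6))%R.
have rho0 : (0 < rho)%R by rewrite mulr_gt0.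
have rho_ub : (rho <= 16 * delta y)%R.
  apply: le_trans (_ : 16 * (t * 2 ^+ (k + 2)) <= _)%R; last by rewrite ler_pM2l.
  by rewrite /rho le_eqVlt; apply/orP; left; apply/eqP; rewrite !exprD; ring.
have rho_lb : (8 * delta y < rho)%R.
  apply: lt_le_trans (_ : 8 * (t * 2 ^+ k.+3) <= _)%R; first by rewrite ltr_pM2l.
  by rewrite /rho le_eqVlt; apply/orP; left; apply/eqP; rewrite !exprS exprD; ring.
have mS : measurable (S : set (borel X)) by exact: ball_setI_borel.
have [z Zz yz] := nearly_closest Zy.
have dy2 : (0 < 2 * delta y)%R by rewrite mulr_gt0.
have dy8 : (0 < 8 * delta y)%R by rewrite mulr_gt0.
have le_S : nu (ball z (2 * delta y) `&` Z) <= nu S.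
  apply: le_measure; [apply/mem_set; exact: ball_setI_borel|exact/mem_set|].
  move=> v [+ Zv]; rewrite !ball_mdist => zv; split => //; rewrite ball_mdist.
  by apply: le_lt_trans (metric_triangle _ z _) _; lra.
have S0 : 0 < nu S by apply: lt_le_trans le_S; case: (dnu Zz dy2).
have Soo : nu S < +oo.
  have [_ _ h] := dnu Zz dy8; apply: le_lt_trans _ h.
  apply: le_measure; [exact/mem_set|apply/mem_set; exact: ball_setI_borel|].
  move=> v [+ Zv]; rewrite !ball_mdist => yv; split => //; rewrite ball_mdist.
  by apply: le_lt_trans (metric_triangle _ y _) _; rewrite metric_sym; lra.
have Q : mean_dist S (extend f y) `^ p <=
    (c1 ^+ 4)%:E * average_kernel (osc nu Z p f rho) y.
  apply: mean_dist_powR_le => //; first exact: subIsetr.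
  move=> v Zv yv; split.
    move=> w [+ _]; rewrite !ball_mdist => yw.
    have := metric_triangle v y w.
    by rewrite [mdist v y]metric_sym; lra.
  apply: (@le_trans _ _ (c1 ^+ 4 * V z (2 * delta y))%R).
    apply: (volume_le_ball _ c11 dnu) => //.
    have := metric_triangle z y v.
    by rewrite [mdist z y]metric_sym (_ : 2 ^+ 4 = 16)%R; [lra|ring].
  apply: ler_wpM2l => //; apply: fine_le => //; rewrite ge0_fin_numE//.
  exact: le_lt_trans le_S Soo.
have tk : (t / delta y <= 2^-1 ^+ k)%R.
  rewrite ler_pdivrMr// exprVn -ler_pdivrMl ?invr_gt0// invrK.
  apply: le_trans n1; rewrite mulrC ler_pM2l// ler_weXn2l ?ler1n// leq_addr//.
have td0 : (0 <= t / delta y)%R by rewrite divr_ge0// ltW.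
have c5 : (0 <= 6 * c1 ^+ 5)%R by rewrite mulr_ge0// exprn_ge0// ltW.
have tkp : ((t / delta y) `^ p <= (2 `^ (- p)) ^+ k)%R.
  apply: le_trans (ge0_ler_powR (ltW p0) _ _ tk) _; rewrite ?nnegrE ?exprn_ge0//.
  by rewrite powR_half_exp.
apply: le_trans (_ : cdiff%:E * osc_series t y <= _); last first.
  by apply: lee_wpmul2l; rewrite ?lee_fin ?cdiff_ge0// leeDr.
rewrite -poweR_EFin.
apply: le_trans (poweR_le (ltW p0) _ (extend_near_mean_dist t0 Zx Zy xy yt)) _.
  by rewrite lee_fin.
rewrite poweRM ?mean_dist_ge0 ?lee_fin//; last exact: mulr_ge0.
rewrite poweR_EFin powRM// EFinM -muleA /cdiff [((_ `^ p) * c1 ^+ 4)%:E]EFinM -muleA.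
apply: lee_wpmul2l; first by rewrite lee_fin powR_ge0.
apply: (@le_trans _ _ (((2 `^ (- p)) ^+ k)%:E * ((c1 ^+ 4)%:E * average_kernel (osc nu Z p f rho) y))).
  by apply: lee_pmul => //; rewrite ?lee_fin ?powR_ge0 ?poweR_ge0.
rewrite muleCA; apply: lee_wpmul2l; first by rewrite lee_fin.
exact: osc_series_ge.
Qed.

Lemma extend_diff_le x y (t : R) : (0 < t)%R -> ~ Z x -> ~ Z y ->
  (mdist x y < t)%R ->
  (`|extend f x - extend f y| `^ p)%:E <=
  cdiff%:E * (osc_series t x + osc_series t y).
Proof.
move=> t0 Zx Zy xy; have [yt|yt] := leP (4 * t)%R (delta y).
  exact: extend_diff_near.
exact: extend_diff_far.
Qed.

(** * Energies of the extension *)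

Lemma measurable_osc_series t :
  measurable_fun (setT : set (borel X)) (osc_series t : borel X -> \bar R).
Proof.
rewrite osc_series.unlock.
apply: (@ge0_emeasurable_sum _ (borel X) R setT (fun k y => ((2 `^ (- p)) ^+ k)%:E *
    ((\1_(collar (t * 2 ^+ k.+3)) y)%:E *
     average_kernel (osc nu Z p f (t * 2 ^+ (k + 6))) y)) xpredT) => [k y _ _|k _].
  exact: osc_series_term_ge0.
apply: measurable_funeM; apply: emeasurable_funM.
  by apply/measurable_EFinP; apply: measurable_indic; exact: measurable_collar.
apply: measurable_average_kernel; first by move=> v; exact: osc_ge0.
exact: measurable_osc.
Qed.

(** The integral of the kernel against [f] is the difference of two integrals of
    nonnegative functions, to which Tonelli applies. *)
Lemma measurable_extend :
  measurable_fun (setT : set (borel X)) (extend f : borel X -> R).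
Proof.
rewrite extend.unlock.
apply: (@measurableT_comp _ _ _ _ _ _ fine); first exact: fine_measurable.
pose g (z : borel X * borel X) : \bar R := (kernel z.1 z.2 * f z.2)%:E.
have mg : measurable_fun [set: borel X * borel X] g.
  apply/measurable_EFinP; apply: measurable_funM; first exact: measurable_kernel.
  exact: (measurableT_comp mf measurable_snd).
rewrite (_ : (fun x => _) = (fun x : borel X =>
    \int[nu]_(v in Z) g^\+ (x, v) - \int[nu]_(v in Z) g^\- (x, v))); last first.
  apply/funext => x; rewrite integralE; congr (_ - _); apply: eq_integral => v _.
    by rewrite !funeposE.
  by rewrite !funenegE.
apply: emeasurable_funB.
  apply: (@measurable_integralr _ _ _ _ _ nu snu (fun x v : borel X => g^\+ (x, v))) => //.
  by under eq_fun do rewrite -surjective_pairing; exact: measurable_funepos.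
apply: (@measurable_integralr _ _ _ _ _ nu snu (fun x v : borel X => g^\- (x, v))) => //.
by under eq_fun do rewrite -surjective_pairing; exact: measurable_funeneg.
Qed.

Lemma integral_osc_series (t : R) : (0 < t)%R ->
  \int[mu]_(y in ~` Z) osc_series t y <=
  \sum_(k <oo) ((2 `^ (- p)) ^+ k)%:E * ((cmass * (t * 2 ^+ k.+3) `^ theta)%:E *
    besov_energy nu Z p f (t * 2 ^+ (k + 6))).
Proof.
move=> t0; have e0 j : (0 < (2 : R) ^+ j)%R by rewrite exprn_gt0.
have P0 r y : 0 <= average_kernel (osc nu Z p f r) y.
  by apply: average_kernel_ge0 => v; exact: osc_ge0.
have mP r : measurable_fun (setT : set (borel X))
    (average_kernel (osc nu Z p f r) : borel X -> \bar R).
  apply: measurable_average_kernel; first by move=> v; exact: osc_ge0.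
  exact: measurable_osc.
have mC T : measurable (collar T : set (borel X)) by exact: measurable_collar.
have mI T r : measurable_fun (~` Z : set (borel X)) ((fun y =>
    (\1_(collar T) y)%:E * average_kernel (osc nu Z p f r) y) : borel X -> \bar R).
  apply: emeasurable_funM; last exact: measurable_funTS.
  by apply/measurable_EFinP; apply: measurable_funTS; exact: measurable_indic.
under eq_integral do rewrite osc_seriesE.
rewrite integral_nneseries//; last 2 first.
- by move=> k; exact: measurable_funeM.
- by move=> k y _; exact: osc_series_term_ge0.
apply: lee_nneseries => k _.
  by move=> _; apply: integral_ge0 => y _; exact: osc_series_term_ge0.
rewrite ge0_integralZl_EFin ?exprn_ge0 ?powR_ge0//; last first.
  by move=> y _; rewrite mule_ge0// lee_fin.
apply: lee_wpmul2l; first by rewrite lee_fin exprn_ge0// powR_ge0.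
have -> : besov_energy nu Z p f (t * 2 ^+ (k + 6)) =
    \int[nu]_(v in Z) osc nu Z p f (t * 2 ^+ (k + 6)) v.
  by rewrite (besov_energyE _ dnu)// mulr_gt0.
apply: le_trans (integral_average_kernel _ _ _) => //; last 3 first.
- by move=> v; exact: osc_ge0.
- exact: measurable_osc.
- by rewrite mulr_gt0.
rewrite [in leRHS](_ : collar _ = ~` Z `&` collar (t * 2 ^+ k.+3)); last first.
  by apply/esym/setIidr => y [].
rewrite integral_mkcondr le_eqVlt; apply/orP; left; apply/eqP.
apply: eq_integral => y _; rewrite patchE indicE.
by case: ifPn => _; rewrite ?mul1e ?mul0e.
Qed.

(** In [osc_series t x + osc_series t y] the first term is constant on the ball of
    centre [x], and the second one is averaged over this ball. *)
Lemma besov_energy_extend (t : R) : (0 < t)%R ->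
  besov_energy mu (~` Z) p (extend f) t <=
  (cdiff * (1 + c0))%:E * \int[mu]_(y in ~` Z) osc_series t y.
Proof.
move=> t0; set S := osc_series t.
have S0 y : 0 <= S y by exact: osc_series_ge0.
have mS : measurable_fun (setT : set (borel X)) (S : borel X -> \bar R).
  exact: measurable_osc_series.
have cd0 := cdiff_ge0.
have c0_ge0 : (0 <= c0)%R by exact: le_trans ler01 c01.
have T (x : X) : [set: X] x by [].
rewrite (besov_energyE (@subsetT _ _) dmu)//.
pose A x := ((volume mu (~` Z) x t)^-1)%:E * \int[mu]_(y in ball x t `&` ~` Z) S y.
have A0 x : 0 <= A x by rewrite mule_ge0 ?lee_fin ?invr_ge0 ?fine_ge0// integral_ge0.
have mA : measurable_fun (setT : set (borel X)) (A : borel X -> \bar R).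
  apply: emeasurable_funM.
    by apply/measurable_EFinP; exact: measurable_volumeV.
  apply: measurable_ball_integral => //.
  exact: (measurableT_comp mS measurable_snd).
apply: (@le_trans _ _ (\int[mu]_(x in ~` Z) (cdiff%:E * (S x + A x)))).
  apply: le_integral_ge0 => x Zx; first exact: osc_ge0.
  have mB : measurable (ball x t `&` ~` Z : set (borel X)) by exact: ball_setI_borel.
  have V0 := volume_gt0 dmu (T x) t0.
  rewrite oscE; apply: (@le_trans _ _ (((volume mu (~` Z) x t)^-1)%:E *
      \int[mu]_(y in ball x t `&` ~` Z) (cdiff%:E * (S x + S y)))).
    apply: lee_wpmul2l; first by rewrite lee_fin invr_ge0 ltW.
    apply: le_integral_ge0 => [y _|y [+ Zy]]; first by rewrite lee_fin powR_ge0.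
    rewrite ball_mdist => xy; rewrite distrC; exact: extend_diff_le.
  rewrite ge0_integralZl_EFin//; last 2 first.
  - by move=> y _; rewrite adde_ge0.
  - by apply: emeasurable_funD => //; exact: measurable_funTS.
  rewrite ge0_integralD//; last exact: measurable_funTS.
  rewrite integral_cst// (volumeE dmu)// muleCA; apply: lee_wpmul2l.
    by rewrite lee_fin.
  rewrite ge0_muleDr ?mule_ge0 ?integral_ge0// ?lee_fin ?(ltW V0)//.
  by rewrite muleCA -EFinM mulVf ?gt_eqF// mule1.
rewrite ge0_integralZl_EFin//; last 2 first.
- by move=> y _; rewrite adde_ge0.
- by apply: measurable_funTS; exact: emeasurable_funD.
rewrite ge0_integralD//; try exact: measurable_funTS.
rewrite [(cdiff * _)%:E]EFinM -muleA; apply: lee_wpmul2l; first by rewrite lee_fin.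
rewrite EFinD ge0_muleDl ?lee_fin// mul1e leeD2l//.
by apply: (integral_average_le _ _ c01 dmu).
Qed.

Definition cenergy : R := (cdiff * (1 + c0) * cmass)%R.

Lemma cmass_ge0 : (0 <= cmass)%R.
Proof.
have c0_ge0 : (0 <= c0)%R by exact: le_trans ler01 c01.
have cA_ge0 : (0 <= cA)%R by exact: le_trans ler01 cA1.
rewrite /cmass divr_ge0 ?subr_ge0 ?(ltW (powR2N_lt1 theta0))//.
by rewrite mulr_ge0// mulr_ge0// exprn_ge0.
Qed.

Lemma besov_energy_extend_le (t : R) : (0 < t)%R ->
  besov_energy mu (~` Z) p (extend f) t <=
  cenergy%:E * \sum_(k <oo) ((2 `^ (- p)) ^+ k * (t * 2 ^+ k.+3) `^ theta)%:E *
    besov_energy nu Z p f (t * 2 ^+ (k + 6)).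
Proof.
move=> t0; have c0_ge0 : (0 <= c0)%R by exact: le_trans ler01 c01.
have e0 r : 0 <= besov_energy nu Z p f r.
  apply: integral_ge0 => v Zv; rewrite mule_ge0 ?inve_ge0//.
  by apply: integral_ge0 => w _; rewrite lee_fin powR_ge0.
apply: le_trans (besov_energy_extend t0) _.
rewrite /cenergy [(_ * cmass)%:E]EFinM -muleA; apply: lee_wpmul2l.
  by rewrite lee_fin mulr_ge0 ?cdiff_ge0// addr_ge0.
apply: le_trans (integral_osc_series t0) _.
rewrite -nneseriesZl ?lee_fin ?cmass_ge0//; last first.
  by move=> k _; rewrite mule_ge0// lee_fin mulr_ge0 ?exprn_ge0 ?powR_ge0.
rewrite le_eqVlt; apply/orP; left; apply/eqP; apply: eq_eseriesr => k _.
by rewrite muleA -EFinM muleA -EFinM; congr (_%:E * _); ring.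
Qed.

(** The Lipschitz estimate [extend_near_mean_dist] bounds the extension on a
    small ball of centre [x]. *)
Lemma integrable_extend x : ~ Z x -> exists2 r : R, (0 < r)%R &
  mu.-integrable (ball x r `&` ~` Z) (EFin \o extend f).
Proof.
move=> Zx; have d0 := delta_gt0 Zx; have d8 : (0 < delta x / 8)%R by rewrite divr_gt0.
exists (delta x / 8)%R => //.
have mB : measurable (ball x (delta x / 8) `&` ~` Z : set (borel X)) by exact: ball_setI_borel.
apply: measurable_bounded_integrable => //.
- by have [_ _] := dmu (I : [set: X] x) d8.
- by apply: measurable_funTS; exact: measurable_extend.
set m := mean_dist (ball x (4 * delta x) `&` Z) (extend f x).
have [z Zz xz] := nearly_closest Zx.
have m0 : 0 <= m by exact: mean_dist_ge0.
have moo : m < +oo.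
  have d6 : (0 < 6 * delta x)%R by rewrite mulr_gt0.
  have mS : measurable (ball x (4 * delta x) `&` Z : set (borel X)) by exact: ball_setI_borel.
  have sub : ball x (4 * delta x) `&` Z `<=` ball z (6 * delta x) `&` Z.
    move=> v [+ Zv]; rewrite !ball_mdist => xv; split => //; rewrite ball_mdist.
    by apply: le_lt_trans (metric_triangle _ x _) _; rewrite metric_sym; lra.
  have If' : nu.-integrable (ball x (4 * delta x) `&` Z) (EFin \o f).
    by apply: integrableS (If Zz d6) => //; exact: ball_setI_borel.
  have /integrableP[_] : nu.-integrable (ball x (4 * delta x) `&` Z)
      (EFin \o (fun v => f v - extend f x)%R).
    have Ic : nu.-integrable (ball x (4 * delta x) `&` Z) (cst (extend f x)%:E).
      apply: integrableS (_ : nu.-integrable (ball z (6 * delta x) `&` Z) _) => //.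
        exact: ball_setI_borel.
      apply: (@measurable_bounded_integrable _ _ _ nu (cst (extend f x)) _ (ball_setI_borel mZ z _)) => //.
        by case: (dnu Zz d6).
      exact: bounded_cst.
    by have := integrableB mS If' Ic; apply: eq_integrable.
  by rewrite /m /mean_dist => h; rewrite lte_mul_pinfty// lee_fin invr_ge0 fine_ge0.
exists (`|extend f x| + 6 * c1 ^+ 5 * 8^-1 * fine m)%R; split; first exact: num_real.
move=> M hM y /= [+ Zy]; rewrite ball_mdist => xy; apply: ltW; apply: le_lt_trans hM.
have c5 : (0 <= 6 * c1 ^+ 5)%R by rewrite mulr_ge0// exprn_ge0// ltW.
have yx : (mdist y x < delta x / 8)%R by rewrite metric_sym.
have le4 : (4 * (delta x / 8) <= delta x)%R by lra.
have := extend_near_mean_dist d8 Zy Zx yx le4.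
rewrite -/m -(fineK (_ : m \is a fin_num)) ?ge0_fin_numE// -EFinM lee_fin.
rewrite (_ : delta x / 8 / delta x = 8^-1)%R; last by field; rewrite gt_eqF.
move=> h; rewrite -lerBlDl; apply: le_trans h; exact: lerB_dist.
Qed.

(** * Traces *)

(** On [ball z r] the kernel only sees the boundary points of [ball z (4 * r)].
    The transfer to the collar of width [r] costs [r `^ theta], which the lower
    codimension bound compensates, and Jensen's inequality turns the mean of
    [`|f v - f z|] into an oscillation. *)
Lemma extend_trace_mean z (r : R) : Z z -> (0 < r)%R -> r%:E <= 2%:E * diam Z ->
  (r `^ theta * V z r <= cA * volume mu (~` Z) z r)%R ->
  ((volume mu (~` Z) z r)^-1)%:E *
    \int[mu]_(x in ball z r `&` ~` Z) `|extend f x - f z|%:E <=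
  (cmass * c1 ^+ 2 * cA)%:E * osc nu Z p f (4 * r) z `^ p^-1.
Proof.
move=> Zz r0 rD codim_z; set S := ball z (4 * r) `&` Z.
have r4 : (0 < 4 * r)%R by rewrite mulr_gt0.
have mS : measurable (S : set (borel X)) by exact: ball_setI_borel.
have [S0 _ Soo] := dnu Zz r4.
have V4 := volume_gt0 dnu Zz r4; have Vr := volume_gt0 dnu Zz r0.
have Wr := volume_gt0 dmu (Logic.I : [set: X] z) r0.
pose h v := `|f v - f z|%:E * (\1_[set v | (mdist z v < 4 * r)%R] v)%:E.
have h0 v : 0 <= h v by rewrite mule_ge0// lee_fin.
have mh : measurable_fun (setT : set (borel X)) (h : borel X -> \bar R).
  apply: emeasurable_funM.
    apply/measurable_EFinP; apply: measurableT_comp => //.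
    exact: measurable_funB.
  exact: (measurableT_comp (measurable_indic_mdist mdist_measurable (4 * r))
    (pair1_measurable (z : borel X))).
have Ih : \int[nu]_(v in Z) h v = (V z (4 * r))%:E * mean_dist S (f z).
  rewrite /mean_dist muleA -EFinM mulfV ?gt_eqF// mul1e.
  by rewrite [RHS](integral_ball nu Z z (4 * r) (fun v => `|f v - f z|%:E)).
have J : mean_dist S (f z) <= osc nu Z p f (4 * r) z `^ p^-1.
  rewrite -[leLHS](@poweRKV _ p)// ?mean_dist_ge0//.
  apply: poweR_le; rewrite ?invr_ge0 ?poweR_ge0// ?(ltW p0)//.
  apply: le_trans (mean_dist_powR (f z) mS S0 Soo) _.
  rewrite oscE -ge0_integralZl_EFin ?invr_ge0 ?(ltW V4)//.
  have h1 : measurable_fun (setT : set (borel X)) ((fun w => (`|f w - f z| `^ p)%:E) : borel X -> \bar R).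
    exact: (measurableT_comp (measurable_powR_diff p mf) (pair1_measurable (z : borel X))).
  exact: measurable_funTS.
apply: (@le_trans _ _ (((volume mu (~` Z) z r)^-1)%:E *
    ((cmass * r `^ theta)%:E * ((V z (4 * r))%:E * mean_dist S (f z))))).
  apply: lee_wpmul2l; first by rewrite lee_fin invr_ge0 ltW.
  rewrite -Ih; apply: le_trans (integral_average_kernel h0 mh r0).
  apply: (@le_trans _ _ (\int[mu]_(x in ball z r `&` ~` Z) average_kernel h x)).
    apply: le_integral_ge0 => [x _|x [+ Zx]]; first by rewrite lee_fin.
    rewrite ball_mdist => zx; apply: le_trans (extend_dist (f z) Zx) _.
    rewrite average_kernelE; apply: le_integral_ge0 => v Zv.
      by rewrite lee_fin mulr_ge0 ?kernel_ge0.
    have [xv|xv] := leP (3 * delta x)%R (mdist x v).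
      by rewrite (kernel_eq0 Zx xv) mul0r mul0e.
    rewrite EFinM; apply: lee_wpmul2l; first by rewrite lee_fin kernel_ge0.
    rewrite /h indicE mem_set ?mule1//=.
    have := dist_to_le Z0 x Zz; have := metric_triangle z x v.
    by rewrite [mdist x z]metric_sym; lra.
  apply: subset_integral_ge0 => [x _|x [+ Zx]]; first exact: average_kernel_ge0.
  rewrite ball_mdist => zx; have := dist_to_le Z0 x Zz; rewrite [mdist x z]metric_sym => dx.
  split => //; split; first exact: le_lt_trans dx zx.
  by apply: lt_le_trans rD; rewrite lte_fin; exact: le_lt_trans dx zx.
move: (mean_dist S (f z)) (mean_dist_ge0 S (f z)) J => md md0 J.
move: (cmass) cmass_ge0 => cm cm0.
rewrite !muleA -!EFinM; apply: lee_pmul => //.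
- by rewrite lee_fin mulr_ge0 ?(ltW V4)// mulr_ge0 ?invr_ge0 ?(ltW Wr)// mulr_ge0 ?cm0 ?powR_ge0.
- have V42 : (V z (4 * r) <= c1 ^+ 2 * V z r)%R.
    rewrite (_ : 4 * r = 2 ^+ 2 * r)%R; last by ring.
    exact: (volume_doubling c11 dnu).
  rewrite lee_fin -!mulrA ler_pdivrMl//.
  apply: (@le_trans _ _ (cm * (c1 ^+ 2 * (r `^ theta * V z r)))%R).
    rewrite ler_wpM2l ?cm0// mulrCA ler_wpM2l ?powR_ge0//.
  apply: (@le_trans _ _ (cm * (c1 ^+ 2 * (cA * volume mu (~` Z) z r)))%R).
    by rewrite ler_wpM2l ?cm0// ler_wpM2l// exprn_ge0// ltW.
  by rewrite le_eqVlt; apply/orP; left; apply/eqP; ring.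
Qed.

(** The sum over [k] of the oscillations at the scales [2^-1 ^+ k] has a finite
    integral, so almost everywhere its terms tend to 0; doubling fills in the
    radii between two such scales. *)
Lemma ae_osc_small : \sum_(k <oo) besov_energy nu Z p f (2^-1 ^+ k) < +oo ->
  {ae nu, forall z, Z z -> forall e : R, (0 < e)%R ->
     exists2 d : R, (0 < d)%R & forall r, (0 < r)%R -> (r < d)%R -> osc nu Z p f r z <= e%:E}.
Proof.
move=> Efin; have h0 k : (0 < (2^-1 : R) ^+ k)%R by rewrite exprn_gt0.
pose s z := \sum_(k <oo) osc nu Z p f (2^-1 ^+ k) z.
have s0 z : 0 <= s z by apply: nneseries_ge0 => k _ _; exact: osc_ge0.
have mo k : measurable_fun (setT : set (borel X)) (osc nu Z p f (2^-1 ^+ k) : borel X -> \bar R).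
  exact: measurable_osc.
have ms : measurable_fun (setT : set (borel X)) (s : borel X -> \bar R).
  apply: (@ge0_emeasurable_sum _ (borel X) R setT (fun k z => osc nu Z p f (2^-1 ^+ k) z) xpredT).
    by move=> k z _ _; exact: osc_ge0.
  by move=> k _.
have Is : nu.-integrable Z (s : borel X -> \bar R).
  apply/integrableP; split; first exact: measurable_funTS.
  under eq_integral do rewrite gee0_abs//.
  apply: le_lt_trans Efin; rewrite /s integral_nneseries//; last 2 first.
  - by move=> k; exact: measurable_funTS.
  - by move=> k z _; exact: osc_ge0.
  rewrite le_eqVlt; apply/orP; left; apply/eqP; apply: eq_eseriesr => k _.
  by rewrite (besov_energyE _ dnu).
have := integrable_ae mZ Is.
apply: (@filterS _ _ (ae_filter_ringOfSetsType nu)) => z szfin Zz e e0.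
have sz : s z < +oo by rewrite -ge0_fin_numE//; exact: szfin.
have ec : (0 < e / c1)%R by rewrite divr_gt0.
have /fine_cvgP[[N1 _ fin] /cvgrPdist_le/(_ _ ec)[N2 _ hN]] :=
  nneseries_tail_cvg sz (fun k _ => osc_ge0 nu Z p f (2^-1 ^+ k) z).
pose N := maxn N1 N2.
have small k : (N <= k)%N -> osc nu Z p f (2^-1 ^+ k) z <= (e / c1)%:E.
  rewrite geq_max => /andP[k1 k2]; have := hN k k2; have := fin k k1 => /= {}fin.
  rewrite sub0r normrN ger0_norm ?fine_ge0//; last first.
    by apply: nneseries_ge0 => i _ _; exact: osc_ge0.
  rewrite -lee_fin fineK// => h; apply: le_trans h.
  apply: le_trans (@nneseries_lim_ge _ _ xpredT k k.+1 _); first by rewrite big_nat1.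
  by move=> i _ _; exact: osc_ge0.
exists (2^-1 ^+ N)%R => // r r0 rN.
have [n /andP[n1 n2]] := dyadic_floor r0.
have nN : (n + 1 <= - N%:Z)%R.
  have : (2 ^ n < 2 ^ (- N%:Z) :> R)%R.
    by apply: le_lt_trans n1 _; rewrite -exprz_inv -exprnP.
  by rewrite ltr_eXz2l ?ltr1n//; clear; lia.
pose j := `|(n + 1)%R|%N.
have jE : (n + 1 = - j%:Z)%R by rewrite /j; move: nN; clear; lia.
have Nj : (N <= j)%N by rewrite /j; move: nN; clear; lia.
have n2' : (2 * 2 ^ n = 2^-1 ^+ j :> R)%R by rewrite -exprz2S jE -exprz_inv -exprnP.
apply: le_trans (osc_le _ c11 dnu _ _ Zz r0 (_ : (r <= 2^-1 ^+ j)%R) _) _ => //.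
- by rewrite -n2' -exprz2S ltW.
- by rewrite -n2' ler_pM2l.
apply: le_trans (lee_wpmul2l _ (small j Nj)) _; first by rewrite lee_fin ltW.
by rewrite -EFinM lee_fin mulrC divfK// gt_eqF.
Qed.

Lemma extend_trace :
  (forall z (r : R), Z z -> (0 < r)%R -> r%:E <= 2%:E * diam Z ->
    (r `^ theta * V z r <= cA * volume mu (~` Z) z r)%R) ->
  0 < diam Z -> \sum_(k <oo) besov_energy nu Z p f (2^-1 ^+ k) < +oo ->
  {ae nu, forall z, Z z ->
    (mu (ball z r `&` ~` Z))^-1 *
      \int[mu]_(x in ball z r `&` ~` Z) `|extend f x - f z|%:E
    @[r --> (0:R)^'+] --> (0 : \bar R)}.
Proof.
move=> codim' D0 Efin; have := ae_osc_small Efin.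
apply: (@filterS _ _ (ae_filter_ringOfSetsType nu)) => z h Zz; have {}h := h Zz.
set c := (cmass * c1 ^+ 2 * cA)%R.
have cA_gt0 : (0 < cA)%R := lt_le_trans ltr01 cA1.
have c_ge0 : (0 <= c)%R by rewrite mulr_ge0 ?(ltW cA_gt0)// mulr_ge0 ?cmass_ge0 ?exprn_ge0// ltW.
have c2 : (0 < c + 1)%R by rewrite ltr_wpDl.
have [D D1 D2] : exists2 D : R, (0 < D)%R & forall r, (r < D)%R -> r%:E <= 2%:E * diam Z.
  case: (diam Z) D0 => [D| |]// D0; last by exists 1%R => // r _; rewrite gt0_muley// leey.
  by exists D => // r rD; rewrite -EFinM lee_fin; rewrite lte_fin in D0; lra.
apply: cvg0_at_right => [r r0|e e0].
  rewrite mule_ge0 ?inve_ge0//; exact: integral_ge0.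
have e1 : (0 < (e / (c + 1)) `^ p)%R by rewrite powR_gt0// divr_gt0.
have [d d0 hd] := h _ e1.
exists (Num.min (d / 4) D)%R; first by rewrite lt_min D1 divr_gt0.
move=> r r0; rewrite lt_min => /andP[rd rD].
rewrite (measure_inveE dmu)//.
apply: le_trans (extend_trace_mean Zz r0 (D2 _ rD) (codim' _ _ Zz r0 (D2 _ rD))) _.
have r4 : (0 < 4 * r)%R by rewrite mulr_gt0.
have r4d : (4 * r < d)%R by lra.
apply: le_trans (lee_wpmul2l _ (poweR_le _ (osc_ge0 _ _ _ _ _ _) (hd _ r4 r4d))) _.
- by rewrite lee_fin.
- by rewrite invr_ge0 ltW.
rewrite poweR_EFin -powRrM mulfV ?gt_eqF// powRr1 ?divr_ge0 ?(ltW e0) ?(ltW c2)//.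
by rewrite -EFinM lee_fin mulrCA ger_pMr// ler_pdivrMr// mul1r lerDl.
Qed.

End extend.
End kernel.

(** * The extension of Besov functions *)

Section boundary_functions.
Context {R : realType} {X : completeMetricType R}.
Context (Z : set X) (nu : {measure set (borel X) -> \bar R}) (c1 p : R).
Hypotheses (cZ : closed Z) (c11 : 1 <= c1) (dnu : doubling_centers nu Z Z c1).
Hypotheses (snu : sigma_finite setT nu).
Hypothesis mdist_measurable :
  measurable_fun [set: borel X * borel X] (fun z => mdist (z.1 : X) (z.2 : X)).
Hypothesis p1 : 1 <= p.

Let mZ : measurable (Z : set (borel X)). Proof. exact: closed_borel. Qed.

Local Open Scope ereal_scope.

Lemma besov_energy_ge0 m (A : set X) f t : 0 <= besov_energy m A p f t.
Proof.
apply: integral_ge0 => v _; rewrite mule_ge0 ?inve_ge0//.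
by apply: integral_ge0 => w _; rewrite lee_fin powR_ge0.
Qed.

(** If the energy at a large scale is finite, some point [v] of the ball has a
    finite oscillation at this scale, and then [`|f w - f v| `^ p] is integrable
    near [v]. *)
Lemma integrable_balls_energy (f : X -> R) :
  measurable_fun (setT : set (borel X)) (f : borel X -> R) ->
  (forall n : int, besov_energy nu Z p f (2 ^ n)%R < +oo) -> integrable_balls Z nu f.
Proof.
move=> mf efin z r Zz r0; have r20 : (0 < 2 * r)%R by rewrite mulr_gt0.
have [n /andP[_ rn]] := dyadic_floor r20.
have := efin (n + 1)%R; set s := (2 ^ (n + 1))%R in rn *.
have s0 : (0 < s)%R by exact: exprz2_gt0.
rewrite (besov_energyE _ dnu)// => Ioo.
set B := ball z r `&` Z.
have mB : measurable (B : set (borel X)) by exact: ball_setI_borel.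
have [B0 _ Boo] := dnu Zz r0.
have [v [zv Zv] oscv] : exists2 v, B v & osc nu Z p f s v < +oo.
  apply: contrapT => nv; move: Ioo; apply/negP; rewrite -leNgt.
  apply: (@le_trans _ _ (\int[nu]_(v in B) (cst +oo v))).
    by rewrite integral_cst// gt0_mulye.
  apply: (@le_trans _ _ (\int[nu]_(v in B) osc nu Z p f s v)).
    apply: le_integral_ge0 => [v _|v Bv]; first by rewrite /= leey.
    by rewrite /= leye_eq -[_ == _]negbK -ltey; apply/negP => h; apply: nv; exists v.
  by apply: subset_integral_ge0 => [v _|v []//]; exact: osc_ge0.
have Vv := volume_gt0 dnu Zv s0.
have mfv : measurable_fun (setT : set (borel X))
    ((fun w => (`|f w - f v| `^ p)%:E) : borel X -> \bar R).
  exact: (measurableT_comp (measurable_powR_diff p mf) (pair1_measurable (v : borel X))).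
have Jfin : \int[nu]_(w in B) (`|f w - f v| `^ p)%:E < +oo.
  apply: (@le_lt_trans _ _ (\int[nu]_(w in ball v s `&` Z) (`|f w - f v| `^ p)%:E)).
    apply: subset_integral_ge0 => [w _|w [+ Zw]]; first by rewrite lee_fin powR_ge0.
    move: zv; rewrite !ball_mdist => zv zw; split => //; rewrite ball_mdist.
    apply: le_lt_trans (metric_triangle _ z _) _; rewrite metric_sym; lra.
  move: oscv; rewrite oscE; set J := integral _ _ _.
  have J0 : 0 <= J by apply: integral_ge0 => w _; rewrite lee_fin powR_ge0.
  rewrite !ltey; apply: contra => /eqP ->.
  by rewrite gt0_muley// lte_fin invr_gt0.
apply/integrableP; split; first by apply/measurable_EFinP; exact: measurable_funTS.
apply: (@le_lt_trans _ _ (\int[nu]_(w in B) ((`|f v| + 1)%:E + (`|f w - f v| `^ p)%:E))).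
  apply: le_integral_ge0 => // w _; rewrite -EFinD lee_fin /=.
  have h : (`|f w| <= `|f v| + `|f w - f v|)%R.
    by rewrite -{1}(subrK (f v) (f w)) addrC; exact: ler_normD.
  have [d1|d1] := leP 1%R (`|f w - f v|)%R; last first.
    have := powR_ge0 (`|f w - f v|)%R p; lra.
  have : (`|f w - f v| `^ 1 <= `|f w - f v| `^ p)%R by apply: ler_powR.
  rewrite powRr1//; lra.
rewrite ge0_integralD//; last exact: measurable_funTS.
rewrite integral_cst//; apply: lte_add_pinfty => //.
by rewrite lte_mul_pinfty// lee_fin addr_ge0.
Qed.

Lemma doubling_besov_energy m (A S : set X) c (f : X -> R) :
  measurable (A : set (borel X)) -> A `<=` S -> (1 <= c)%R -> doubling_centers m A S c ->
  sigma_finite setT m ->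
  measurable_fun (setT : set (borel X)) (f : borel X -> R) ->
  doubling_energy c (besov_energy m A p f).
Proof.
move=> mA AS c_ge1 dm sm mf; split => [t|t u t0 tu ut]; first exact: besov_energy_ge0.
exact: (besov_energy_le mA AS c_ge1 dm).
Qed.

Lemma besov_energy_restrict m (A : set X) f :
  besov_energy m A p (f \_ A) = besov_energy m A p f.
Proof.
apply/funext => t; apply: eq_integral => x xA; congr (_ * _).
apply: eq_integral => y /set_mem[_ Ay].
by rewrite !patchE xA mem_set.
Qed.

Lemma extend_restrict f : extend Z nu (f \_ Z) = extend Z nu f.
Proof.
rewrite extend.unlock; apply/funext => x; congr fine.
by apply: eq_integral => v vZ; rewrite patchE vZ.
Qed.

End boundary_functions.

Section whitney_extension.
Context {R : realType} {X : completeMetricType R}.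
Context (Omega : set X) (mu nu : {measure set (borel X) -> \bar R}).
Context (alpha p theta Cmu Ctheta : R) (q : \bar R).
Hypotheses (halpha : 0 < alpha) (hp : 1 <= p) (hq : (1%:E <= q)%E) (htheta : 0 < theta).
Hypotheses (hCmu : 1 <= Cmu) (hCtheta : 1 <= Ctheta).
Hypotheses (dO : dense Omega) (oO : open Omega) (Z0 : boundary Omega !=set0).
Hypotheses (mu0 : mu (boundary Omega) = 0%E) (dbl : doubling mu Omega Cmu).
Hypotheses (nu0 : nu Omega = 0%E) (codim : codim_Ahlfors_regular mu nu Omega theta Ctheta).
Hypothesis D0 : (0 < diam (boundary Omega))%E.

Let Z := boundary Omega.
Let c0 := Cmu ^+ 3.
Let c1 := Ctheta * Ctheta * c0.

Let cZ : closed Z. Proof. exact: open_closedC. Qed.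
Let ZC : ~` Z = Omega. Proof. exact: setCK. Qed.
Let mO : measurable (Omega : set (borel X)). Proof. exact: open_borel. Qed.
Let mZ : measurable (Z : set (borel X)). Proof. exact: closed_borel. Qed.
Let c01 : 1 <= c0. Proof. exact: exprn_ege1. Qed.
Let c11 : 1 <= c1. Proof. by rewrite !mulr_ege1. Qed.

Let dmu0 : doubling_centers mu Omega setT c0. Proof. exact: doubling_dense. Qed.
Let dmu : doubling_centers mu (~` Z) setT c0. Proof. by rewrite ZC. Qed.
Let dnu : doubling_centers nu Z Z c1.
Proof. exact: (doubling_boundary hCtheta c01 dmu0 codim htheta D0). Qed.

Let smu : sigma_finite setT mu.
Proof.
have [z _] := Z0; apply: (@sigma_finite_balls _ _ mu Omega z) => // r r0.
by have [] := dmu0 (I : [set: X] z) r0.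
Qed.

Let snu : sigma_finite setT nu.
Proof.
have [z Zz] := Z0; apply: (@sigma_finite_balls _ _ nu Z z) => // [r r0|].
  by have [] := dnu Zz r0.
by rewrite ZC.
Qed.

Let mdist_measurable :
  measurable_fun [set: borel X * borel X] (fun z => mdist (z.1 : X) (z.2 : X)).
Proof.
have [|D cD sD] := @positive_measure_separable _ _ mu Omega dO mO.
  by move=> x r _ r0; have [? _ ?] := dmu0 (I : [set: X] x) r0.
exact: measurable_mdist cD sD.
Qed.

Let upper v (r : R) : Z v -> 0 < r -> (r%:E <= 2%:E * diam Z)%E ->
  volume mu (~` Z) v r <= Ctheta * (r `^ theta * volume nu Z v r).
Proof. by rewrite ZC => Zv r0 rD; have [] := codim_volume hCtheta dmu0 codim Zv r0 rD. Qed.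

Let lower v (r : R) : Z v -> 0 < r -> (r%:E <= 2%:E * diam Z)%E ->
  r `^ theta * volume nu Z v r <= Ctheta * volume mu (~` Z) v r.
Proof. by rewrite ZC => Zv r0 rD; have [] := codim_volume hCtheta dmu0 codim Zv r0 rD. Qed.

(** A function of the Besov space is only known on the boundary. Its extension
    by 0 has the same energies and the same extension to Omega, and it is
    measurable everywhere. *)
Let besov_regular f : besov nu Z alpha p q f ->
  [/\ measurable_fun (setT : set (borel X)) ((f \_ Z) : borel X -> R),
      integrable_balls Z nu (f \_ Z),
      doubling_energy c1 (besov_energy nu Z p f) &
      (\sum_(k <oo) besov_energy nu Z p f (2^-1 ^+ k) < +oo)%E].
Proof.
move=> [[mf _] ffin].
have mf' : measurable_fun (setT : set (borel X)) ((f \_ Z) : borel X -> R).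
  exact: (measurable_restrictT _ mZ).1 mf.
have de : doubling_energy c1 (besov_energy nu Z p f).
  rewrite -besov_energy_restrict.
  exact: (doubling_besov_energy p mdist_measurable mZ (@subset_refl _ Z)).
split => //; last exact: (energy_summable hp halpha c11 hq de ffin).
apply: (integrable_balls_energy cZ dnu (p := p)) => // n.
by rewrite besov_energy_restrict; exact: (energy_fin hp halpha c11 hq de ffin).
Qed.

Lemma extend_extension_operator :
  extension_operator mu nu Omega (besov nu Z alpha p q) (extend Z nu).
Proof.
split.
- move=> f g [[mf _] _] [[mg _] _] fg; apply: aeW => x _.
  rewrite extend.unlock; congr fine; apply: ae_eq_integral => //.
  + apply/measurable_EFinP; apply: measurable_funM => //.
    by apply: measurable_funTS; exact: measurable_kernelr.
  + apply/measurable_EFinP; apply: measurable_funM => //.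
    by apply: measurable_funTS; exact: measurable_kernelr.
  move: fg; apply: (@filterS _ _ (ae_filter_ringOfSetsType nu)) => v fg Zv.
  by rewrite fg.
- move=> a f g /besov_regular[mf If _ _] /besov_regular[mg Ig _ _] x Ox.
  have Zx : ~ Z x by move=> /(_ Ox).
  have If' := integrable_kernel cZ Z0 snu mdist_measurable mf If Zx.
  have Ig' := integrable_kernel cZ Z0 snu mdist_measurable mg Ig Zx.
  rewrite -(extend_restrict Z nu f) -(extend_restrict Z nu g).
  apply: EFin_inj; rewrite EFinD EFinM.
  rewrite (extendE cZ Z0 snu mdist_measurable mf If Zx).
  rewrite (extendE cZ Z0 snu mdist_measurable mg Ig Zx).
  rewrite -integralZl// -integralD//; last exact: integrableZl.
  rewrite extend.unlock; transitivity (fine (\int[nu]_(v in Z)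
    (a%:E * (extension_kernel Z nu x v * (f \_ Z) v)%:E +
     (extension_kernel Z nu x v * (g \_ Z) v)%:E)))%:E%E.
    congr (fine _)%:E; apply: eq_integral => v vZ.
    by rewrite !patchE vZ -EFinM -EFinD /=; congr EFin; ring.
  rewrite fineK//; apply: integrable_fin_num => //.
  by apply: integrableD => //; exact: integrableZl.
- move=> f /besov_regular[mf If _ Ef]; rewrite -(extend_restrict Z nu f).
  have := extend_trace cZ Z0 c01 c11 hCtheta dmu dnu smu snu mdist_measurable
    htheta upper mf If hp lower D0.
  rewrite besov_energy_restrict => /(_ Ef).
  apply: (@filterS _ _ (ae_filter_ringOfSetsType nu)) => z + Zz => /(_ Zz).
  by rewrite ZC patchE mem_set.
Qed.

Lemma extend_besov (C : R) : 0 <= C -> alpha + theta / p < 1 ->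
  (forall e g : R -> \bar R, doubling_energy c1 e -> doubling_energy c0 g ->
    (forall t, 0 < t -> (g t <= (cenergy theta c0 c1 Ctheta p)%:E *
      \sum_(k <oo) ((2 `^ (- p)) ^+ k * (t * 2 ^+ k.+3) `^ theta)%:E *
      e (t * 2 ^+ (k + 6))%R)%E) ->
  (energy_seminorm (alpha + theta / p) p q g <= C%:E * energy_seminorm alpha p q e)%E) ->
  forall f, besov nu Z alpha p q f ->
    besov mu Omega (alpha + theta / p) p q (extend Z nu f) /\
    (besov_seminorm mu Omega (alpha + theta / p) p q (extend Z nu f) <=
      C%:E * besov_seminorm nu Z alpha p q f)%E.
Proof.
move=> C0 s1 hC f bf; have [mf If de _] := besov_regular bf.
have mF := measurable_extend cZ Z0 snu mdist_measurable mf.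
have le : (besov_seminorm mu Omega (alpha + theta / p) p q (extend Z nu f) <=
    C%:E * besov_seminorm nu Z alpha p q f)%E.
  rewrite !besov_seminormE; apply: hC => //.
    rewrite -extend_restrict.
    exact: (doubling_besov_energy p mdist_measurable mO (@subsetT _ _)).
  move=> t t0; rewrite -extend_restrict -(besov_energy_restrict p nu Z f) -ZC.
  exact: (besov_energy_extend_le cZ Z0 c01 c11 hCtheta dmu dnu smu snu mdist_measurable
    htheta upper mf If hp t0).
split => //; split; last first.
  apply: le_lt_trans le _; have [_ ffin] := bf.
  by rewrite lte_mul_pinfty// ?lee_fin// besov_seminormE energy_seminorm_ge0//; have [] := de.
rewrite -extend_restrict; split; first exact: measurable_funTS.
move=> x Ox; have Zx : ~ Z x by move=> /(_ Ox).
have := integrable_extend cZ Z0 c11 dmu dnu snu mdist_measurable mf If Zx.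
by rewrite ZC.
Qed.

End whitney_extension.

(** * Boundaries reduced to a point *)

Section point_boundary.
Context {R : realType} {X : completeMetricType R}.
Context (Omega : set X) (mu nu : {measure set (borel X) -> \bar R}) (z : X).
Hypotheses (mO : measurable (Omega : set (borel X))) (bz : boundary Omega = [set z]).
Local Open Scope ereal_scope.

(** If the point has measure 0 the value of [f] there is not determined by its
    class modulo almost everywhere equality, hence the value 0. *)
Definition constant_extension (f : X -> R) (x : X) : R :=
  if 0 < nu [set z] then f z else 0%R.

Let mz : measurable ([set z] : set (borel X)).
Proof. by rewrite -bz; exact: (@measurableC _ (borel X)). Qed.

Lemma constant_extension_operator (D : set (X -> R)) :
  extension_operator mu nu Omega D constant_extension.
Proof.
split.
- move=> f g _ _ [N [mN N0 fgN]]; apply: aeW => x _; rewrite /constant_extension.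
  case: ifPn => // z0; apply: contrapT => fgz; move: z0; apply/negP; rewrite -leNgt -N0.
  apply: le_measure; [exact/mem_set|exact/mem_set|].
  by move=> _ ->; apply: fgN => /= h; apply/fgz/h; rewrite bz.
- move=> a f g _ _ x _; rewrite /constant_extension; case: ifP => //= _.
  by rewrite mulr0 addr0.
- move=> f _; have [z0|z0] := boolP (0 < nu [set z]).
    apply: aeW => w; rewrite bz => ->.
    rewrite (_ : (fun r => _) = cst 0); first exact: cvg_cst.
    apply/funext => r; rewrite integral0_eq ?mule0// => x _.
    by rewrite /constant_extension z0 subrr normr0.
  exists [set z]; split => //.
    by apply/eqP; rewrite eq_le measure_ge0 andbT leNgt.
  by move=> w /= /not_implyP[]; rewrite bz.
Qed.

Lemma constant_extension_besov (C s p : R) q f : (0 < p)%R -> 1%:E <= q ->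
  doubling mu Omega C ->
  besov mu Omega s p q (constant_extension f) /\
  besov_seminorm mu Omega s p q (constant_extension f) = 0.
Proof.
move=> p0 q1 dbl.
have S0 : besov_seminorm mu Omega s p q (constant_extension f) = 0.
  rewrite besov_seminormE; apply: energy_seminorm0 => // t t0.
  apply: integral0_eq => x _; rewrite integral0_eq ?mule0// => y _.
  by rewrite /constant_extension subrr normr0 powR0 ?gt_eqF.
split => //; split; last by rewrite S0.
split; first exact: measurable_cst.
move=> x Ox; exists 1%R => //; apply: measurable_bounded_integrable.
- by apply: measurableI => //; exact: ball_borel.
- by have [_ _] := dbl _ _ Ox (@ltr01 R).
- exact: measurable_cst.
- exact: bounded_cst.
Qed.

End point_boundary.

Lemma diam0_point (R : realType) (X : completeMetricType R) (Z : set X) z :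
  Z z -> (diam Z <= 0)%E -> Z = [set z].
Proof.
move=> Zz D0; apply/seteqP; split => [x Zx|_ ->//]; apply: mdist_positivity.
apply/eqP; rewrite eq_le mdist_ge0 andbT -lee_fin.
exact: le_trans (mdist_diam Zx Zz) D0.
Qed.

Theorem theorem1p6 (R : realType) (alpha p theta : R) (q : \bar R)
    (Cmu Ctheta : R)
    (halpha : 0 < alpha < 1) (hp : 1 <= p) (hq : (1%:E <= q)%E)
    (htheta : 0 < theta) (halphap : alpha < 1 - theta / p)
    (hCmu : 1 <= Cmu) (hCtheta : 1 <= Ctheta) :
  exists2 C : R, 1 <= C &
    forall (X : completeMetricType R) (Omega : set X)
      (mu nu : {measure set (borel X) -> \bar R}),
    dense Omega ->
    locally_compact [set: set_type Omega] ->
    ~ complete_space (set_type Omega) ->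
    mu (boundary Omega) = 0%E ->
    doubling mu Omega Cmu ->
    nu Omega = 0%E ->
    codim_Ahlfors_regular mu nu Omega theta Ctheta ->
    exists E : (X -> R) -> (X -> R),
      extension_operator mu nu Omega
        (besov nu (boundary Omega) alpha p q) E /\
      forall f, besov nu (boundary Omega) alpha p q f ->
        besov mu Omega (alpha + theta / p) p q (E f) /\
        (besov_seminorm mu Omega (alpha + theta / p) p q (E f)
           <= C%:E * besov_seminorm nu (boundary Omega) alpha p q f)%E.
Proof.
have [alpha0 _] := andP halpha.
have s1 : alpha + theta / p < 1 by rewrite -ltrBrDr.
pose c0 := Cmu ^+ 3; pose c1 := Ctheta * Ctheta * c0.
have c01 : 1 <= c0 by exact: exprn_ege1.
have c11 : 1 <= c1 by rewrite !mulr_ege1.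
have K0 : 0 <= cenergy theta c0 c1 Ctheta p.
  rewrite mulr_ge0 ?(cmass_ge0 c01 c11 hCtheta htheta)//.
  by rewrite mulr_ge0 ?cdiff_ge0// addr_ge0// (le_trans ler01).
have [C C1 hC] := energy_seminorm_le hp alpha0 c11 hq htheta s1 c01 K0.
have C0 : 0 <= C by exact: le_trans ler01 C1.
exists C => // X Omega mu nu dO lcO ncO mu0 dbl nu0 codim.
have oO := locally_compact_dense_open dO lcO.
have Z0 := not_complete_boundary ncO.
have [D0|D0] := ltP 0%E (diam (boundary Omega)).
  exists (extend (boundary Omega) nu); split.
    exact: (extend_extension_operator alpha0 hp hq htheta hCmu hCtheta dO oO Z0 mu0 dbl nu0 codim D0).
  exact: (extend_besov alpha0 hp hq htheta hCmu hCtheta dO oO Z0 mu0 dbl nu0 codim D0 C0 s1 hC).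
have [z Zz] := Z0; have bz := diam0_point Zz D0.
have mO := open_borel oO.
exists (constant_extension nu z); split; first exact: constant_extension_operator.
move=> f _; have p0 : 0 < p := lt_le_trans ltr01 hp.
have [bE ->] := constant_extension_besov nu z mO (alpha + theta / p) f p0 hq dbl.
split => //; rewrite mule_ge0 ?lee_fin// besov_seminormE energy_seminorm_ge0// => t.
exact: besov_energy_ge0.
Qed.
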